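(* For every $n\geq 3$, there exists a discrete biparametric family of closed non-CMC biconservative rotational hypersurfaces $M^{n-1}$ in the round sphere $\mathbb{S}^n(\rho)$. However, none of these hypersurfaces are embedded in $\mathbb{S}^n(\rho)$.
   Context: For $\rho>0$, $\mathbb{S}^n(\rho)$ is the $n$-dimensional round sphere of constant sectional curvature $\rho$. Hypersurfaces are immersed and oriented; closed means compact without boundary. With unit normal vector field $\eta$, shape operator $S_\eta$ and mean curvature function $H=\mathrm{trace}\,S_\eta/(n-1)$, a hypersurface $M^{n-1}$ of $\mathbb{S}^n(\rho)$ is biconservative if $2S_\eta(\mathrm{grad}\,H)+(n-1)H\,\mathrm{grad}\,H=0$; non-CMC means that $H$ is not constant. A (spherical) rotational hypersurface is one invariant by the orthogonal group $O(n-1)$, considered as a subgroup of isometries of $\mathbb{S}^n(\rho)$ whose orbits are $(n-2)$-dimensional spheres; it is the evolution under the action of $O(n-1)$ of an arc length parametrized curve in $\mathbb{S}^2(\rho)$, called its profile curve. A discrete biparametric family is a family whose members are indexed by two discrete (natural number) parameters. *)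

(* Defs.v *)
(* Immersed hypersurfaces M^(n-1) of the round sphere S^n(rho), realised as the
   sphere of radius 1 / sqrt rho centred at 0 in R^(n+1).
   Vectors are row vectors, so matrices act on the right. *)
From HB Require Import structures.
From mathcomp Require Import all_boot all_order all_algebra.
From mathcomp Require Import all_classical all_reals all_analysis.
Import Order.TTheory GRing.Theory Num.Theory.
Import numFieldNormedType.Exports.

Set Implicit Arguments.
Unset Strict Implicit.
Unset Printing Implicit Defensive.

Local Open Scope classical_set_scope.
Local Open Scope ring_scope.

Section Calculus.
Variable R : realType.

(* Class C^k on an open set U (the space V being finite dimensional): all
   iterated directional derivatives of order <= k exist on U and those of order
   k are continuous on U. *)
Fixpoint class_C (V W : normedModType R) (k : nat) (U : set V) (f : V -> W) :
    Prop :=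
  match k with
  | 0 => forall x, U x -> {for x, continuous f}
  | k'.+1 => forall v : V, (forall x, U x -> derivable f x v) /\
                           class_C k' U ('D_v f)
  end.

Definition smooth_on (V W : normedModType R) (U : set V) (f : V -> W) : Prop :=
  forall k, class_C k U f.

(* The library's jacobian is restricted to nonzero dimensions, which does not
   fit the dimension n.-1 used below; the convention is the same. *)
Definition jac (d N : nat) (f : 'rV[R]_d -> 'rV[R]_N) (u : 'rV[R]_d) :
    'M[R]_(d, N) :=
  \matrix_(i < d) 'D_(delta_mx 0 i) f u.

Definition dot (N : nat) (u v : 'rV[R]_N) : R := \sum_(i < N) u 0 i * v 0 i.

Definition orthogonal_mx (N : nat) (A : 'M[R]_N) : Prop := A *m A^T = 1%:M.

Definition round_sphere (n : nat) (rho : R) : set 'rV[R]_n.+1 :=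
  [set x | dot x x = rho^-1].

End Calculus.

(* A connected manifold of dimension n - 1 with a smooth immersion into
   S^n(rho).  The charts are given by their inverses par i, defined on the open
   sets dom i.  Smoothness of the transition maps is not a field: it follows
   from the fact that every imm \o par i is a smooth immersion and that the
   transition maps are homeomorphisms.  Second countability is automatic in the
   compact case, the only one used. *)
Record hypersurface (R : realType) (n : nat) (rho : R) := Hypersurface {
  carrier :> topologicalType;
  imm : carrier -> 'rV[R]_n.+1;
  chart : Type;
  dom : chart -> set 'rV[R]_n.-1;
  par : chart -> 'rV[R]_n.-1 -> carrier;
  carrier_hausdorff : hausdorff_space carrier;
  carrier_connected : connected [set: carrier];
  dom_open : forall i, open (dom i);
  par_continuous : forall i u, dom i u -> {for u, continuous (par i)};
  par_inj : forall i u v, dom i u -> dom i v -> par i u = par i v -> u = v;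
  par_open : forall i (A : set 'rV[R]_n.-1), open A -> A `<=` dom i ->
    open (par i @` A);
  par_cover : forall x, exists i, exists2 u, dom i u & par i u = x;
  imm_sphere : forall x, round_sphere rho (imm x);
  imm_smooth : forall i, smooth_on (dom i) (imm \o par i);
  imm_immersion : forall i u, dom i u -> row_free (jac (imm \o par i) u)
}.

Section Hypersurfaces.
Variables (R : realType) (n : nat) (rho : R) (M : hypersurface n rho).

Definition closed_hypersurface : Prop := compact [set: M].

(* A unit normal vector field of M in the sphere; it orients M. *)
Definition unit_normal (eta : M -> 'rV[R]_n.+1) : Prop :=
  [/\ forall x, dot (eta x) (eta x) = 1,
      forall x, dot (eta x) (imm x) = 0,
      forall (i : chart M) u, dom i u ->
        jac (@imm _ _ _ M \o par i) u *m (eta (par i u))^T = 0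
    & forall i : chart M, smooth_on (dom i) (eta \o par i)].

Section Curvature.
Variables (eta : M -> 'rV[R]_n.+1) (i : chart M).

(* Row k is the k-th coordinate vector field of the chart. *)
Definition tangent_frame (u : 'rV[R]_n.-1) : 'M[R]_(n.-1, n.+1) :=
  jac (@imm _ _ _ M \o par i) u.

Definition metric (u : 'rV[R]_n.-1) : 'M[R]_n.-1 :=
  tangent_frame u *m (tangent_frame u)^T.

(* The matrix of S_eta(X) = - nabla_X eta in the coordinate frame: row k holds
   the coordinates of S_eta applied to the k-th coordinate vector field.  For J
   the tangent frame, w *m J^T *m (J *m J^T)^-1 are the coordinates of the
   orthogonal projection of w to the tangent space of M; this projection
   turns the derivative in R^(n+1) into the covariant derivative of the sphere,
   as the derivative of eta has no component along imm or along eta. *)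
Definition shape (u : 'rV[R]_n.-1) : 'M[R]_n.-1 :=
  - jac (eta \o par i) u *m (tangent_frame u)^T *m invmx (metric u).

Definition mean_curvature (u : 'rV[R]_n.-1) : R := \tr (shape u) / n.-1%:R.

Definition grad_mean_curvature (u : 'rV[R]_n.-1) : 'rV[R]_n.-1 :=
  (\row_k 'D_(delta_mx 0 k) mean_curvature u) *m invmx (metric u).

End Curvature.

Definition biconservative (eta : M -> 'rV[R]_n.+1) : Prop :=
  forall (i : chart M) u, dom i u ->
    2%:R *: (grad_mean_curvature eta i u *m shape eta i u)
    + (n.-1%:R * mean_curvature eta i u) *: grad_mean_curvature eta i u = 0.

Definition CMC (eta : M -> 'rV[R]_n.+1) : Prop :=
  exists c : R, forall (i : chart M) u, dom i u -> mean_curvature eta i u = c.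

Definition is_embedding : Prop :=
  [/\ continuous (@imm _ _ _ M), injective (@imm _ _ _ M)
    & forall A : set M, open A ->
        exists2 B : set 'rV[R]_n.+1, open B & A = @imm _ _ _ M @^-1` B].

End Hypersurfaces.

(* Embeddedness is a property of the image: a multiple cover of an embedded
   hypersurface counts as embedded, although its immersion is not injective. *)
Definition embedded (R : realType) (n : nat) (rho : R)
    (M : hypersurface n rho) : Prop :=
  exists M' : hypersurface n rho,
    is_embedding M' /\ range (@imm _ _ _ M') = range (@imm _ _ _ M).

(* O(n-1) as the group of isometries of S^n(rho) that fix the last two vectors
   of the canonical basis of R^(n+1). *)
Definition rotations (R : realType) (n : nat) : set 'M[R]_n.+1 :=
  [set A | orthogonal_mx A /\
           forall k l : 'I_n.+1, (n.-1 <= k)%N -> A k l = (k == l)%:R].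

(* S^2(rho) is the totally geodesic sphere spanned by the last three vectors of
   the canonical basis; it meets every orbit of O(n-1). *)
Definition profile_curve (R : realType) (n : nat) (rho : R)
    (gamma : R -> 'rV[R]_n.+1) : Prop :=
  [/\ smooth_on setT gamma,
      forall s, round_sphere rho (gamma s),
      forall s (k : 'I_n.+1), (k < n.-2)%N -> gamma s 0 k = 0
    & forall s, dot (derive1 gamma s) (derive1 gamma s) = 1].

Definition rotational (R : realType) (n : nat) (rho : R)
    (M : hypersurface n rho) : Prop :=
  (exists act : 'M[R]_n.+1 -> M -> M,
    [/\ forall x, act 1%:M x = x,
        forall A B x, rotations A -> rotations B ->
          act (A *m B) x = act B (act A x),
        forall A, rotations A -> continuous (act A)
      & forall A x, rotations A -> imm (act A x) = imm x *m A]) /\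
  (exists2 gamma : R -> 'rV[R]_n.+1, profile_curve rho gamma &
    range (@imm _ _ _ M) =
      [set y | exists s A, rotations A /\ y = gamma s *m A]).

Definition congruent (R : realType) (n : nat) (rho : R)
    (M M' : hypersurface n rho) : Prop :=
  exists2 Q : 'M[R]_n.+1, orthogonal_mx Q &
    range (@imm _ _ _ M') = [set x *m Q | x in range (@imm _ _ _ M)].

(* Main.v *)
(* Put N = n - 2.  A biconservative rotational hypersurface satisfies
   k1 = - (N / 3) k2 for its principal curvatures along the profile curve and
   along the orbits.  With r the distance of the profile curve to the fixed axis
   of O(n-1) and r = sqrt (N / (N + 3)) y^3, the curvature equation has a first
   integral: in a suitable parameter, y' = Gam y * C with
   C^2 = y^(2N) (N + 3 - N y^6) - c^2.  The potential has its maximum 3 at y = 1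
   (a CMC torus), and in the coordinate x = potx y with 3 - x^2 = potential the
   solutions become x = A sin t with c^2 = 3 - A^2.  Thus r oscillates while the
   polar angle of the profile curve turns by some P(A) in a period.  P is
   continuous, P(0) lies in (pi, 2 pi), and a second-order expansion gives
   P(A) < P(0) for small A; so P takes infinitely many values 2 pi p / l, for
   which l periods close up to an immersed torus.
   As P(A) > pi, two arcs of the profile curve that are mirror images of each
   other meet transversally: an embedded hypersurface with the same image would
   have a tangent space containing both directions, which is one dimension too
   many.  Finally A is a congruence invariant, because the largest value of r
   is one: an isometry Q cannot decrease it, since the average of the squared
   distances to the new axis over the points where r is maximal (a product of
   an orthogonal cross with a regular star polygon) is at least the maximum. *)
Require Import Defs.
From mathcomp Require Import all_boot all_order all_algebra.
From mathcomp Require Import all_classical all_reals all_analysis.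
From mathcomp Require Import ring lra zify.
Import Order.TTheory GRing.Theory Num.Theory.
Import numFieldNormedType.Exports.
Set Implicit Arguments.
Unset Strict Implicit.
Unset Printing Implicit Defensive.
Local Open Scope classical_set_scope.
Local Open Scope ring_scope.

(** * Smooth functions *)

(** The cube in [r] comes from the Codazzi equation [d k2 / d r = (k1 - k2) / r]: together with
    [k1 = - (N / 3) k2] it makes [k2] a multiple of [r ^ (- (N + 3) / 3)], which is an integral
    power of [y] once [r] is a multiple of [y ^ 3]. Written as an integral over [r], the period P is
    improper at both turning points, and these move with the amplitude. The substitution
    [x = A sin t] removes both obstacles: a single inverse [g] of [potx] near 0 serves all
    amplitudes, the polar angle is, up to the constant factor [cA], an antiderivative of
    [kap (g (A * sin t))], and every oscillation is an interval of length 2 pi. Continuity and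
    expansion of P then reduce to the mean value theorem and to monotonicity, applied to
    antiderivatives. On the charts of S^N x S^1 the coordinate directions are principal, so the
    shape operator and the metric are diagonal matrices. *)

Section SmoothScalar.
Context {R : realType} {V : normedModType R}.
Implicit Types (f g : V -> R) (h : R -> R).

(* Unlike [class_C], differentiability is required at every level, so that the
   chain rule is available. *)
Fixpoint Cs (k : nat) (f : V -> R) : Prop :=
  (forall x, differentiable f x) /\
  match k with
  | 0 => True
  | k'.+1 => forall v : V, Cs k' ('D_v f)
  end.

Definition smooth f := forall k, Cs k f.

Lemma Cs_diff k f x : Cs k f -> differentiable f x.
Proof. by case: k => [|k] []. Qed.

Lemma CsW k f : Cs k.+1 f -> Cs k f.
Proof.
elim: k f => [|k IH] f [df Df]; split => // v.
by apply: IH; apply: Df.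
Qed.

Lemma Cs_step k f (df : V -> V -> R) :
  (forall x, differentiable f x) -> (forall x v, 'D_v f x = df v x) ->
  (forall v, Cs k (df v)) -> Cs k.+1 f.
Proof.
move=> dff E H; split => // v.
by have -> : 'D_v f = df v by apply/funext => x; exact: E.
Qed.

Lemma Cs_cst k (a : R) : Cs k (fun=> a).
Proof.
have da x : differentiable (fun=> a : R) (x : V) by exact: (differentiable_cst a x).
elim: k a da => [|k IH] a da; first by split.
apply: (@Cs_step _ _ (fun _ _ => 0)) => // [x v|v]; first exact: derive_cst.
by apply: IH => x; exact: (differentiable_cst (0 : R) x).
Qed.

Lemma CsD k f g : Cs k f -> Cs k g -> Cs k (fun x => f x + g x).
Proof.
elim: k f g => [|k IH] f g Hf Hg.
  by split => // x; exact: differentiableD (Cs_diff x Hf) (Cs_diff x Hg).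
apply: (@Cs_step _ _ (fun v x => 'D_v f x + 'D_v g x)).
- by move=> x; exact: differentiableD (Cs_diff x Hf) (Cs_diff x Hg).
- move=> x v; exact: deriveD (diff_derivable (Cs_diff x Hf)) (diff_derivable (Cs_diff x Hg)).
- by move=> v; apply: IH; [exact: (proj2 Hf v)|exact: (proj2 Hg v)].
Qed.

Lemma CsM k f g : Cs k f -> Cs k g -> Cs k (fun x => f x * g x).
Proof.
elim: k f g => [|k IH] f g Hf Hg.
  by split => // x; exact: differentiableM (Cs_diff x Hf) (Cs_diff x Hg).
apply: (@Cs_step _ _ (fun v x => f x * 'D_v g x + g x * 'D_v f x)).
- by move=> x; exact: differentiableM (Cs_diff x Hf) (Cs_diff x Hg).
- move=> x v; exact: deriveM (diff_derivable (Cs_diff x Hf)) (diff_derivable (Cs_diff x Hg)).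
- move=> v; apply: CsD; apply: IH; try exact: CsW.
  + exact: (proj2 Hg v).
  + exact: (proj2 Hf v).
Qed.

Lemma is_derive_comp1 h f (x v : V) (dh df : R) :
  is_derive x v f df -> differentiable f x -> is_derive (f x) 1 h dh ->
  is_derive x v (fun y => h (f y)) (dh * df).
Proof.
move=> Hf dff Hh.
have dhf : differentiable h (f x).
  by apply/derivable1_diffP; exact: ex_derive.
have dhff : differentiable (h \o f) x by exact: differentiable_comp.
apply: DeriveDef; first exact: diff_derivable.
have -> : 'D_v (fun y => h (f y)) x = 'd h (f x) ('d f x v).
  have E1 : 'D_v (h \o f) x = 'd (h \o f) x v by exact: deriveE.
  have E2 := diff_comp dff dhf.
  by move: E1; rewrite E2.
rewrite -(deriveE v dff) (@derive_val _ _ _ _ _ _ _ Hf).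
rewrite (deriv1E (@ex_derive _ _ _ _ _ _ _ Hh)).
by rewrite /= derive1E (@derive_val _ _ _ _ _ _ _ Hh) mulrC.
Qed.

Lemma Cs_comp0 h (h' : R -> R) f :
  (forall x, is_derive (f x) 1 h (h' (f x))) -> Cs 0 f -> Cs 0 (fun x => h (f x)).
Proof.
move=> Hh [Hf _]; split => // x.
apply: (@differentiable_comp _ _ _ _ f h) => //.
by apply/derivable1_diffP; have := Hh x; case.
Qed.

(** The derivative of [h] is asked for only at the values of [f], so that the inverse, the square
    root and functions controlled on an interval only can be composed with [f]. *)
Lemma Cs_comp k h (h' : R -> R) f :
  (forall x, is_derive (f x) 1 h (h' (f x))) -> Cs k.+1 f ->
  Cs k (fun x => h' (f x)) -> Cs k.+1 (fun x => h (f x)).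
Proof.
move=> Hh Hf Hh'.
apply: (@Cs_step _ _ (fun v x => h' (f x) * 'D_v f x)).
- move=> x; apply: (@differentiable_comp _ _ _ _ f h); first exact: (Cs_diff _ Hf).
  by apply/derivable1_diffP; have := Hh x; case.
- move=> x v; apply: derive_val; apply: is_derive_comp1 => //.
  + by apply: derivableP; apply: diff_derivable; exact: (Cs_diff _ Hf).
  + exact: (Cs_diff _ Hf).
- by move=> v; apply: CsM => //; exact: (proj2 Hf v).
Qed.

Lemma smooth_cst (a : R) : smooth (fun=> a).
Proof. by move=> k; exact: Cs_cst. Qed.

Lemma smoothD f g : smooth f -> smooth g -> smooth (fun x => f x + g x).
Proof. by move=> Hf Hg k; exact: CsD. Qed.

Lemma smoothM f g : smooth f -> smooth g -> smooth (fun x => f x * g x).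
Proof. by move=> Hf Hg k; exact: CsM. Qed.

Lemma smoothN f : smooth f -> smooth (fun x => - f x).
Proof.
move=> Hf; have -> : (fun x => - f x) = (fun x => -1 * f x).
  by apply/funext => x; rewrite mulN1r.
by apply: smoothM => //; exact: smooth_cst.
Qed.

Lemma smoothB f g : smooth f -> smooth g -> smooth (fun x => f x - g x).
Proof. by move=> Hf Hg; apply: smoothD => //; exact: smoothN. Qed.

Lemma smoothX n f : smooth f -> smooth (fun x => f x ^+ n).
Proof.
move=> Hf; elim: n => [|n IH].
  by under eq_fun do rewrite expr0; exact: smooth_cst.
by under eq_fun do rewrite exprS; exact: smoothM.
Qed.

Lemma smooth_sum (I : Type) (s : seq I) (P : pred I) (F : I -> V -> R) :
  (forall i, smooth (F i)) -> smooth (fun x => \sum_(i <- s | P i) F i x).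
Proof.
move=> HF; elim: s => [|i s IH].
  by under eq_fun do rewrite big_nil; exact: smooth_cst.
under eq_fun do rewrite big_cons.
by case: (P i) => //; exact: smoothD.
Qed.

(* The bootstrap for autonomous equations such as the ones satisfied by an
   inverse function: the derivative of [h] is a smooth function of [h]. *)
Lemma smooth_comp h (h' : R -> R) f :
  (forall x, is_derive (f x) 1 h (h' (f x))) -> smooth f ->
  (forall k, Cs k (fun x => h (f x)) -> Cs k (fun x => h' (f x))) ->
  smooth (fun x => h (f x)).
Proof.
move=> Hh Hf H; elim => [|k IH]; first exact: Cs_comp0 (Hf 0).
by apply: (Cs_comp Hh) => //; exact: H.
Qed.

Lemma CsN k f : Cs k f -> Cs k (fun x => - f x).
Proof.
move=> Hf; have -> : (fun x => - f x) = (fun x => -1 * f x).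
  by apply/funext => x; rewrite mulN1r.
by apply: CsM => //; exact: Cs_cst.
Qed.

Lemma CsX k n f : Cs k f -> Cs k (fun x => f x ^+ n).
Proof.
move=> Hf; elim: n => [|n IH].
  by under eq_fun do rewrite expr0; exact: Cs_cst.
by under eq_fun do rewrite exprS; exact: CsM.
Qed.

Lemma CsV k f : (forall x, f x != 0) -> Cs k f -> Cs k (fun x => (f x)^-1).
Proof.
move=> f0; elim: k => [|k IH] Hf.
  apply: (@Cs_comp0 _ (fun y => - (y ^- 2) *: 1)) => // x.
  by apply: is_deriveV; exact: f0.
apply: (@Cs_comp _ _ (fun y => - (y ^- 2) *: 1)) => // [x|].
  by apply: is_deriveV; exact: f0.
have -> : (fun x => - (f x ^- 2) *: (1 : R)) = (fun x => - ((f x)^-1 ^+ 2)).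
  by apply/funext => x; rewrite exprVn scaler1.
by apply: CsN; apply: CsX; apply: IH; exact: CsW.
Qed.

Lemma Cs_sqrt k f : (forall x, 0 < f x) -> Cs k f ->
  Cs k (fun x => Num.sqrt (f x)).
Proof.
move=> f0; elim: k => [|k IH] Hf.
  apply: (@Cs_comp0 _ (fun y => (2 * Num.sqrt y)^-1)) => // x.
  exact: is_derive1_sqrt.
apply: (@Cs_comp _ _ (fun y => (2 * Num.sqrt y)^-1)) => // [x|].
  exact: is_derive1_sqrt.
apply: (@CsV _ (fun x => 2 * Num.sqrt (f x))).
  by move=> x; rewrite mulf_neq0// ?pnatr_eq0// sqrtr_eq0 -ltNge.
by apply: CsM; [exact: Cs_cst|apply: IH; exact: CsW].
Qed.

Lemma Cs_sin_cos k f : Cs k f ->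
  Cs k (fun x => sin (f x)) /\ Cs k (fun x => cos (f x)).
Proof.
elim: k => [|k IH] Hf.
  by split; [apply: (@Cs_comp0 _ cos)|apply: (@Cs_comp0 _ (fun x => - sin x))].
have [Hs Hc] := IH (CsW Hf).
split; first by apply: (@Cs_comp _ _ cos).
by apply: (@Cs_comp _ _ (fun x => - sin x)) => //; exact: CsN.
Qed.

Lemma smoothV f : (forall x, f x != 0) -> smooth f -> smooth (fun x => (f x)^-1).
Proof. by move=> f0 Hf k; exact: CsV. Qed.

Lemma smooth_sqrt f : (forall x, 0 < f x) -> smooth f ->
  smooth (fun x => Num.sqrt (f x)).
Proof. by move=> f0 Hf k; exact: Cs_sqrt. Qed.

Lemma smooth_sin f : smooth f -> smooth (fun x => sin (f x)).
Proof. by move=> Hf k; have [] := Cs_sin_cos (Hf k). Qed.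

Lemma smooth_cos f : smooth f -> smooth (fun x => cos (f x)).
Proof. by move=> Hf k; have [] := Cs_sin_cos (Hf k). Qed.

Lemma smooth_atan f : smooth f -> smooth (fun x => atan (f x)).
Proof.
move=> Hf; apply: (@smooth_comp _ (fun x => (1 + x ^+ 2)^-1)) => // k _.
apply: (@CsV _ (fun x => 1 + f x ^+ 2)).
  by move=> x; rewrite gt_eqF// ltr_pwDl// sqr_ge0.
by apply: CsD; [exact: Cs_cst|exact: CsX].
Qed.

Lemma Cs_horner k (p : {poly R}) f : Cs k f -> Cs k (fun x => p.[f x]).
Proof.
move=> Hf; elim/poly_ind: p => [|p c IH].
  by under eq_fun do rewrite horner0; exact: Cs_cst.
under eq_fun do rewrite hornerMXaddC.
by apply: CsD; [exact: CsM|exact: Cs_cst].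
Qed.

End SmoothScalar.

Lemma smooth_id {R : realType} : smooth (fun t : R => t).
Proof.
have did (x : R) : differentiable (fun t : R => t) x by exact/derivable1_diffP/derivable_id.
case=> [|k]; first by split.
apply: (@Cs_step _ _ _ _ (fun v _ => v)) => // [x v|v]; last exact: Cs_cst.
exact: derive_id.
Qed.

Lemma Cs_comp_smooth {R : realType} {V : normedModType R} k (h : R -> R) (f : V -> R) :
  smooth h -> Cs k f -> Cs k (fun x => h (f x)).
Proof.
elim: k h f => [|k IH] h f Hh Hf;
  have dh (x : R) : is_derive x 1 h ('D_1 h x) by
    apply: derivableP; apply: diff_derivable; exact: (Cs_diff _ (Hh 0%N)).
  exact: (@Cs_comp0 R V h ('D_1 h) f (fun x => dh (f x)) Hf).
have Hh' : smooth ('D_1 h) by move=> j; exact: (proj2 (Hh j.+1) 1).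
exact: (@Cs_comp R V k h ('D_1 h) f (fun x => dh (f x)) Hf (IH _ _ Hh' (CsW Hf))).
Qed.

Section SmoothVector.
Context {R : realType} {d : nat}.

Lemma smooth_coord (k : 'I_d) : smooth (fun u : 'rV[R]_d => u 0 k).
Proof.
case=> [|n]; first by split => // x; exact: differentiable_coord.
have H (x v : 'rV[R]_d) : is_derive x v (fun u : 'rV[R]_d => u 0 k) (v 0 k).
  apply: DeriveDef; first by apply: diff_derivable; exact: differentiable_coord.
  rewrite /derive; apply: cvg_lim => //=.
  apply: cvg_near_cst; near=> h.
  rewrite /= !mxE addrK -[RHS]scale1r.
  rewrite -[in RHS](@mulVf _ h); first by rewrite scalerA.
  by near: h; exact: nbhs_dnbhs_neq.
apply: (@Cs_step R 'rV[R]_d n (fun u => u 0 k) (fun v _ => v 0 k)).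
- by move=> x; exact: (@differentiable_coord R 1 d x 0 k).
- by move=> x v; exact: derive_val.
- by move=> v; exact: Cs_cst.
Unshelve. all: by end_near. Qed.

Context {V : normedModType R}.

Lemma cvg_rV {T : Type} {F : set_system T} {FF : Filter F} N
    (f : T -> 'rV[R]_N) (l : 'rV[R]_N) :
  (forall j, f x 0 j @[x --> F] --> l 0 j) -> f x @[x --> F] --> l.
Proof.
move=> H; apply/cvgrPdist_le => /= e e0.
near=> x.
rewrite /Num.Def.normr/= mx_normrE (bigmax_le _ (ltW e0))//= => -[i j] _.
rewrite !mxE (ord1 i) /=.
move: j; near: x; apply: filter_forall => /= j.
exact: ((cvgrPdist_le _ _).1 (H j)).
Unshelve. all: by end_near. Qed.

Lemma class_C_coord k N (F : V -> 'rV[R]_N) :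
  (forall j, smooth (fun u => F u 0 j)) -> class_C k setT F.
Proof.
elim: k F => [|k IH] F HF.
  move=> x _; apply: cvg_rV => j.
  exact: differentiable_continuous (Cs_diff x (HF j 0%N)).
have dF v x : derivable F x v.
  apply/derivable_mxP => i j; rewrite (ord1 i); apply: diff_derivable.
  exact: (Cs_diff x (HF j 0%N)).
move=> v; split => [x _|]; first exact: dF.
apply: IH => j.
have -> : (fun u => 'D_v F u 0 j) = 'D_v (fun u => F u 0 j).
  by apply/funext => x; rewrite derive_mx// mxE.
by move=> l; exact: (proj2 (HF j l.+1) v).
Qed.

Lemma smooth_on_coord N (F : V -> 'rV[R]_N) :
  (forall j, smooth (fun u => F u 0 j)) -> smooth_on setT F.
Proof. by move=> HF k; exact: class_C_coord. Qed.

End SmoothVector.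

(** * Real functions of one variable *)

Section RealCalculus.
Context {R : realType}.
Implicit Types (f g F : R -> R).

Lemma is_derive_continuous f (f' x : R) : is_derive x 1 f f' -> {for x, continuous f}.
Proof.
by move=> [df _]; apply: differentiable_continuous; apply/derivable1_diffP.
Qed.

Lemma mean_value f (f' : R -> R) (a b : R) : (forall x : R, a <= x <= b -> is_derive x 1 f (f' x)) ->
  a <= b -> exists2 c, a <= c <= b & f b - f a = f' c * (b - a).
Proof.
move=> df ab.
have [c| |c cab E] := @MVT_segment R f f' a b ab.
- by rewrite in_itv/= => /andP[ac cb]; apply: df; rewrite !ltW.
- apply: continuous_in_subspaceT => x; rewrite inE/= in_itv/= => /df.
  exact: is_derive_continuous.
- by exists c => //; move: cab; rewrite in_itv.
Qed.

Lemma derive_eq0 f (a b : R) : (forall x : R, is_derive x 1 f 0) -> f a = f b.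
Proof. by move=> df; apply: is_derive_0_is_cst. Qed.

Lemma nondecreasing_deriv f (f' : R -> R) (a b : R) :
  (forall x : R, a <= x <= b -> is_derive x 1 f (f' x)) ->
  (forall x : R, a <= x <= b -> 0 <= f' x) -> a <= b -> f a <= f b.
Proof.
move=> df f0 ab; have [c cab E] := mean_value df ab.
by rewrite -subr_ge0 E mulr_ge0 ?subr_ge0//; exact: f0.
Qed.

Lemma increasing_deriv f (f' : R -> R) (a b : R) :
  (forall x : R, a <= x <= b -> is_derive x 1 f (f' x)) ->
  (forall x : R, a <= x <= b -> 0 < f' x) -> a < b -> f a < f b.
Proof.
move=> df f0 ab; have [c cab E] := mean_value df (ltW ab).
by rewrite -subr_gt0 E mulr_gt0 ?subr_gt0//; exact: f0.
Qed.

Lemma intermediate_value f (a b v : R) : continuous f -> a <= b ->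
  f a <= v <= f b -> exists2 c, a <= c <= b & f c = v.
Proof.
move=> cf ab /andP[av vb].
have [||c cab E] := @IVT R f a b v ab.
- by apply: continuous_subspaceT.
- by rewrite ge_min av/= le_max vb orbT.
- by exists c => //; move: cab; rewrite in_itv.
Qed.

Lemma local_inverse f (f' : R -> R) (I : set R) : open I -> is_interval I ->
  (forall x : R, I x -> is_derive x 1 f (f' x)) ->
  (forall x : R, I x -> 0 < f' x) ->
  exists g : R -> R, forall x : R, I x ->
    g (f x) = x /\ is_derive (f x) 1 g (f' x)^-1.
Proof.
move=> oI II df f0.
have mono x y : I x -> I y -> x < y -> f x < f y.
  move=> Ix Iy xy.
  by apply: (@increasing_deriv _ f') => // z xzy; [apply: df|apply: f0];
    apply: (II _ _ Ix Iy).
have inj x y : I x -> I y -> f x = f y -> x = y.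
  move=> Hx Hy E; case: (ltgtP x y) => // H.
    by have := mono _ _ Hx Hy H; rewrite E ltxx.
  by have := mono _ _ Hy Hx H; rewrite E ltxx.
(* The default 0 is taken off the image of [I]; the claims concern points [f x] with [x] in [I]
   only. *)
pose g y := xget 0 [set x | I x /\ f x = y].
have gK x : I x -> g (f x) = x.
  move=> Hx; rewrite /g; case: xgetP => [z _ [Hz /inj]|/(_ x)]; first exact.
  by case.
exists g => x Hx; split; first exact: gK.
have nI : \forall z \near x, I z by exact: open_nbhs_nbhs.
apply: is_derive_inverse; last 2 first.
- exact: df.
- by rewrite gt_eqF// f0.
- by apply: filterS nI => z /gK.
- by apply: filterS nI => z /df; exact: is_derive_continuous.
Qed.

(** The integral from [- n] is an antiderivative to the right of [- n]. Normalised to vanish at 0,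
    these functions agree wherever two of them are valid, and they are glued by letting [n] grow
    with the absolute value of the argument. *)
Lemma antiderivative f : continuous f -> exists F : R -> R,
  forall x : R, is_derive x 1 F (f x).
Proof.
move=> cf.
have cint (a b : R) : (@lebesgue_measure R).-integrable `[a, b] (EFin \o f).
  apply: continuous_compact_integrable; first exact: segment_compact.
  by apply: continuous_subspaceT.
pose G (n : nat) (x : R) := (\int[lebesgue_measure]_(t in [set` `[- n%:R, x]]) f t)%R.
have dG n (x : R) : - n%:R < x -> is_derive x 1 (G n) (f x).
  move=> nx; have x1 : x < x + 1 by rewrite ltrDl.
  have [dF E] := continuous_FTC1_closed x1 (cint _ _) nx (cf x).
  by move: E; rewrite derive1E => E; exact: (DeriveDef dF E).
pose H n x := G n x - G n 0.
have dH n (x : R) : - n%:R < x -> is_derive x 1 (H n) (f x).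
  move=> nx; have dc := is_derive_cst (G n 0) x 1.
  rewrite -[f x]subr0; exact: is_deriveB (dG _ _ nx) dc.
have HH (n k : nat) (x : R) : - n.+1%:R < x -> - k.+1%:R < x -> H n.+1 x = H k.+1 x.
  move=> nx kx.
  have dHH (y : R) : - n.+1%:R < y -> - k.+1%:R < y ->
      is_derive y 1 (fun y => H n.+1 y - H k.+1 y) 0.
    move=> ny ky; rewrite -[0](subrr (f y)).
    by apply: is_deriveB; exact: dH.
  apply/eqP; rewrite -subr_eq0; apply/eqP.
  have n0 (i : nat) : - i.+1%:R < 0 :> R by rewrite oppr_lt0 ltr0n.
  have H0 i : H i 0 = 0 by rewrite /H subrr.
  have E0 : H n.+1 0 - H k.+1 0 = 0 by rewrite !H0 subrr.
  case: (leP x 0) => x0.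
  - have d y : x <= y <= 0 -> is_derive y 1 (fun y => H n.+1 y - H k.+1 y) 0.
      by move=> /andP[xy y0]; apply: dHH; [exact: lt_le_trans nx xy|exact: lt_le_trans kx xy].
    have [c _] := mean_value d x0.
    by rewrite E0 mul0r sub0r => /eqP; rewrite oppr_eq0 => /eqP.
  - have d y : 0 <= y <= x -> is_derive y 1 (fun y => H n.+1 y - H k.+1 y) 0.
      by move=> /andP[xy y0]; apply: dHH; exact: lt_le_trans (n0 _) xy.
    have [c _] := mean_value d (ltW x0).
    by rewrite E0 mul0r subr0.
exists (fun x => H (Num.truncn `|x|).+1 x) => x.
have bnd (y : R) : - (Num.truncn `|y|).+1%:R < y.
  rewrite ltrNl (le_lt_trans (ler_norm (- y)))// normrN.
  exact: truncnS_gt.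
(* The margin 1 makes the same [H m] valid at all points within distance 1 of [x]. *)
pose m := (Num.truncn (`|x| + 1)).+1.
apply: (@near_eq_is_derive _ _ _ (H m)) => //; last first.
  apply: dH; rewrite ltrNl (le_lt_trans (ler_norm (- x)))// normrN.
  by apply: lt_trans (truncnS_gt _); rewrite ltrDl.
near=> y; apply: HH; last exact: bnd.
rewrite ltrNl (le_lt_trans (ler_norm (- y)))// normrN.
apply: le_lt_trans (truncnS_gt _).
have : `|y - x| <= 1 by rewrite distrC; near: y; apply: cvgr_dist_le => //.
by move=> h; rewrite -(subrK x y) (le_trans (ler_normD _ _))// addrC lerD2l.
Unshelve. all: by end_near. Qed.

End RealCalculus.

(** * Tangent vectors to immersed images *)

Section MatrixNorm.
Context {R : realType}.

Lemma norm_coord_le N (x : 'rV[R]_N) j : `|x 0 j| <= `|x|.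
Proof.
rewrite [leRHS]/Num.Def.normr/= mx_normrE.
exact: (le_bigmax _ (fun p : 'I_1 * 'I_N => `|x p.1 p.2|) (0, j)).
Qed.

Lemma norm_rV_le N (x : 'rV[R]_N) (e : R) : 0 <= e ->
  (forall j, `|x 0 j| <= e) -> `|x| <= e.
Proof.
move=> e0 H; rewrite [leLHS]/Num.Def.normr/= mx_normrE (bigmax_le _ e0)//= => -[i j] _.
by rewrite (ord1 i).
Qed.

Lemma norm_mulmx_le d N (x : 'rV[R]_d) (K : 'M[R]_(d, N)) :
  `|x *m K| <= `|x| * \sum_i \sum_j `|K i j|.
Proof.
have K0 : 0 <= \sum_i \sum_j `|K i j|.
  by apply: sumr_ge0 => i _; apply: sumr_ge0.
apply: norm_rV_le => [|j]; first by rewrite mulr_ge0.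
rewrite mxE mulr_sumr (le_trans (ler_norm_sum _ _ _))// ler_sum// => i _.
rewrite normrM ler_pM ?norm_coord_le//.
by rewrite (bigD1 j)//= lerDl sumr_ge0.
Qed.

End MatrixNorm.

Section StrictDifferentiability.
Context {R : realType}.

Lemma mean_value_bound (f f' : R -> R) (L e b : R) :
  (forall x : R, `|x| <= `|b| -> is_derive x 1 f (f' x)) ->
  (forall x : R, `|x| <= `|b| -> `|f' x - L| <= e) ->
  `|f b - f 0 - b * L| <= e * `|b|.
Proof.
move=> df f'L; case: (leP 0 b) => b0.
- have d x : 0 <= x <= b -> is_derive x 1 f (f' x).
    by move=> /andP[x0 xb]; apply: df; rewrite !ger0_norm.
  have [c /andP[c0 cb] ->] := mean_value d b0.
  rewrite subr0 mulrC -mulrBr normrM mulrC ler_wpM2r//.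
  by apply: f'L; rewrite !ger0_norm.
- have d x : b <= x <= 0 -> is_derive x 1 f (f' x).
    by move=> /andP[bx x0]; apply: df; rewrite (ltr0_norm b0) ler0_norm// lerN2.
  have [c /andP[bc c0] E] := mean_value d (ltW b0).
  have -> : f b - f 0 = f' c * b by rewrite -[LHS]opprB E sub0r mulrN opprK.
  rewrite mulrC -mulrBr normrM mulrC ler_wpM2r//.
  by apply: f'L; rewrite (ltr0_norm b0) ler0_norm// lerN2.
Qed.

Lemma is_derive_line (V W : normedModType R) (f : V -> W) (v w : V) (s : R) :
  derivable f (s *: v + w) v ->
  is_derive s 1 (fun s => f (s *: v + w)) ('D_v f (s *: v + w)).
Proof.
move=> df.
have E : (fun h : R => h^-1 *: (f ((h *: 1 + s) *: v + w) - f (s *: v + w))) =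
    (fun h : R => h^-1 *: (f (h *: v + (s *: v + w)) - f (s *: v + w))).
  by apply/funext => h; rewrite addrA -scalerDl; congr (_ *: (f ((_ + _) *: _ + _) - _)); rewrite [LHS]mulr1.
by apply: DeriveDef; rewrite /derivable /derive /= E.
Qed.

(** [class_C] speaks of directional derivatives only; the classical criterion by partial derivatives
    continuous at a point turns them into a first-order expansion there. *)
Lemma partials_differentiable d (f : 'rV[R]_d -> R) (u0 : 'rV[R]_d) (e : R) :
  (forall i, \forall u \near u0, derivable f u (delta_mx 0 i)) ->
  (forall i, {for u0, continuous ('D_(delta_mx 0 i) f)}) -> 0 < e ->
  \forall u \near u0,
    `|f u - f u0 - \sum_i (u - u0) 0 i * 'D_(delta_mx 0 i) f u0| <= e * `|u - u0|.
Proof.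
move=> df cdf e0.
(* The error is shared by [d] legs; dividing by [d.+1] also covers [d = 0]. *)
pose e' := e / d.+1%:R.
have e'0 : 0 < e' by rewrite divr_gt0// ltr0n.
pose P (i : 'I_d) u := derivable f u (delta_mx 0 i) /\
  `|'D_(delta_mx 0 i) f u - 'D_(delta_mx 0 i) f u0| <= e'.
have nP i : \forall u \near u0, P i u.
  near=> u; split; near: u; first exact: df.
  by apply: cvgr_distC_le => //; exact: cdf.
have : \forall u \near u0, forall i, P i u by apply: filter_forall nP.
move=> /nbhs_ballP[r /= r0 H].
near=> u.
have ur : `|u - u0| < r.
  by rewrite distrC; near: u; apply: cvgr_dist_lt.
(* A path from [u0] to [u] that changes one coordinate at a time; in the maximum norm it never
   leaves the ball. *)
pose w (i : nat) : 'rV[R]_d := u0 + \row_k (if (k < i)%N then (u - u0) 0 k else 0).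
have w0 : w 0%N = u0 by apply/rowP => k; rewrite !mxE /= addr0.
have wd : w d = u by apply/rowP => k; rewrite !mxE ltn_ord addrC subrK.
have wS (i : 'I_d) : w i.+1 = (u - u0) 0 i *: delta_mx 0 i + w i.
  apply/rowP => k; rewrite !mxE eqxx/= ltnS leq_eqVlt.
  case: (eqVneq k i) => [->|ki].
    by rewrite eqxx/= ltnn mulr1 addr0 addrC.
  have -> : (nat_of_ord k == i) = false by apply/negbTE.
  by rewrite mulr0 add0r.
have wB (i : 'I_d) (s : R) : `|s| <= `|(u - u0) 0 i| ->
    ball u0 r (s *: delta_mx 0 i + w i).
  move=> su; rewrite -ball_normE /ball_/=; apply: le_lt_trans ur.
  apply: norm_rV_le => // k; rewrite !mxE eqxx/=.
  case: (eqVneq k i) => [->|ki].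
    rewrite ltnn mulr1 addr0 opprD addrCA subrr addr0 normrN.
    exact: le_trans su (norm_coord_le _ _).
  rewrite mulr0 add0r opprD addrA subrr sub0r normrN.
  case: ifP => _; last by rewrite normr0.
  by have := norm_coord_le (u - u0) k; rewrite !mxE.
have step (i : 'I_d) : `|f (w i.+1) - f (w i) - (u - u0) 0 i * 'D_(delta_mx 0 i) f u0|
    <= e' * `|u - u0|.
  pose g (s : R) := f (s *: delta_mx 0 i + w i).
  have -> : f (w i.+1) = g ((u - u0) 0 i) by rewrite /g wS.
  have -> : f (w i) = g 0 by rewrite /g scale0r add0r.
  apply: (@le_trans _ _ (e' * `|(u - u0) 0 i|)); last first.
    by rewrite ler_wpM2l ?norm_coord_le// ltW.
  apply: (@mean_value_bound _ (fun s => 'D_(delta_mx 0 i) f (s *: delta_mx 0 i + w i))).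
    by move=> s /wB /H /(_ i)[D _]; exact: is_derive_line.
  by move=> s /wB /H /(_ i)[].
have -> : f u - f u0 = \sum_(i < d) (f (w i.+1) - f (w i)).
  rewrite -(big_mkord xpredT (fun i => f (w i.+1) - f (w i))) telescope_sumr//.
  by rewrite w0 wd.
rewrite -sumrB (le_trans (ler_norm_sum _ _ _))//.
apply: (@le_trans _ _ (\sum_(i < d) e' * `|u - u0|)); first exact: ler_sum.
rewrite sumr_const card_ord -mulr_natl mulrA ler_wpM2r//.
rewrite /e' mulrCA ler_piMr ?(ltW e0)// ler_pdivrMr ?ltr0n// mul1r.
by rewrite ler_nat.
Unshelve. all: by end_near. Qed.

End StrictDifferentiability.

Section Dot.
Context {R : realType} {N : nat}.
Implicit Types u v w : 'rV[R]_N.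

Lemma dot_mulmx u v : u *m v^T = (dot u v)%:M.
Proof.
apply/rowP => i; rewrite (ord1 i) !mxE eqxx mulr1n.
by apply: eq_bigr => k _; rewrite mxE.
Qed.

Lemma dotC u v : dot u v = dot v u.
Proof. by apply: eq_bigr => i _; rewrite mulrC. Qed.

Lemma dotDl u v w : dot (u + v) w = dot u w + dot v w.
Proof. by rewrite /dot -big_split; apply: eq_bigr => i _; rewrite mxE mulrDl. Qed.

Lemma dotZl a u w : dot (a *: u) w = a * dot u w.
Proof. by rewrite /dot mulr_sumr; apply: eq_bigr => i _; rewrite mxE mulrA. Qed.

Lemma dotBl u v w : dot (u - v) w = dot u w - dot v w.
Proof. by rewrite dotDl -scaleN1r dotZl mulN1r. Qed.

Lemma dotDr u v w : dot u (v + w) = dot u v + dot u w.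
Proof. by rewrite dotC dotDl !(dotC _ u). Qed.

Lemma dotZr a u w : dot u (a *: w) = a * dot u w.
Proof. by rewrite dotC dotZl dotC. Qed.

Lemma dot_norm_le u v : `|dot u v| <= `|u| * \sum_i `|v 0 i|.
Proof.
rewrite (le_trans (ler_norm_sum _ _ _))// mulr_sumr ler_sum// => i _.
by rewrite normrM ler_wpM2r// norm_coord_le.
Qed.

End Dot.

Lemma dot_mulr (R : realType) N (u v : 'rV[R]_N) (A : 'M[R]_N) :
  orthogonal_mx A -> dot (u *m A) (v *m A) = dot u v.
Proof.
move=> AA; have : (u *m A) *m (v *m A)^T = u *m v^T.
  by rewrite trmx_mul mulmxA -(mulmxA u) AA mulmx1.
by rewrite !dot_mulmx => /matrixP/(_ 0 0); rewrite !mxE eqxx !mulr1n.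
Qed.

Section Tangency.
Context {R : realType}.

Lemma chart_estimate d N (F : 'rV[R]_d -> 'rV[R]_N) (D : set 'rV[R]_d) u0 (e : R) :
  open D -> D u0 -> class_C 1 D F -> 0 < e ->
  \forall u \near u0, `|F u - F u0 - (u - u0) *m jac F u0| <= e * `|u - u0|.
Proof.
move=> oD Du0 FC e0.
have nP (j : 'I_N) : \forall u \near u0,
   `|F u 0 j - F u0 0 j - \sum_i (u - u0) 0 i * 'D_(delta_mx 0 i) (fun u => F u 0 j) u0|
     <= e * `|u - u0|.
  apply: partials_differentiable => // i.
    near=> u; have [dF _] := FC (delta_mx 0 i).
    have /derivable_mxP : derivable F u (delta_mx 0 i).
      by apply: dF; near: u; exact: open_nbhs_nbhs.
    exact.
  have [dF /(_ _ Du0) cF] := FC (delta_mx 0 i).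
  have cFj : (fun u => 'D_(delta_mx 0 i) F u 0 j) u @[u --> u0] -->
      'D_(delta_mx 0 i) F u0 0 j.
    apply: (@cvg_comp _ _ _ ('D_(delta_mx 0 i) F) (fun x : 'rV[R]_N => x 0 j) _
       (nbhs ('D_(delta_mx 0 i) F u0))) => //.
    exact: coord_continuous.
  have E u : D u -> 'D_(delta_mx 0 i) (fun u => F u 0 j) u = 'D_(delta_mx 0 i) F u 0 j.
    by move=> Du; have h := derive_mx (dF u Du); rewrite h mxE.
  suff : 'D_(delta_mx 0 i) (fun u => F u 0 j) u @[u --> u0] -->
      'D_(delta_mx 0 i) (fun u => F u 0 j) u0 by [].
  rewrite E//; apply: (@cvg_trans _ _ _ _ _ cFj).
  have FF : Filter (nbhs u0) by exact: nbhs_filter.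
  have nD : \forall v \near u0, D v by exact: open_nbhs_nbhs.
  by apply: near_eq_cvg; apply: filterS nD => v Dv; rewrite E.
have : \forall u \near u0, forall j,
   `|F u 0 j - F u0 0 j - \sum_i (u - u0) 0 i * 'D_(delta_mx 0 i) (fun u => F u 0 j) u0|
     <= e * `|u - u0| by apply: filter_forall nP.
apply: filterS => u H; apply: norm_rV_le => [|j]; first by rewrite mulr_ge0// ltW.
apply: le_trans (H j); rewrite !mxE.
suff -> : \sum_i (u - u0) 0 i * jac F u0 i j =
  \sum_i (u - u0) 0 i * 'D_(delta_mx 0 i) (fun u => F u 0 j) u0 by [].
apply: eq_bigr => i _; congr (_ * _); rewrite !mxE.
have [dF _] := FC (delta_mx 0 i).
by have h := derive_mx (dF u0 Du0); rewrite h mxE.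
Unshelve. all: by end_near. Qed.

(* A curve that stays, near [t = 0], in the image of small neighbourhoods of
   [u0] under an immersion has its velocity in the tangent space. *)
Lemma tangent_velocity d N (F : 'rV[R]_d -> 'rV[R]_N) (D : set 'rV[R]_d) u0
    (nu : 'rV[R]_N) (c : R -> 'rV[R]_N) (c' : 'rV[R]_N) :
  open D -> D u0 -> class_C 1 D F -> row_free (jac F u0) ->
  jac F u0 *m nu^T = 0 -> is_derive (0 : R) 1 c c' -> c 0 = F u0 ->
  (forall r : R, 0 < r -> \forall t \near (0 : R), exists u, `|u - u0| < r /\ F u = c t) ->
  dot c' nu = 0.
Proof.
move=> oD Du0 FC /row_freeP[K JK] Jnu dc c0 H.
set J := jac F u0 in JK Jnu *.
(* [K] is a right inverse of [J], so [CK] bounds the length of a displacement by that of its image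
   under [J]; the summand 1 keeps it positive. *)
pose CK := \sum_i \sum_j `|K i j| + 1.
pose Cn := \sum_i `|nu 0 i|.
have CK0 : 0 < CK by rewrite ltr_wpDl// sumr_ge0// => i _; rewrite sumr_ge0.
have Cn0 : 0 <= Cn by rewrite sumr_ge0.
have hle (h : 'rV[R]_d) : `|h| <= CK * `|h *m J|.
  rewrite -{1}[h]mulmx1 -JK mulmxA (le_trans (norm_mulmx_le _ _))// mulrC.
  by rewrite ler_wpM2r// lerDl.
have key e : 0 < e -> e * CK <= 2^-1 -> \forall t \near (0 : R),
    `|dot (c t - c 0) nu| <= Cn * (e * (2 * CK * `|c t - c 0|)).
  move=> e0 eCK; have /nbhs_ballP[r /= r0 E] := chart_estimate oD Du0 FC e0.
  apply: filterS (H r r0) => t [u [ur Fu]].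
  have {}E : `|F u - F u0 - (u - u0) *m J| <= e * `|u - u0|.
    by apply: E; rewrite -ball_normE /ball_/= distrC.
  (* As [e * CK <= 1 / 2], the error of the first-order expansion can be absorbed on the left: the
     chart parameter moves at a rate comparable to that of the curve. *)
  have hc : `|u - u0| <= 2 * CK * `|c t - c 0|.
    have h1 : `|(u - u0) *m J| <= `|c t - c 0| + e * `|u - u0|.
      rewrite c0 -Fu -[X in `|X| <= _](subKr (F u - F u0)).
      by rewrite (le_trans (ler_normB _ _))// lerD2l.
    have h2 : `|u - u0| <= CK * `|c t - c 0| + CK * e * `|u - u0|.
      by rewrite -mulrA -mulrDr (le_trans (hle _))// ler_wpM2l// ltW.
    have h3 : CK * e * `|u - u0| <= 2^-1 * `|u - u0| by rewrite ler_wpM2r// mulrC.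
    by lra.
  have -> : dot (c t - c 0) nu = dot (F u - F u0 - (u - u0) *m J) nu.
    rewrite c0 -Fu [RHS]dotBl.
    suff -> : dot ((u - u0) *m J) nu = 0 by rewrite subr0.
    have : (u - u0) *m J *m nu^T = 0 by rewrite -mulmxA Jnu mulmx0.
    by rewrite dot_mulmx => /matrixP/(_ 0 0); rewrite !mxE eqxx mulr1n.
  rewrite (le_trans (dot_norm_le _ _))// mulrC ler_wpM2l//.
  by rewrite (le_trans E)// ler_pM2l.
have dq : h^-1 *: (c h - c 0) @[h --> 0^'] --> c'.
  have [dcv <-] := dc.
  have -> : (fun h : R => h^-1 *: (c h - c 0)) = (fun h => h^-1 *: (c (h *: 1 + 0) - c 0)).
    by apply/funext => h; rewrite addr0 [h *: 1]mulr1.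
  exact: dcv.
apply/eqP; rewrite -normr_eq0; apply/eqP/le_anti; rewrite normr_ge0 andbT.
apply/ler_addgt0Pr => /= e e0; rewrite add0r.
suff : `|dot c' nu| <= e by [].
pose B := Cn * (2 * CK * (`|c'| + 1)) + Cn + 1.
have B0 : 0 < B.
  rewrite ltr_wpDl// addr_ge0// mulr_ge0// !mulr_ge0 ?(ltW CK0)//.
(* The three bounds make the total error at most [e], keep the difference quotient within 1 of [c'],
   and allow the absorption in [key]. *)
pose e1 := Num.min (Num.min (e / B) 1) (2 * CK)^-1.
have CK20 : 0 < (2 * CK)^-1 by rewrite invr_gt0 mulr_gt0.
have e10 : 0 < e1 by rewrite !lt_min ltr01 divr_gt0.
have e1e : e1 * B <= e by rewrite -ler_pdivlMr// /e1 !ge_min lexx.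
have e11 : e1 <= 1 by rewrite /e1 !ge_min lexx orbT.
have e1C : e1 * CK <= 2^-1.
  rewrite (@le_trans _ _ ((2 * CK)^-1 * CK))//.
    by rewrite ler_pM2r// /e1 ge_min lexx orbT.
  by rewrite invfM -mulrA mulVf ?mulr1// gt_eqF.
have [h [hk hd h0]] : exists h : R, [/\ `|dot (c h - c 0) nu| <=
    Cn * (e1 * (2 * CK * `|c h - c 0|)), `|c' - h^-1 *: (c h - c 0)| <= e1 & h != 0].
  apply: (@filter_ex _ (0 : R)^').
  near=> h; split; near: h.
  - exact: nbhs_dnbhs (key _ e10 e1C).
  - by apply: cvgr_dist_le.
  - exact: nbhs_dnbhs_neq.
set q := h^-1 *: _ in hd.
have Eq : c h - c 0 = h *: q by rewrite scalerA divff// scale1r.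
have qn : `|q| <= `|c'| + 1.
  rewrite -[q](subKr c') (le_trans (ler_normB _ _))// lerD2l.
  exact: le_trans hd e11.
have hq : `|dot q nu| <= Cn * (e1 * (2 * CK * `|q|)).
  move: hk; rewrite Eq dotZl normrM normrZ.
  have -> : Cn * (e1 * (2 * CK * (`|h| * `|q|))) =
    `|h| * (Cn * (e1 * (2 * CK * `|q|))) by ring.
  by rewrite ler_pM2l// normr_gt0.
have -> : c' = (c' - q) + q by rewrite subrK.
rewrite dotDl (le_trans (ler_normD _ _))//.
apply: le_trans e1e.
have h4 : `|dot (c' - q) nu| <= e1 * Cn.
  by rewrite (le_trans (dot_norm_le _ _))// ler_wpM2r.
have h5 : Cn * (e1 * (2 * CK * `|q|)) <= e1 * (Cn * (2 * CK * (`|c'| + 1))).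
  have -> : Cn * (e1 * (2 * CK * `|q|)) = e1 * (Cn * (2 * CK * `|q|)) by ring.
  rewrite ler_pM2l// ler_wpM2l// ler_wpM2l// mulr_ge0// ltW//.
have -> : e1 * B = e1 * Cn + e1 * (Cn * (2 * CK * (`|c'| + 1))) + e1 by rewrite /B; ring.
by apply: (le_trans (lerD h4 (le_trans hq h5))); rewrite lerDl ltW.
Unshelve. all: by end_near. Qed.

End Tangency.

(** * Rules of derivation *)

Section DerivationRules.
Context {R : realType} {V : normedModType R}.
Implicit Types (f g : V -> R) (x v : V) (df dg : R).

Lemma der_cst (a : R) x v : is_derive x v (fun=> a) 0.
Proof. exact: (is_derive_cst a x v). Qed.

Lemma derD f g x v df dg : is_derive x v f df -> is_derive x v g dg ->
  is_derive x v (fun y => f y + g y) (df + dg).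
Proof. exact: is_deriveD. Qed.

Lemma derB f g x v df dg : is_derive x v f df -> is_derive x v g dg ->
  is_derive x v (fun y => f y - g y) (df - dg).
Proof. exact: is_deriveB. Qed.

Lemma derN f x v df : is_derive x v f df -> is_derive x v (fun y => - f y) (- df).
Proof. exact: is_deriveN. Qed.

Lemma derM f g x v df dg : is_derive x v f df -> is_derive x v g dg ->
  is_derive x v (fun y => f y * g y) (f x * dg + g x * df).
Proof. exact: is_deriveM. Qed.

Lemma derX f n x v df : is_derive x v f df ->
  is_derive x v (fun y => f y ^+ n) (n%:R * f x ^+ n.-1 * df).
Proof.
move=> H; case: n => [|n].
  by rewrite !mul0r; under eq_fun do rewrite expr0; exact: der_cst.
have -> : (fun y => f y ^+ n.+1) = f ^+ n.+1.
  by apply/funext => y; elim: n => [|n IH]; rewrite ?expr1// exprS IH [in RHS]exprS.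
exact: is_deriveX.
Qed.

Lemma derV f x v df : f x != 0 -> is_derive x v f df ->
  is_derive x v (fun y => (f y)^-1) (- df / f x ^+ 2).
Proof.
move=> f0 [dfx <-]; apply: DeriveDef; first exact: derivableV.
by rewrite deriveV// /GRing.scale/= mulNr mulNr mulrC.
Qed.

End DerivationRules.

Section DerivationRules1.
Context {R : realType}.
Implicit Types (f : R -> R) (x df : R).

Lemma der_id x : is_derive x 1 (fun y : R => y) 1.
Proof. exact: (is_derive_id x 1). Qed.

Lemma der_comp (h f : R -> R) x dh df : is_derive x 1 f df ->
  is_derive (f x) 1 h dh -> is_derive x 1 (fun y => h (f y)) (dh * df).
Proof.
move=> Hf Hh; apply: is_derive_comp1 => //.
by apply/derivable1_diffP; exact: ex_derive.
Qed.

Lemma der_sqrt f x df : 0 < f x -> is_derive x 1 f df ->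
  is_derive x 1 (fun y => Num.sqrt (f y)) ((2 * Num.sqrt (f x))^-1 * df).
Proof. by move=> f0 H; apply: der_comp H _; exact: is_derive1_sqrt. Qed.

Lemma der_horner (p : {poly R}) f x df : is_derive x 1 f df ->
  is_derive x 1 (fun y => p.[f y]) (p^`().[f x] * df).
Proof. by move=> H; apply: (der_comp H); exact: is_derive_poly. Qed.

Lemma der_sin f x df : is_derive x 1 f df ->
  is_derive x 1 (fun y => sin (f y)) (cos (f x) * df).
Proof. by move=> H; apply: (der_comp H). Qed.

Lemma der_cos f x df : is_derive x 1 f df ->
  is_derive x 1 (fun y => cos (f y)) (- sin (f x) * df).
Proof. by move=> H; apply: (der_comp H). Qed.

End DerivationRules1.

(* [is_derive] is a class: its instances must not preempt the rules above. *)
Ltac der :=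
  lazymatch goal with
  | |- is_derive _ _ (fun=> ?a) _ => exact: der_cst
  | |- is_derive _ _ (fun y => y) _ => exact: der_id
  | |- is_derive _ _ (@GRing.inv _) _ =>
      notypeclasses refine (derV (f := fun y => y) _ (der_id _))
  | |- is_derive _ _ (@sin _) _ => notypeclasses refine (der_sin (f := fun y => y) (der_id _))
  | |- is_derive _ _ (@cos _) _ => notypeclasses refine (der_cos (f := fun y => y) (der_id _))
  | |- is_derive _ _ (@GRing.opp _) _ => notypeclasses refine (derN (f := fun y => y) (der_id _))
  | |- is_derive _ _ (@GRing.add _ ?a) _ =>
      notypeclasses refine (derD (f := fun=> a) (g := fun y => y) (der_cst _ _ _) (der_id _))
  | |- is_derive _ _ (@GRing.mul _ ?a) _ =>
      notypeclasses refine (derM (f := fun=> a) (g := fun y => y) (der_cst _ _ _) (der_id _))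
  | |- is_derive _ _ (fun y => @?f y - @?g y) _ => notypeclasses refine (derB _ _); [der|der]
  | |- is_derive _ _ (fun y => - @?f y) _ => notypeclasses refine (derN _); der
  | |- is_derive _ _ (fun y => @?f y + @?g y) _ => notypeclasses refine (derD _ _); [der|der]
  | |- is_derive _ _ (fun y => @?f y * @?g y) _ => notypeclasses refine (derM _ _); [der|der]
  | |- is_derive _ _ (fun y => @?f y ^+ _) _ => notypeclasses refine (derX _ _); der
  | |- is_derive _ _ (fun y => (@?f y)^-1) _ => notypeclasses refine (derV _ _); [|der]
  | |- is_derive _ _ (fun y => Num.sqrt (@?f y)) _ =>
      notypeclasses refine (der_sqrt _ _); [|der]
  | |- is_derive _ _ (fun y => horner _ (@?f y)) _ =>
      notypeclasses refine (der_horner _ _); der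
  | |- is_derive _ _ (fun y => sin (@?f y)) _ => notypeclasses refine (der_sin _); der
  | |- is_derive _ _ (fun y => cos (@?f y)) _ => notypeclasses refine (der_cos _); der
  | |- _ => try eassumption
  end.

Ltac derive_eq := notypeclasses refine (is_derive_eq _ _); [der|].

(** * The potential of the profile equation *)

Section PotentialPolynomial.
Context {R : realType} (N : nat).
Let M : R := N%:R + 3.

(* The potential [p y := y ^ (2 N) * (M - N * y ^ 6)] of the profile equation
   satisfies [3 - p y = (y ^ 2 - 1) ^ 2 * Spoly.[y ^ 2]] with [Spoly] positive,
   so that [3 - p] has a smooth square root through the maximum [y = 1]. *)
Definition Spoly : {poly R} :=
  \sum_(i < N) \sum_(e < 3) 'X^i * \sum_(l < N + e - i) 'X^l.

(** One division of the right side by [X - 1] leaves [N X^N (1 + X + X^2) - 3 (1 + ... + X^(N-1))],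
    which is the sum of the differences [X^(N+e) - X^i] over [i < N] and [e < 3]. Each of them is
    again divisible by [X - 1], with a geometric sum as quotient: this is the origin of the double
    sum in [Spoly]. *)
Lemma SpolyE : ('X - 1) ^+ 2 * Spoly = N%:R *: 'X^(N + 3) - M *: 'X^N + 3%:P.
Proof.
have E1 (i : 'I_N) (e : 'I_3) :
    ('X - 1 : {poly R}) * ('X^i * \sum_(l < N + e - i) 'X^l) = 'X^(N + e) - 'X^i.
  rewrite mulrCA -subrX1 mulrBr mulr1 -exprD subnKC//.
  by rewrite (leq_trans (ltnW (ltn_ord i)))// leq_addr.
have E2 : ('X - 1 : {poly R}) * Spoly =
    N%:R *: ('X^N * (1 + 'X + 'X^2)) - 3%:P * \sum_(i < N) 'X^i.
  rewrite /Spoly mulr_sumr.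
  under eq_bigr => i _.
    rewrite mulr_sumr (eq_bigr _ (fun e _ => E1 i e)) !big_ord_recl big_ord0.
    rewrite /= addn0 /bump /= !add1n.
    have -> : 'X^N - 'X^i + ('X^(N + 1) - 'X^i + ('X^(N + 2) - 'X^i + 0)) =
      'X^N * (1 + 'X + 'X^2) - 3%:P * 'X^i :> {poly R}.
      by rewrite !exprD expr1 polyC_natr; ring.
    over.
  rewrite sumrB sumr_const card_ord -mulr_sumr.
  by rewrite scaler_nat.
rewrite expr2 -mulrA E2 mulrBr [X in _ - X]mulrCA -subrX1.
by rewrite /M -!mul_polyC exprD polyCD !polyC_natr; ring.
Qed.

Lemma Spoly_horner (Y : R) :
  (Y - 1) ^+ 2 * Spoly.[Y] = N%:R * Y ^+ (N + 3) - M * Y ^+ N + 3.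
Proof.
have := congr1 (fun p : {poly R} => p.[Y]) SpolyE.
by rewrite !hornerE /= => E; rewrite -E; ring.
Qed.

(** All coefficients are nonnegative, and the term [i = e = l = 0] contributes the constant 1. *)
Lemma Spoly_gt0 (Y : R) : (0 < N)%N -> 0 <= Y -> 0 < Spoly.[Y].
Proof.
move=> N0 Y0; rewrite /Spoly horner_sum.
have T0 (i : 'I_N) (e : 'I_3) : 0 <= ('X^i * \sum_(l < N + e - i) 'X^l : {poly R}).[Y].
  rewrite hornerM hornerXn mulr_ge0 ?exprn_ge0// horner_sum sumr_ge0// => l _.
  by rewrite hornerXn exprn_ge0.
have T1 (i : 'I_N) : 0 <= (\sum_(e < 3) 'X^i * \sum_(l < N + e - i) 'X^l : {poly R}).[Y].
  by rewrite horner_sum; apply: sumr_ge0 => e _; exact: T0.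
rewrite (bigD1 (Ordinal N0))//= ltr_pwDl//; last by apply: sumr_ge0 => i _; exact: T1.
rewrite horner_sum (bigD1 ord0)//= ltr_pwDl//; last by apply: sumr_ge0 => e _; exact: (T0 (Ordinal N0)).
rewrite mul1r subn0 addn0 horner_sum (bigD1 (Ordinal N0))//=.
rewrite hornerXn expr0 ltr_pwDl// sumr_ge0// => l _.
by rewrite hornerXn exprn_ge0.
Qed.

End PotentialPolynomial.

Section PotentialDerivatives.
Context {R : realType} (m : nat).
Local Notation N := m.+1.
Local Notation S := (@Spoly R N).
Let M : R := N%:R + 3.

(** [SpolyE] is differentiated and one factor [X - 1] cancelled. The right side is a single product,
    and this gives [potx] a derivative in closed form. *)
Lemma Spoly_deriv : 2%:P * S + ('X - 1) * S^`() =
  (N%:R * M) *: ('X^m * ('X^2 + 'X + 1)).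
Proof.
have X1 : ('X - 1 : {poly R}) != 0 by rewrite polyXsubC_eq0.
apply: (mulfI X1).
have E : (('X - 1) ^+ 2 * S)^`() = (N%:R *: 'X^(N + 3) - M *: 'X^N + 3%:P)^`().
  by rewrite SpolyE.
move: E; rewrite expr2 derivD derivB !derivZ !derivXn derivC !derivM derivB derivX derivC.
rewrite subr0 mul1r mulr1 addr0 => E.
rewrite [LHS]mulrDr.
transitivity ((('X - 1) + ('X - 1)) * S + ('X - 1) * ('X - 1) * S^`()).
  by rewrite polyC_natr; ring.
rewrite E -(mulr_natr 'X^_ (N + 3)) -(mulr_natr 'X^_ N) addSn addn3 /= -!mul_polyC.
rewrite /M !exprS polyCM polyCD !polyC_natr -!natr1; ring.
Qed.

Lemma Spoly_deriv_horner Y : 2 * S.[Y] + (Y - 1) * S^`().[Y] =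
  N%:R * M * Y ^+ m * (Y ^+ 2 + Y + 1).
Proof.
have := congr1 (fun p : {poly R} => p.[Y]) Spoly_deriv.
by rewrite !hornerE /= => ->; ring.
Qed.

Let natr_pred (k : nat) : k%:R * k.-1%:R = k%:R * (k%:R - 1) :> R.
Proof. by case: k => [|k]; rewrite ?mul0r// /= -natr1 addrK. Qed.

(* Taylor coefficients at 1, by differentiating [Spoly_deriv]. *)
Lemma Spoly_taylor :
  [/\ S.[1] = 3 / 2 * N%:R * M, S^`().[1] = N%:R ^+ 2 * M &
      S^`()^`().[1] = N%:R * M * (9 * N%:R ^+ 2 - 9 * N%:R + 6) / 12].
Proof.
have E0 := Spoly_deriv_horner 1.
have E1 := congr1 (fun p : {poly R} => p^`().[1]) Spoly_deriv.
have E2 := congr1 (fun p : {poly R} => p^`()^`().[1]) Spoly_deriv.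
move: E0 E1 E2.
rewrite subrr mul0r addr0 !expr1n => E0.
have d1 : (1 : {poly R})^`() = 0 by exact: derivC.
rewrite /= !(derivD, derivB, derivM, derivZ, derivXn, derivX, derivC, derivMn, derivN, d1, deriv0, subr0, oppr0, mul0r, add0r, mul1r, mulr1, addr0).
rewrite !hornerE /= !hornerMn !hornerXn !expr1n subrr !mul0r !addr0 => E1 E2.
have p1 : m.-1%:R * m%:R = m%:R * (m%:R - 1) :> R by rewrite mulrC natr_pred.
have mN : m%:R = N%:R - 1 :> R by rewrite -natr1 addrK.
move: E2; rewrite -(mulr_natr m.-1%:R m) p1 => E2.
have {}E1 : 3 * S^`().[1] = 3 * (N%:R ^+ 2 * M).
  by transitivity (2 * S^`().[1] + S^`().[1]); [ring|rewrite E1 mN; ring].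
have {}E2 : 4 * S^`()^`().[1] = 4 * (N%:R * M * (9 * N%:R ^+ 2 - 9 * N%:R + 6) / 12).
  transitivity (2 * S^`()^`().[1] + S^`()^`().[1] + S^`()^`().[1]); first by ring.
  by rewrite E2 mN; field.
have n2 : (2 : R) != 0 by rewrite pnatr_eq0.
have n3 : (3 : R) != 0 by rewrite pnatr_eq0.
have n4 : (4 : R) != 0 by rewrite pnatr_eq0.
split.
- by apply: (mulfI n2); rewrite E0; field.
- exact: (mulfI n3).
- by apply: (mulfI n4); rewrite E2; field.
Qed.

End PotentialDerivatives.

(** The slopes of [f'] at 0 stay below [l] near 0, so [l v^2 - (f v + f (- v))] is nondecreasing for
    [v >= 0]. Only the even part of [f] matters later, because the odd part cancels over a full
    oscillation of [A sin t]. *)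
Lemma symmetric_taylor (R : realType) (f f' : R -> R) (a l A : R) : 0 < A ->
  (forall v : R, `|v| <= A -> is_derive v 1 f (f' v)) ->
  is_derive (0 : R) 1 f' a -> a < l ->
  exists2 r : R, 0 < r <= A &
    forall v, `|v| <= r -> f v + f (- v) <= 2 * f 0 + l * v ^+ 2.
Proof.
move=> A0 df df' al.
have dq : h^-1 *: (f' h - f' 0) @[h --> 0^'] --> a.
  have [dcv <-] := df'.
  have -> : (fun h : R => h^-1 *: (f' h - f' 0)) =
      (fun h => h^-1 *: (f' (h *: 1 + 0) - f' 0)).
    by apply/funext => h; rewrite addr0 [h *: 1]mulr1.
  exact: dcv.
have la : 0 < l - a by rewrite subr_gt0.
have nq : \forall h \near 0^', `|a - h^-1 *: (f' h - f' 0)| <= l - a.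
  by apply: cvgr_dist_le.
have /nbhs_ballP[r0 /= r00 H] : \forall h \near (0 : R),
  h != 0 -> `|a - h^-1 *: (f' h - f' 0)| <= l - a by exact: nq.
pose r := Num.min (r0 / 2) A.
have r_gt0 : 0 < r by rewrite lt_min A0 divr_gt0.
have rA : r <= A by rewrite /r ge_min lexx orbT.
have rr0 : r < r0.
  by rewrite (le_lt_trans (y := r0 / 2)) ?ge_min ?lexx// ltr_pdivrMr// ltr_pMr// ltr1n.
have slope h : `|h| <= r -> h != 0 -> h^-1 * (f' h - f' 0) <= l.
  move=> hr h0.
  have : `|a - h^-1 * (f' h - f' 0)| <= l - a.
    apply: H => //; rewrite -ball_normE /ball_/= sub0r normrN; exact: le_lt_trans rr0.
  by rewrite ler_distl => /andP[]; lra.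
exists r; first by rewrite r_gt0.
have pos v : 0 <= v <= r -> f v + f (- v) <= 2 * f 0 + l * v ^+ 2.
  move=> /andP[v0 vr].
  pose psi x := l * x ^+ 2 - (f x + f (- x)).
  suff : psi 0 <= psi v by rewrite /psi oppr0 expr0n /= mulr0; lra.
  pose dpsi x := 2 * l * x - (f' x - f' (- x)).
  have dp (x : R) : 0 <= x <= v -> is_derive x 1 psi (dpsi x).
    move=> /andP[x0 xv].
    have xA : `|x| <= A by rewrite ger0_norm// (le_trans xv)// (le_trans vr).
    have d1 := df x xA.
    have d2 : is_derive (- x) 1 f (f' (- x)) by apply: df; rewrite normrN.
    have d3 : is_derive x 1 (fun y => f (- y)) (f' (- x) * - 1).
      by apply: (@der_comp R f (fun y => - y)) => //; apply: derN; exact: der_id.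
    have d4 : is_derive x 1 (fun y => l * y ^+ 2) (l * (2%:R * x ^+ 1 * 1) + x ^+ 2 * 0).
      exact: (derM (der_cst l x 1) (derX 2 (der_id x))).
    by apply: (is_derive_eq (derB d4 (derD d1 d3))); rewrite /dpsi; ring.
  apply: (nondecreasing_deriv dp) => // x /andP[x0 xv]; rewrite /dpsi.
  case: (eqVneq x 0) => [->|xn0]; first by rewrite oppr0 subrr mulr0 subr0.
  have xp : 0 < x by rewrite lt_neqAle eq_sym xn0.
  have xr : x <= r by exact: le_trans vr.
  have := slope x; rewrite ger0_norm// => /(_ xr xn0).
  rewrite mulrC ler_pdivrMr// => s1.
  have := slope (- x); rewrite normrN ger0_norm// oppr_eq0 => /(_ xr xn0).
  rewrite invrN mulNr -mulrN mulrC ler_pdivrMr// => s2.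
  by lra.
move=> v; case: (leP 0 v) => v0 vr.
  by apply: pos; rewrite v0 (le_trans (ler_norm _)).
have := pos (- v); rewrite opprK sqrrN addrC; apply.
by rewrite oppr_ge0 ltW//= (le_trans (ler_norm _))// normrN.
Qed.

Section Profile.
Context {R : realType} (m : nat).
Local Notation N := m.+1.
Local Notation S := (@Spoly R N).
Definition prM : R := N%:R + 3.
Local Notation M := prM.

Definition potx (y : R) : R := (y ^+ 2 - 1) * Num.sqrt S.[y ^+ 2].
(** The reciprocal of the derivative of [potx], in closed form by [Spoly_deriv]; the inverse of
    [potx] thus solves the autonomous equation [g' = Gam g]. *)
Definition Gam (y : R) : R := Num.sqrt S.[y ^+ 2] /
  (N%:R * M * y ^+ (m + m).+1 * (y ^+ 4 + y ^+ 2 + 1)).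
(** [w2 y / M] is [1 - r^2], the squared length of the component in the plane fixed by the
    rotations. *)
Definition w2 (y : R) : R := M - N%:R * y ^+ 6.

Let N0 : 0 < N%:R :> R. Proof. by rewrite ltr0n. Qed.
Lemma prM_gt0 : 0 < M. Proof. by rewrite addr_gt0. Qed.
Let M0 := prM_gt0.
Let S0 y : 0 < S.[y ^+ 2]. Proof. by apply: Spoly_gt0 => //; exact: sqr_ge0. Qed.
Let q0 (y : R) : 0 < y ^+ 4 + y ^+ 2 + 1.
Proof.
have -> : y ^+ 4 = (y ^+ 2) ^+ 2 by rewrite -exprM.
by rewrite ltr_wpDl// addr_ge0 ?sqr_ge0.
Qed.

Lemma potx_sqr y : potx y ^+ 2 = 3 - y ^+ (N + N) * w2 y.
Proof.
rewrite /potx exprMn sqr_sqrtr ?ltW//.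
rewrite Spoly_horner /w2 -/M -!exprM mulnDr !mul2n -!addnn exprD; ring.
Qed.

Lemma Gam_gt0 y : 0 < y -> 0 < Gam y.
Proof.
move=> y0; rewrite /Gam divr_gt0 ?sqrtr_gt0//.
by rewrite !mulr_gt0 ?exprn_gt0.
Qed.

Lemma der_potx (y : R) : 0 < y -> is_derive y 1 potx (Gam y)^-1.
Proof.
move=> y0; rewrite /potx; have h0 := S0 y.
have hs0 : Num.sqrt S.[y ^+ 2] != 0 by rewrite sqrtr_eq0 -ltNge.
derive_eq => //.
rewrite /Gam; have := Spoly_deriv_horner m (y ^+ 2); rewrite -/M => E.
have SS : Num.sqrt S.[y ^+ 2] ^+ 2 = S.[y ^+ 2] by rewrite sqr_sqrtr ?ltW.
apply: (mulIf hs0); rewrite invf_div mulfVK//.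
transitivity (y * (2 * Num.sqrt S.[y ^+ 2] ^+ 2 + (y ^+ 2 - 1) * S^`().[y ^+ 2])).
  by rewrite /=; field.
rewrite SS E -(exprM y 2 m) mul2n -addnn [y ^+ (m + m).+1]exprS. ring.
Qed.

(** [potx] increases on the positive axis and vanishes at 1, so it has an inverse near 0. The cap
    [N y^6 <= N + 1] serves twice: it keeps [w2] at least 2, and it is exactly the inequality
    [2 r^2 <= (N + 1) w^2] on which the averaging over apexes relies. *)
Lemma inverse_profile : exists (A : R) (g : R -> R), 0 < A /\
  forall v : R, `|v| <= A -> [/\ 0 < g v, N%:R * g v ^+ 6 <= N%:R + 1,
    potx (g v) = v & is_derive v 1 g (Gam (g v))].
Proof.
have [b /andP[b1 b2] b6] : exists2 b : R, 1 <= b <= 2 & b ^+ 6 = (N%:R + 1) / N%:R.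
  apply: (@intermediate_value _ (fun y => y ^+ 6)) => //.
  - exact: exprn_continuous.
  - by rewrite ler1n.
  - rewrite expr1n ler_pdivlMr// mul1r lerDl ler01/= ler_pdivrMr//.
    have N1 : 1 <= N%:R :> R by rewrite ler1n.
    have -> : (2 : R) ^+ 6 = 64 by rewrite -natrX.
    lra.
have b0 : 0 < b by exact: lt_le_trans b1.
have b1' : 1 < b.
  rewrite lt_neqAle b1 andbT; apply/eqP => E; move: b6; rewrite -E expr1n => /esym/eqP.
  rewrite -subr_eq0 mulrDl divff ?gt_eqF// mul1r addrC addKr invr_eq0 pnatr_eq0.
have dx y : 0 < y < b -> is_derive y 1 potx (Gam y)^-1.
  by move=> /andP[y0 _]; exact: der_potx.
have x0 y : 0 < y < b -> 0 < (Gam y)^-1.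
  by move=> /andP[y0 _]; rewrite invr_gt0 Gam_gt0.
have dx' y : `]0, b[%classic y -> is_derive y 1 potx (Gam y)^-1.
  by rewrite /= in_itv/=; exact: dx.
have x0' y : `]0, b[%classic y -> 0 < (Gam y)^-1 by rewrite /= in_itv/=; exact: x0.
have [g gP'] := local_inverse (@interval_open R (BRight 0) (BLeft b) isT isT) (@interval_is_interval _ _) dx' x0'.
have gP y : 0 < y < b -> g (potx y) = y /\ is_derive (potx y) 1 g (Gam y)^-1^-1.
  by move=> yb; apply: gP'; rewrite /= in_itv.
pose y1 : R := 2^-1; pose y2 : R := (1 + b) / 2.
have y1b : 0 < y1 < 1 by rewrite /y1 invr_gt0 ltr0n /= invf_lt1 ?ltr1n.
have y2b : 1 < y2 < b by rewrite /y2; apply/andP; split; lra.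
have x1 : potx 1 = 0 by rewrite /potx expr1n subrr mul0r.
have mono y z : 0 < y -> y < z -> z < b -> potx y < potx z.
  move=> y0 yz zb; apply: (@increasing_deriv _ _ (fun y => (Gam y)^-1)) => // t /andP[yt tz].
    by apply: dx; rewrite (lt_le_trans y0)// (le_lt_trans tz).
  by apply: x0; rewrite (lt_le_trans y0)// (le_lt_trans tz).
have [y1p y11] := andP y1b; have [y2p y2b'] := andP y2b.
have n1 : potx y1 < 0 by rewrite -x1; apply: mono.
have n2 : 0 < potx y2 by rewrite -x1; apply: mono.
exists (Num.min (- potx y1) (potx y2)), g; split; first by rewrite lt_min oppr_gt0 n1 n2.
move=> v; rewrite le_min !ler_norml opprK => /andP[/andP[v1 _] /andP[_ v2]].
have cpot : {within `[y1, y2], continuous potx}.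
  apply: continuous_in_subspaceT => y; rewrite inE/= in_itv/= => /andP[yy1 yy2].
  by apply: (@is_derive_continuous _ _ (Gam y)^-1); apply: der_potx; exact: lt_le_trans yy1.
have [||y yI xy] := @IVT R potx y1 y2 v _ cpot; first by rewrite (ltW (lt_trans y11 y2p)).
  by rewrite ge_min v1 le_max v2 orbT.
move: yI; rewrite in_itv/= => /andP[yy1 yy2].
have yb : 0 < y < b by rewrite (lt_le_trans y1p)//= (le_lt_trans yy2).
have [gK dg] := gP _ yb.
rewrite -xy gK; split => //; first by case/andP: yb.
  have -> : N%:R + 1 = N%:R * b ^+ 6 :> R by rewrite b6 mulrC divfK// gt_eqF.
  rewrite ler_pM2l// lerXn2r ?nnegrE ?ltW//; by case/andP: yb.
by move: dg; rewrite invrK.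
Qed.

End Profile.

(** * The angular period *)

Section AngularSpeed.
Context {R : realType} (m : nat).
Local Notation N := m.+1.
Local Notation S := (@Spoly R N).
Local Notation M := (@prM R m).
Local Notation Gam := (@Gam R m).
Local Notation w2 := (@w2 R m).

Definition qq (y : R) := y ^+ 4 + y ^+ 2 + 1.
(* The polar angle turns at speed [cA * kap y] along the profile curve. *)
Definition kap (y : R) : R := 3 * Num.sqrt (N%:R * M) * y ^+ 2 * Gam y / w2 y.
(* The logarithmic derivatives of [Gam] and [kap]. *)
Definition lamG (y : R) : R := y * S^`().[y ^+ 2] / S.[y ^+ 2]
  - (2 * m%:R + 1) / y - (4 * y ^+ 3 + 2 * y) / qq y.
Definition lamK (y : R) : R := lamG y + (2 / y + 6 * N%:R * y ^+ 5 / w2 y).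

Let N0 : 0 < N%:R :> R. Proof. by rewrite ltr0n. Qed.
Let M0 : 0 < M. Proof. exact: prM_gt0. Qed.
Let S0 y : 0 < S.[y ^+ 2]. Proof. by apply: Spoly_gt0 => //; exact: sqr_ge0. Qed.
Let q0 (y : R) : 0 < qq y.
Proof.
have e : y ^+ 4 = (y ^+ 2) ^+ 2 by rewrite -exprM.
by rewrite /qq e ltr_wpDl// addr_ge0 ?sqr_ge0.
Qed.

Lemma der_w2 (y : R) : is_derive y 1 w2 (- (6 * N%:R * y ^+ 5)).
Proof. by rewrite /w2; derive_eq; rewrite /=; ring. Qed.

Lemma der_Gam (y : R) : 0 < y -> is_derive y 1 Gam (Gam y * lamG y).
Proof.
move=> y0; have h0 := S0 y; have hq := q0 y.
have hs0 : Num.sqrt S.[y ^+ 2] != 0 by rewrite sqrtr_eq0 -ltNge.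
have SS : S.[y ^+ 2] = Num.sqrt S.[y ^+ 2] ^+ 2 by rewrite sqr_sqrtr ?ltW.
have yn : y ^+ (m + m) != 0 by rewrite gt_eqF// exprn_gt0.
have yS : y ^+ (m + m).+1 != 0 by rewrite gt_eqF// exprn_gt0.
rewrite /qq in hq; rewrite /Gam; derive_eq => //.
  by rewrite !mulf_neq0 ?(gt_eqF hq) ?(gt_eqF N0) ?(gt_eqF M0).
rewrite /lamG /Gam /= /qq; set h := Num.sqrt _ in SS hs0 *; rewrite SS.
have -> : (m + m).+1%:R = 2 * m%:R + 1 :> R by rewrite -natr1 natrD; ring.
rewrite [y ^+ (m + m).+1]exprS.
by field; rewrite yn hs0 !gt_eqF.
Qed.

Lemma der_kap (y : R) : 0 < y -> 0 < w2 y -> is_derive y 1 kap (kap y * lamK y).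
Proof.
move=> y0 w0; have dG := der_Gam y0; have dw := der_w2 y.
rewrite /kap; derive_eq; try by rewrite gt_eqF.
rewrite /lamK /=; field.
by rewrite !gt_eqF.
Qed.

Definition dlamG (y : R) := S^`().[y ^+ 2] / S.[y ^+ 2] +
  2 * y ^+ 2 * S^`()^`().[y ^+ 2] / S.[y ^+ 2]
  - 2 * y ^+ 2 * (S^`().[y ^+ 2] / S.[y ^+ 2]) ^+ 2
  + (2 * m%:R + 1) / y ^+ 2
  - ((12 * y ^+ 2 + 2) * qq y - (4 * y ^+ 3 + 2 * y) ^+ 2) / qq y ^+ 2.

Lemma der_lamG (y : R) : 0 < y -> is_derive y 1 lamG (dlamG y).
Proof.
move=> y0; have h0 := S0 y; have hq := q0 y; rewrite /lamG /qq in hq *.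
derive_eq; try by rewrite gt_eqF.
rewrite /dlamG /qq /=; field.
by rewrite !gt_eqF.
Qed.

Lemma der_lamK (y : R) : 0 < y -> 0 < w2 y -> is_derive y 1 lamK
  (dlamG y + (- 2 / y ^+ 2 +
    (30 * N%:R * y ^+ 4 * w2 y + 36 * N%:R ^+ 2 * y ^+ 10) / w2 y ^+ 2)).
Proof.
move=> y0 w0; have dG := der_lamG y0; have dw := der_w2 y.
rewrite /lamK; derive_eq; try by rewrite gt_eqF.
by rewrite /=; field; rewrite !gt_eqF.
Qed.

(* [dkap \o g] is the derivative of [kap \o g], as [g' = Gam \o g]. *)
Definition dkap (y : R) := kap y * lamK y * Gam y.

Lemma der_dkap (y : R) : 0 < y -> 0 < w2 y -> is_derive y 1 dkap
  (kap y * Gam y * (lamK y ^+ 2 + (dlamG y + (- 2 / y ^+ 2 +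
    (30 * N%:R * y ^+ 4 * w2 y + 36 * N%:R ^+ 2 * y ^+ 10) / w2 y ^+ 2))
   + lamK y * lamG y)).
Proof.
move=> y0 w0; have d1 := der_Gam y0; have d2 := der_kap y0 w0.
have d3 := der_lamK y0 w0.
rewrite /dkap; derive_eq.
by rewrite /=; ring.
Qed.

Lemma w2_1 : w2 1 = 3.
Proof. by rewrite /w2 /prM expr1n mulr1 addrAC subrr add0r. Qed.

Lemma Gam1_sqr : Gam 1 ^+ 2 = (6 * N%:R * M)^-1.
Proof.
have [S1 _ _] := @Spoly_taylor R m; rewrite -/M in S1.
rewrite /Gam !expr1n expr_div_n sqr_sqrtr ?S1; last first.
  by rewrite ltW// !mulr_gt0.
by field; rewrite !gt_eqF.
Qed.

Lemma kap1 : kap 1 = Num.sqrt (N%:R * M) * Gam 1.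
Proof. by rewrite /kap w2_1; field. Qed.

(** The value is independent of the dimension, so that the period at amplitude 0 is
    [2 pi sqrt 3 / sqrt 6], that is [sqrt 2 * pi], for every [n]. *)
Lemma kap1_sqr : kap 1 ^+ 2 = 6^-1.
Proof.
rewrite kap1 exprMn Gam1_sqr sqr_sqrtr; last by rewrite ltW// mulr_gt0.
by field; rewrite !gt_eqF.
Qed.

(* This strict inequality makes the period function of the profile curves
   nonconstant: it says that the period decreases for small amplitudes. *)
Lemma second_variation : exists2 l, l < 2 / 3 * kap 1 &
  is_derive (1 : R) 1 dkap (l / Gam 1).
Proof.
have w1 : 0 < w2 1 by rewrite w2_1.
have G0 : 0 < Gam 1 by exact: Gam_gt0.
have d := der_dkap ltr01 w1; set l := (X in is_derive _ _ _ X) in d.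
(* The factor [Gam 1] is the derivative of [g] at 0, so the witness is the second derivative of
   [kap \o g] there. *)
exists (l * Gam 1); last by rewrite mulfK// gt_eqF.
rewrite /l {l d}.
have [S1 S2 S3] := @Spoly_taylor R m; rewrite -/M in S1 S2 S3.
have mN : m%:R = N%:R - 1 :> R by rewrite -natr1 addrK.
have -> : lamK 1 = 2 / 3 * N%:R + 1.
  rewrite /lamK /lamG /qq w2_1 !expr1n S1 S2 mN.
  by field; rewrite !gt_eqF.
have -> : lamG 1 = - (4 / 3 * N%:R + 1).
  rewrite /lamG /qq !expr1n S1 S2 mN.
  by field; rewrite !gt_eqF.
have -> : dlamG 1 = (9 * N%:R ^+ 2 - 9 * N%:R + 6) / 9 + 2 / 3 * N%:R
   - 8 / 9 * N%:R ^+ 2 + 2 * N%:R - 1 - 2 / 3.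
  rewrite /dlamG /qq !expr1n S1 S2 S3 mN.
  by field; rewrite !gt_eqF.
rewrite w2_1 !expr1n kap1.
set s := Num.sqrt _.
have s0 : 0 < s by rewrite sqrtr_gt0 mulr_gt0.
have N1 : 1 <= N%:R :> R by rewrite ler1n.
(* After [Gam 1 ^ 2] is replaced by its value, the claim is
   [11 / 3 N^2 + 11 N - 3 < 4 N (N + 3)]. *)
rewrite [X in X < _](_ : _ = s * Gam 1 * (2 / 3) *
  ((11 / 3 * N%:R ^+ 2 + 11 * N%:R - 3) / (4 * N%:R * M))); last first.
  set e := (X in s * Gam 1 * Gam 1 * X * Gam 1 = _).
  transitivity (s * Gam 1 * (Gam 1 ^+ 2 * e)); first by ring.
  by rewrite Gam1_sqr /e; field; rewrite !gt_eqF.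
have sG : 0 < s * Gam 1 * (2 / 3) by rewrite pmulr_rgt0 ?divr_gt0// pmulr_rgt0.
rewrite [X in _ < X](_ : _ = s * Gam 1 * (2 / 3)); last by ring.
rewrite gtr_pMr//.
rewrite ltr_pdivrMr ?mulr_gt0// mul1r /prM; nra.
Qed.

End AngularSpeed.

Lemma lipschitz_continuous (R : realType) (f : R -> R) (L : R) :
  (forall x y, `|f x - f y| <= L * `|x - y|) -> continuous f.
Proof.
move=> fL x; apply/cvgrPdist_le => /= e e0.
have L0 : 0 < `|L| + 1 by rewrite ltr_wpDl.
near=> y; apply: (le_trans (fL x y)).
apply: (@le_trans _ _ ((`|L| + 1) * `|x - y|)).
  by rewrite ler_wpM2r// (le_trans (ler_norm _))// lerDl.
rewrite mulrC -ler_pdivlMr//; near: y.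
by apply: cvgr_dist_le => //; rewrite divr_gt0.
Unshelve. all: by end_near. Qed.

Lemma clamp_lipschitz (R : realType) (b x y : R) : 0 <= b ->
  `|Num.min (Num.max x 0) b - Num.min (Num.max y 0) b| <= `|x - y|.
Proof.
wlog xy : x y / x <= y.
  move=> H b0; case: (leP x y) => [/H|/ltW/H h]; first exact.
  by rewrite distrC (distrC x y); exact: h.
move=> b0; rewrite [`|x - y|]ler0_norm ?subr_le0// opprB.
have minE z : Num.min z b = if z < b then z else b by [].
have -> : Num.max x 0 = if x < 0 then 0 else x by [].
have -> : Num.max y 0 = if y < 0 then 0 else y by [].
case: (ltP x 0) => x0; case: (ltP y 0) => y0; rewrite !minE;
  do ?[case: (ltP _ b) => ?]; rewrite ler_norml; apply/andP; split; lra.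
Qed.

Lemma rationals_between (R : realType) (a b : R) : 0 < a -> a < b ->
  exists (p l : nat -> nat),
   [/\ forall j, (0 < l j)%N,
     forall j, a < (p j)%:R / (l j)%:R < b &
     injective (fun j => (p j)%:R / (l j)%:R : R)].
Proof.
move=> a0 ab.
have [q1 /andP[aq1 q1b]] := rat_in_itvoo ab.
have [q2 /andP[q12 q2b]] := rat_in_itvoo q1b.
move: aq1 q1b q12 q2b; rewrite !bnd_simp => aq1 q1b q12 q2b.
have q12' : q1 < q2 by rewrite -(@ltr_rat R).
pose q (j : nat) : rat := q1 + (q2 - q1) / j.+1%:R.
have qb j : q1 < q j <= q2.
  rewrite /q ltrDl divr_gt0 ?subr_gt0//= -lerBrDl ler_pdivrMr//.
  by rewrite ler_peMr ?ler1n// subr_ge0 ltW.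
have q0 j : 0 < q j.
  by rewrite -(@ltr_rat R) rmorph0 (lt_trans a0)// (lt_trans aq1)// ltr_rat; case/andP: (qb j).
have E j : (`|numq (q j)|%N)%:R / (`|denq (q j)|%N)%:R = ratr (q j) :> R.
  rewrite /ratr; congr (_ / _).
    by rewrite -{2}(gez0_abs (ltW _ : 0 <= numq (q j))) ?numq_gt0.
  by rewrite -{2}(gez0_abs (ltW (denq_gt0 (q j)))).
exists (fun j => `|numq (q j)|%N), (fun j => `|denq (q j)|%N); split.
- by move=> j; rewrite absz_gt0 gt_eqF.
- move=> j; rewrite E; have /andP[h1 h2] := qb j.
  by rewrite (lt_trans aq1) ?ltr_rat//= (le_lt_trans _ q2b)// ler_rat.
- move=> i j; rewrite !E => /fmorph_inj/addrI.
  have d : q2 - q1 != 0 by rewrite subr_eq0 gt_eqF.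
  by move=> /(mulfI d)/invr_inj/eqP; rewrite eqr_nat => /eqP[].
Qed.

(** * The angular period as a function of the amplitude *)

Section PeriodFunction.
Context {R : realType} (m : nat).
Local Notation N := m.+1.
Local Notation Gam := (@Gam R m).
Local Notation w2 := (@w2 R m).
Local Notation kap := (@kap R m).
Local Notation dkap := (@dkap R m).
Local Notation potx := (@potx R m).

Variables (A0 : R) (g : R -> R).
Hypothesis A00 : 0 < A0.
Hypothesis gP : forall v : R, `|v| <= A0 -> [/\ 0 < g v, N%:R * g v ^+ 6 <= N%:R + 1,
    potx (g v) = v & is_derive v 1 g (Gam (g v))].

Lemma w2_ge2 v : `|v| <= A0 -> 2 <= w2 (g v).
Proof. by move=> /gP[_ h _ _]; rewrite /w2 /prM; lra. Qed.

Lemma w2_gt0 v : `|v| <= A0 -> 0 < w2 (g v).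
Proof. by move=> /w2_ge2; apply: lt_le_trans. Qed.

Lemma g0 : g 0 = 1.
Proof.
have [gp _ E _] : [/\ 0 < g 0, N%:R * g 0 ^+ 6 <= N%:R + 1, potx (g 0) = 0
    & is_derive (0 : R) 1 g (Gam (g 0))] by apply: gP; rewrite normr0 ltW.
move/eqP: E; rewrite /potx mulf_eq0 sqrtr_eq0 leNgt Spoly_gt0 ?sqr_ge0//= orbF.
rewrite subr_eq0 -[X in _ == X](expr1n _ 2) eqrXn2 ?ltW//.
by move/eqP.
Qed.

Lemma amplitude_lt3 v : `|v| <= A0 -> v ^+ 2 < 3.
Proof.
move=> vA; have [gp _ <- _] := gP vA.
rewrite potx_sqr ltrBlDr ltrDl mulr_gt0 ?exprn_gt0//.
exact: w2_gt0.
Qed.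

Definition kg (v : R) := kap (g v).

Lemma der_kg (v : R) : `|v| <= A0 -> is_derive v 1 kg (dkap (g v)).
Proof.
move=> vA; have [gp _ _ dg] := gP vA.
exact: (der_comp dg (der_kap gp (w2_gt0 vA))).
Qed.

Lemma sin_amplitude (A t : R) : `|A| <= A0 -> `|A * sin t| <= A0.
Proof.
by move=> AA; rewrite normrM (le_trans _ AA)// ler_piMr// sin_max.
Qed.

Lemma kg_lipschitz : exists2 L, 0 <= L & forall v w, `|v| <= A0 -> `|w| <= A0 ->
  `|kg v - kg w| <= L * `|v - w|.
Proof.
pose f v := `|dkap (g v)|.
have cf : {within `[- A0, A0], continuous f}.
  apply: continuous_in_subspaceT => v; rewrite inE/= in_itv/= -ler_norml => vA.
  have [gp _ _ dg] := gP vA.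
  have d := der_comp dg (der_dkap gp (w2_gt0 vA)).
  exact: continuous_comp (is_derive_continuous d) (@norm_continuous _ _ _).
have [|c cA Hc] := @EVT_max R f (- A0) A0 _ cf; first by rewrite ge0_cp// ltW.
exists (f c); first exact: normr_ge0.
have main v w : `|v| <= A0 -> `|w| <= A0 -> v <= w -> `|kg v - kg w| <= f c * `|v - w|.
  move=> vA wA vw.
  have d x : v <= x <= w -> is_derive x 1 kg (dkap (g x)).
    move=> /andP[vx xw]; apply: der_kg; move: vA wA; rewrite !ler_norml.
    by move=> /andP[h1 _] /andP[_ h2]; rewrite (le_trans h1)//= (le_trans xw).
  have [x /andP[vx xw] E] := mean_value d vw.
  rewrite distrC E normrM [`|w - v|]distrC ler_wpM2r//; apply: Hc.
  rewrite in_itv/=; move: vA wA; rewrite !ler_norml.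
  by move=> /andP[h1 _] /andP[_ h2]; rewrite (le_trans h1)//= (le_trans xw).
move=> v w vA wA; case: (leP v w) => [/main|/ltW/main h]; first exact.
by rewrite distrC (distrC v w); exact: h.
Qed.

Lemma angle_exists : exists Phi : R -> R -> R, forall A, `|A| <= A0 ->
  forall t : R, is_derive t 1 (Phi A) (kg (A * sin t)).
Proof.
suff /choice[Phi HPhi] : forall A, exists F : R -> R, `|A| <= A0 ->
  forall t : R, is_derive t 1 F (kg (A * sin t)) by exists Phi.
(* Beyond [A0] the function [g] is not controlled, and [id] is a dummy value. *)
move=> A; case: (leP `|A| A0) => AA; last by exists id.
have [|F dF] := @antiderivative R (fun t => kg (A * sin t)); last by exists F.
move=> t; apply: (@is_derive_continuous _ _ (dkap (g (A * sin t)) * (A * cos t))).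
have d : is_derive t 1 (fun t => A * sin t) (A * cos t) by derive_eq; rewrite /=; ring.
exact: (der_comp d (der_kg (sin_amplitude _ AA))).
Qed.

Section OneAngle.
Variables (A : R) (F : R -> R).
Hypothesis dF : forall t : R, is_derive t 1 F (kg (A * sin t)).

Lemma angle_periodic t : F (t + 2 * pi) = F t + (F (2 * pi) - F 0).
Proof.
have d (s : R) : is_derive s 1 (fun s => F (s + 2 * pi) - F s) 0.
  have d1 : is_derive s 1 (fun s => s + 2 * pi) 1 by derive_eq; rewrite addr0.
  have := derB (der_comp d1 (dF (s + 2 * pi))) (dF s).
  by rewrite [2 * pi]mulrC mulr_natr sinD2pi mulr1 subrr.
have := derive_eq0 t 0 d; rewrite add0r => <-; ring.
Qed.

(** The sine is even about [pi / 2]; geometrically, the profile curve is symmetric under the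
    reflection that fixes its apex. *)
Lemma angle_odd t :
  F (pi / 2 + t) - F (pi / 2) = F (pi / 2) - F (pi / 2 - t).
Proof.
have d (s : R) : is_derive s 1 (fun s => F (pi / 2 + s) + F (pi / 2 - s)) 0.
  have d1 : is_derive s 1 (fun s => pi / 2 + s) 1 by derive_eq; rewrite add0r.
  have d2 : is_derive s 1 (fun s => pi / 2 - s) (- 1) by derive_eq; rewrite sub0r.
  have := derD (der_comp d1 (dF (pi / 2 + s))) (der_comp d2 (dF (pi / 2 - s))).
  by rewrite ![pi / 2 + _]addrC !sinDpihalf cosN mulr1 mulrN1 subrr.
have := derive_eq0 t 0 d; rewrite subr0 addr0 => E.
by lra.
Qed.

End OneAngle.

Section Angle.
Variables (Phi : R -> R -> R).
Hypothesis dPhi : forall A, `|A| <= A0 ->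
  forall t : R, is_derive t 1 (Phi A) (kg (A * sin t)).

Definition per A := Phi A (2 * pi) - Phi A 0.
Definition period A := Num.sqrt (3 - A ^+ 2) * per A.

Lemma per_lipschitz : exists L, forall A B, `|A| <= A0 -> `|B| <= A0 ->
  `|per A - per B| <= L * `|A - B|.
Proof.
have [L L0 HL] := kg_lipschitz.
exists (L * (2 * pi)) => A B AA BB.
have d (t : R) : 0 <= t <= 2 * pi -> is_derive t 1 (fun t => Phi A t - Phi B t)
   (kg (A * sin t) - kg (B * sin t)).
  by move=> _; apply: derB; exact: dPhi.
have pi20 : 0 <= 2 * pi :> R by rewrite mulr_ge0// pi_ge0.
have [t _ E] := mean_value d pi20.
have -> : per A - per B = (kg (A * sin t) - kg (B * sin t)) * (2 * pi).
  by rewrite subr0 in E; rewrite -E /per; ring.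
rewrite normrM (ger0_norm pi20) mulrAC ler_wpM2r//.
apply: (le_trans (HL _ _ _ _)); [exact: sin_amplitude|exact: sin_amplitude|].
by rewrite ler_wpM2l// -mulrBl normrM ler_piMr// sin_max.
Qed.

Lemma per0 : per 0 = kap 1 * (2 * pi).
Proof.
have d (t : R) : 0 <= t <= 2 * pi -> is_derive t 1 (Phi 0) (kap 1).
  move=> _; have -> : kap 1 = kg (0 * sin t) by rewrite mul0r /kg g0.
  by apply: dPhi; rewrite normr0 ltW.
have pi20 : 0 <= 2 * pi :> R by rewrite mulr_ge0// pi_ge0.
by have [t _] := mean_value d pi20; rewrite subr0.
Qed.

(** A comparison of integrals in the form of monotonicity: the period over [[- pi, pi]] is folded to
    [[0, pi]], where the folded integrand is at most [2 kap 1 + l A^2 sin^2 t]. The term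
    [t / 2 - sin t cos t / 2] is the antiderivative of [sin^2]. *)
Lemma per_upper (A l : R) : `|A| <= A0 ->
  (forall v, `|v| <= `|A| -> kg v + kg (- v) <= 2 * kg 0 + l * v ^+ 2) ->
  per A <= kap 1 * (2 * pi) + l * A ^+ 2 * pi / 2.
Proof.
move=> AA H.
have E : per A = Phi A pi - Phi A (- pi).
  have := angle_periodic (dPhi AA) (- pi); have -> : - pi + 2 * pi = pi :> R by ring.
  by move=> ->; rewrite /per; ring.
have d (t : R) : 0 <= t <= pi -> is_derive t 1
   (fun t => 2 * kap 1 * t + l * A ^+ 2 * (t / 2 - sin t * cos t / 2)
       - (Phi A t - Phi A (- t)))
   (2 * kap 1 + l * (A * sin t) ^+ 2 - (kg (A * sin t) + kg (- (A * sin t)))).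
  move=> _; apply: derB.
    derive_eq => /=; rewrite exprMn sin2cos2; have := sin2cos2 t; rewrite expr2 => s2.
    have -> : - sin t * 1 = - sin t by rewrite mulr1.
    have -> : sin t * - sin t = - (1 - cos t ^+ 2) by rewrite mulrN s2.
    by field.
  have d1 : is_derive t 1 (fun t => Phi A (- t)) (- kg (- (A * sin t))).
    have d0 : is_derive t 1 (fun t : R => - t) (- 1) by derive_eq.
    rewrite -mulrN1; apply: (der_comp d0).
    by rewrite -mulrN -sinN; exact: dPhi.
  have := derB (dPhi AA t) d1; by rewrite opprK.
have pi0 : 0 <= pi :> R by exact: pi_ge0.
have := nondecreasing_deriv d _ pi0.
rewrite /= sin0 sinpi oppr0 !mul0r !mulr0 !subr0 subrr mulr0 addr0 subr0 -E.
have h (t : R) : 0 <= t <= pi ->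
    0 <= 2 * kap 1 + l * (A * sin t) ^+ 2 - (kg (A * sin t) + kg (- (A * sin t))).
  move=> _; rewrite subr_ge0; have := H (A * sin t); have -> : kg 0 = kap 1 by rewrite /kg g0.
  apply.
  by rewrite normrM ler_piMr// sin_max.
by move=> /(_ h); lra.
Qed.

Lemma kap1_gt0 : 0 < kap 1.
Proof. by rewrite kap1 mulr_gt0 ?Gam_gt0// sqrtr_gt0 mulr_gt0// ?ltr0n// prM_gt0. Qed.

Lemma period0 : exists s : R, [/\ 2^-1 < s, s < 1 & period 0 = 2 * pi * s].
Proof.
exists (Num.sqrt 3 * kap 1).
have s0 : 0 < Num.sqrt 3 * kap 1 by rewrite mulr_gt0 ?kap1_gt0 ?sqrtr_gt0.
have s2 : (Num.sqrt 3 * kap 1) ^+ 2 = 2^-1.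
  by rewrite exprMn kap1_sqr sqr_sqrtr//; field.
split; last by rewrite /period per0 expr0n /= subr0; ring.
- rewrite -(@ltr_pXn2r _ 2) ?nnegrE ?(ltW s0)// s2; lra.
- rewrite -(@ltr_pXn2r _ 2) ?nnegrE ?(ltW s0)// s2; lra.
Qed.

(** To second order [sqrt (3 - A^2)] is [sqrt 3 (1 - A^2 / 6)] and [per A] is at most
    [2 pi kap 1 + l pi A^2 / 2]. In the product the coefficient of [A^2] has the sign of
    [l - 2 / 3 kap 1], whence the bound in [second_variation]. *)
Lemma period_decreases : exists2 A1, 0 < A1 <= A0 & period A1 < period 0.
Proof.
have [l hl dl] := @second_variation R m.
have k0 := kap1_gt0; have G0 : 0 < Gam 1 by exact: Gam_gt0.
(* Strictly above [l] for [symmetric_taylor], still below [2 / 3 kap 1], and nonnegative so that the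
   quartic remainder [l' (A1^2)^2] has the favourable sign. *)
pose l' := (Num.max l 0 + 2 / 3 * kap 1) / 2.
have ll : l < l' /\ 0 <= l' /\ l' < 2 / 3 * kap 1.
  by rewrite /l'; case: (leP l 0) => h; do ?split; lra.
have [ll' [l'0 l'k]] := ll; clearbody l'.
have dg0 : is_derive (0 : R) 1 (fun v => dkap (g v)) l.
  have [_ _ _ dg] : [/\ 0 < g 0, N%:R * g 0 ^+ 6 <= N%:R + 1, potx (g 0) = 0
    & is_derive (0 : R) 1 g (Gam (g 0))] by apply: gP; rewrite normr0 ltW.
  rewrite g0 in dg; have := @der_comp _ dkap g _ _ _ dg; rewrite g0 => /(_ _ dl).
  by rewrite divfK ?gt_eqF.
have [A1 /andP[A10 A1A] H] := symmetric_taylor A00 der_kg dg0 ll'.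
exists A1; first by rewrite A10.
have A1n : `|A1| <= A0 by rewrite ger0_norm// ltW.
have up := per_upper A1n (l := l').
have {}up : per A1 <= kap 1 * (2 * pi) + l' * A1 ^+ 2 * pi / 2.
  by apply: up => v; rewrite (ger0_norm (ltW A10)) => /H.
have A13 := amplitude_lt3 A1n.
have A12 : 0 < A1 ^+ 2 by rewrite exprn_gt0.
rewrite /period per0 expr0n /= subr0.
(* The square root is concave and lies below its tangent. *)
have sq : Num.sqrt (3 - A1 ^+ 2) <= Num.sqrt 3 * (1 - A1 ^+ 2 / 6).
  have e : Num.sqrt 3 * (1 - A1 ^+ 2 / 6) = Num.sqrt (3 * (1 - A1 ^+ 2 / 6) ^+ 2).
    by rewrite sqrtrM// sqrtr_sqr ger0_norm//; lra.
  rewrite e ler_sqrt; last by rewrite mulr_ge0// sqr_ge0.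
  by rewrite -subr_ge0 (_ : _ - _ = (A1 ^+ 2) ^+ 2 / 12) ?divr_ge0 ?sqr_ge0//; field.
have pp : 0 < pi :> R by exact: pi_gt0.
have s3 : 0 < Num.sqrt 3 :> R by rewrite sqrtr_gt0.
have up0 : 0 <= kap 1 * (2 * pi) + l' * A1 ^+ 2 * pi / 2.
  have := ltW k0; have := ltW pp; have := ltW A12 => h1 h2 h3.
  have aux K : 0 <= K -> 0 <= K * (2 * pi) + l' * A1 ^+ 2 * pi / 2.
    by move=> K0; rewrite addr_ge0 ?divr_ge0 ?mulr_ge0// ltW.
  exact: aux.
apply: (@le_lt_trans _ _ (Num.sqrt 3 * (1 - A1 ^+ 2 / 6) *
    (kap 1 * (2 * pi) + l' * A1 ^+ 2 * pi / 2))).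
  apply: (le_trans (ler_wpM2l (sqrtr_ge0 _) up)).
  by rewrite ler_wpM2r.
rewrite -mulrA ltr_pM2l// -subr_gt0.
rewrite (_ : _ - _ = pi * (A1 ^+ 2 / 2) *
  ((2 / 3 * kap 1 - l') + l' * (A1 ^+ 2 / 6))); last by field.
rewrite mulr_gt0 ?mulr_gt0 ?divr_gt0// ltr_pwDl ?subr_gt0// mulr_ge0// divr_ge0// ltW//.
Qed.

(* Amplitudes whose angular period is a rational multiple of [2 pi] in
   [(pi, 2 pi)]. *)
Lemma rational_amplitudes : exists (A : nat -> R) (p l : nat -> nat),
  [/\ injective A, forall j, 0 < A j <= A0, forall j, (0 < l j)%N &
    forall j, pi < period (A j) < 2 * pi /\
      period (A j) * (l j)%:R = 2 * pi * (p j)%:R].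
Proof.
have [A1 /andP[A10 A1A] lt1] := period_decreases.
have [s [s1 s2 Es]] := period0.
have pp : 0 < pi :> R by exact: pi_gt0.
(* The bound [1 / 2] forces the selected periods above [pi], as the self-intersection requires. *)
pose a := Num.max (period A1 / (2 * pi)) 2^-1.
have a0 : 0 < a by rewrite lt_max invr_gt0 ltr0n orbT.
have as_ : a < s.
  by rewrite gt_max s1 andbT ltr_pdivrMr ?mulr_gt0// mulrC -Es.
have [p [l [l0 pl inj]]] := rationals_between a0 as_.
(* Clamping to [[0, A1]] yields a function continuous on the whole line, the form in which
   [intermediate_value] applies; the sign in [cneg] makes it go upwards. *)
pose c x : R := Num.min (Num.max x 0) A1.
have cb x : 0 <= c x <= A1.
  by rewrite /c le_min ge_min le_max lexx !orbT (ltW A10) lexx orbT.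
have cid x : 0 <= x <= A1 -> c x = x.
  by move=> /andP[x0 x1]; rewrite /c max_l// min_l.
have cA x : `|c x| <= A0.
  by have /andP[h1 h2] := cb x; rewrite ger0_norm// (le_trans h2).
have cc : continuous c.
  by apply: (@lipschitz_continuous _ _ 1) => x y; rewrite mul1r clamp_lipschitz// ltW.
have cper : continuous (fun x => per (c x)).
  have [L HL] := per_lipschitz.
  apply: (@lipschitz_continuous _ _ `|L|) => x y.
  apply: (le_trans (HL _ _ (cA x) (cA y))).
  apply: (@le_trans _ _ (`|L| * `|c x - c y|)); first by rewrite ler_wpM2r// ler_norm.
  by rewrite ler_wpM2l// clamp_lipschitz// ltW.
have cneg : continuous (fun x => - period (c x)).
  move=> x; rewrite /period; apply: (@continuousN _ _ _ (fun x => Num.sqrt (3 - c x ^+ 2) * per (c x))).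
  apply: continuousM; last exact: cper.
  apply: continuous_comp; last exact: sqrt_continuous.
  apply: continuousB; first exact: cst_continuous.
  apply: (@continuous_comp _ _ _ c (fun y => y ^+ 2)); first exact: cc.
  exact: exprn_continuous.
have ex j : exists A, 0 < A <= A0 /\ period A = 2 * pi * ((p j)%:R / (l j)%:R).
  have /andP[h1 h2] := pl j; set q := _ / _ in h1 h2 *.
  have aq : period A1 <= 2 * pi * q.
    rewrite mulrC -ler_pdivrMr ?mulr_gt0// (le_trans _ (ltW h1))//.
    by rewrite /a le_max lexx.
  have qs : 2 * pi * q < period 0 by rewrite Es ltr_pM2l// mulr_gt0.
  have [||A /andP[AA1 AA2] EA] := @intermediate_value _ (fun x => - period (c x)) 0 A1 (- (2 * pi * q)) cneg.
  - exact: ltW.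
  - by rewrite !cid ?lexx ?(ltW A10)// !lerN2 aq ltW.
  move: EA; rewrite cid ?AA1// => /oppr_inj EA; exists A; split => //.
  rewrite (le_trans AA2)// andbT lt_neqAle AA1 andbT; apply/eqP => E0.
  by move: qs; rewrite -EA -E0 ltxx.
have /choice[A HA] := ex.
exists A, p, l; split => //.
- by move=> i j E; apply: inj; move: (HA i).2 (HA j).2; rewrite E => -> /(mulfI _)-> //;
    rewrite mulf_neq0// gt_eqF.
- by move=> j; have [] := HA j.
- move=> j; have [_ ->] := HA j; have /andP[h1 h2] := pl j; split; last first.
    by rewrite -(mulrA (2 * pi)) divfK// pnatr_eq0 -lt0n.
  have h3 : 2^-1 < (p j)%:R / (l j)%:R :> R by rewrite (le_lt_trans _ h1)// le_max lexx orbT.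
  have h4 := lt_trans h2 s2.
  apply/andP; split.
    rewrite -[X in X < _]mulr1 [X in _ < X](_ : _ = pi * (2 * ((p j)%:R / (l j)%:R))); last by ring.
    rewrite ltr_pM2l//; lra.
  by rewrite gtr_pMr// mulr_gt0.
Qed.

End Angle.
End PeriodFunction.

(** [potx / Gam] is half the derivative of [potx ^ 2], hence minus half the derivative of the
    potential. It expresses through [y] the sine that appears when [cos t] is differentiated in
    [der_al]. *)
Lemma potx_Gam (R : realType) (m : nat) (y : R) : 0 < y ->
  potx m y = Gam m y * (m.+1%:R * @prM R m * (y ^+ m.+1 * y ^+ m) * (y ^+ 6 - 1)).
Proof.
move=> y0; rewrite /potx /Gam.
have q0 : 0 < y ^+ 4 + y ^+ 2 + 1.
  have e : y ^+ 4 = (y ^+ 2) ^+ 2 by rewrite -exprM.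
  by rewrite e ltr_wpDl// addr_ge0 ?sqr_ge0.
have ym : y ^+ m != 0 by rewrite gt_eqF// exprn_gt0.
rewrite [y ^+ (m + m).+1]exprS [y ^+ m.+1]exprS exprD; field.
by rewrite ym !gt_eqF// ?prM_gt0// ?ltr0n// mulr_gt0.
Qed.

(** * The profile curve *)

Section ProfileCurve.
Context {R : realType} (m : nat).
Local Notation N := m.+1.
Local Notation M := (@prM R m).
Local Notation Gam := (@Gam R m).
Local Notation w2 := (@w2 R m).
Local Notation potx := (@potx R m).

Variables (A0 : R) (g : R -> R).
Hypothesis A00 : 0 < A0.
Hypothesis gP : forall v : R, `|v| <= A0 -> [/\ 0 < g v, N%:R * g v ^+ 6 <= N%:R + 1,
    potx (g v) = v & is_derive v 1 g (Gam (g v))].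
Variables (A : R) (Phi : R -> R).
Hypothesis AA0 : `|A| <= A0.
Hypothesis dPhi : forall t : R, is_derive t 1 Phi (kg m g (A * sin t)).

Definition yc t := g (A * sin t).
Definition cA := Num.sqrt (3 - A ^+ 2).
Definition om t := Num.sqrt (w2 (yc t)).
Definition sN : R := Num.sqrt N%:R.
Definition sM : R := Num.sqrt M.
(* The profile curve is [(rr, ww cos ph, ww sin ph)]; its unit tangent and
   normal are [al (ww e_r - rr e_w) + be e_ph] and
   [be (ww e_r - rr e_w) - al e_ph], and [sp] is its speed. *)
Definition rr t := sN / sM * yc t ^+ 3.
Definition ww t := om t / sM.
Definition ph t := cA * Phi t.
Definition al t := A * cos t / (yc t ^+ N * om t).
Definition be t := cA / (yc t ^+ N * om t).
Definition sp t := 3 * sN * (yc t ^+ N * yc t ^+ 2) * Gam (yc t).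
Definition k1 t := sN * cA / (3 * (yc t ^+ N * yc t ^+ 3)).
Definition k2 t := - (cA / (sN * (yc t ^+ N * yc t ^+ 3))).

Let sinA t : `|A * sin t| <= A0. Proof. exact: sin_amplitude. Qed.

Lemma yc_gt0 t : 0 < yc t.
Proof. by have [] := gP (sinA t). Qed.

Lemma ycX_gt0 t k : 0 < yc t ^+ k. Proof. by rewrite exprn_gt0 ?yc_gt0. Qed.

Lemma cA_gt0 : 0 < cA.
Proof. by rewrite sqrtr_gt0 subr_gt0 (amplitude_lt3 gP AA0). Qed.

Lemma om_gt0 t : 0 < om t.
Proof. by rewrite sqrtr_gt0 (w2_gt0 gP (sinA t)). Qed.

Lemma om_sqr t : om t ^+ 2 = M - N%:R * yc t ^+ 6.
Proof. by rewrite sqr_sqrtr// ltW// (w2_gt0 gP (sinA t)). Qed.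

Lemma sN_gt0 : 0 < sN. Proof. by rewrite sqrtr_gt0 ltr0n. Qed.
Lemma sM_gt0 : 0 < sM. Proof. by rewrite sqrtr_gt0 prM_gt0. Qed.
Lemma sN_sqr : sN ^+ 2 = N%:R. Proof. by rewrite sqr_sqrtr// ler0n. Qed.
Lemma sM_sqr : sM ^+ 2 = sN ^+ 2 + 3.
Proof. by rewrite sN_sqr sqr_sqrtr// ltW// prM_gt0. Qed.

Lemma rr_gt0 t : 0 < rr t.
Proof. by rewrite mulr_gt0 ?divr_gt0 ?sN_gt0 ?sM_gt0 ?ycX_gt0. Qed.
Lemma ww_gt0 t : 0 < ww t.
Proof. by rewrite divr_gt0 ?om_gt0 ?sM_gt0. Qed.
Lemma be_gt0 t : 0 < be t.
Proof. by rewrite divr_gt0 ?cA_gt0// mulr_gt0 ?om_gt0 ?ycX_gt0. Qed.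
Lemma sp_gt0 t : 0 < sp t.
Proof.
by rewrite mulr_gt0 ?Gam_gt0 ?yc_gt0// mulr_gt0// mulr_gt0 ?ycX_gt0 ?sN_gt0// ltr0n.
Qed.

(* Conservation of energy along the profile curve. *)
Lemma energy t : (A * cos t) ^+ 2 + cA ^+ 2 = (yc t ^+ N * om t) ^+ 2.
Proof.
have [_ _ E _] := gP (sinA t).
rewrite sqr_sqrtr; last by rewrite ltW// subr_gt0 (amplitude_lt3 gP AA0).
have := potx_sqr m (yc t); rewrite /yc E !exprMn => E2.
rewrite om_sqr -/(w2 _) /yc -exprM muln2 -addnn.
have -> : g (A * sin t) ^+ (N + N) * w2 (g (A * sin t)) = 3 - A ^+ 2 * sin t ^+ 2 by rewrite E2; ring.
by rewrite cos2sin2; ring.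
Qed.

Lemma alpha_beta t : al t ^+ 2 + be t ^+ 2 = 1.
Proof.
have h : yc t ^+ N * om t != 0 by rewrite gt_eqF// mulr_gt0 ?om_gt0 ?ycX_gt0.
by rewrite /al /be !expr_div_n -mulrDl energy divff// expf_neq0.
Qed.

Lemma rr_ww t : rr t ^+ 2 + ww t ^+ 2 = 1.
Proof.
rewrite /rr /ww exprMn !expr_div_n om_sqr -exprM sM_sqr -sN_sqr /prM -sN_sqr.
have : 0 < sN ^+ 2 + 3 by rewrite ltr_wpDl// sqr_ge0.
by move=> h; field; rewrite gt_eqF.
Qed.

Lemma der_yc (t : R) : is_derive t 1 yc (Gam (yc t) * (A * cos t)).
Proof.
have [_ _ _ dg] := gP (sinA t).
have d : is_derive t 1 (fun t => A * sin t) (A * cos t) by derive_eq; rewrite /=; ring.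
exact: (der_comp d dg).
Qed.

Lemma der_om (t : R) : is_derive t 1 om
  (- (3 * N%:R * yc t ^+ 5 * (Gam (yc t) * (A * cos t)) / om t)).
Proof.
have d : is_derive t 1 (fun t => w2 (yc t)) _ := der_comp (der_yc t) (der_w2 m (yc t)).
rewrite /om; derive_eq; first exact: (w2_gt0 gP (sinA t)).
by rewrite -/(om t); field; rewrite gt_eqF ?om_gt0.
Qed.

Lemma der_rr (t : R) : is_derive t 1 rr (sp t * (al t * ww t)).
Proof.
have d := der_yc t; have y0 := ycX_gt0 t N; have o0 := om_gt0 t; have M0 := sM_gt0.
rewrite /rr; derive_eq; rewrite /sp /al /ww /=; field.
by rewrite !gt_eqF.
Qed.

Lemma der_ww (t : R) : is_derive t 1 ww (- (sp t * (al t * rr t))).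
Proof.
have d := der_om t; have y0 := ycX_gt0 t N; have o0 := om_gt0 t; have M0 := sM_gt0.
rewrite /ww; derive_eq; rewrite /sp /al /rr /= -sN_sqr; field.
by rewrite !gt_eqF.
Qed.

Lemma der_ph (t : R) : is_derive t 1 ph (sp t * be t / ww t).
Proof.
have d := dPhi t; have y0 := ycX_gt0 t N; have o0 := om_gt0 t; have M0 := sM_gt0.
rewrite /ph; derive_eq; rewrite /kg /kap -/(yc t) sqrtrM ?ler0n// -/sN -/sM.
have -> : w2 (yc t) = om t ^+ 2 by rewrite om_sqr.
rewrite /sp /be /ww; field.
by rewrite !gt_eqF.
Qed.

Lemma der_be_ww (t : R) : is_derive t 1 (fun t => be t * ww t)
  (- (k1 t * sp t * (al t * ww t))).
Proof.
have d := der_yc t; have y0 := ycX_gt0 t N; have o0 := om_gt0 t; have M0 := sM_gt0.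
have yp := yc_gt0 t.
have -> : (fun t => be t * ww t) = (fun t => cA / (sM * yc t ^+ N)).
  apply/funext => s; rewrite /be /ww; field.
  by rewrite !gt_eqF ?om_gt0 ?ycX_gt0.
derive_eq; first by rewrite mulf_neq0 ?gt_eqF.
rewrite /k1 /sp /al /ww /= -sN_sqr [yc t ^+ N]exprS; field.
by rewrite !gt_eqF ?ycX_gt0.
Qed.

Lemma der_al (t : R) : is_derive t 1 al
  (k1 t * sp t * be t - be t * rr t * (sp t * be t / ww t)).
Proof.
have d1 := der_yc t; have d2 := der_om t.
have y0 := ycX_gt0 t N; have ym := ycX_gt0 t m.
have o0 := om_gt0 t; have M0 := sM_gt0; have yp := yc_gt0 t.
have [_ _ E _] := gP (sinA t).
have E1 : A * sin t = Gam (yc t) *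
   (N%:R * M * (yc t ^+ N * yc t ^+ m) * (yc t ^+ 6 - 1)) by rewrite -potx_Gam.
rewrite /al; derive_eq; first by rewrite mulf_neq0 ?gt_eqF.
rewrite /= /k1 /sp /be /rr /ww.
have en := energy t; have os := om_sqr t.
move: E1 en os; rewrite /prM -sN_sqr ![yc t ^+ m.+1]exprS.
set y := yc t in yp *; set o := om t in o0 *; set G := Gam y; set C := A * cos t.
set Y := y ^+ m in ym *; set c := cA; set n := sN => E1 en os.
apply/eqP; rewrite -subr_eq0; apply/eqP.
(* The difference of the two sides is a combination of the relations [E1], [en] and [os], with the
   coefficients found by eliminating the sine, [C^2 + c^2] and [o^2]. *)
transitivity (- (y * Y * o)^-1 * (A * sin t - G * (n ^+ 2 * (n ^+ 2 + 3) * (y * Y * Y) * (y ^+ 6 - 1)))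
  + G * n ^+ 2 * (3 * y ^+ 4 / (Y * o ^+ 3) - (y ^+ 2 * Y * o)^-1) * (C ^+ 2 + c ^+ 2 - (y * Y * o) ^+ 2)
  - G * n ^+ 2 * Y / o * (o ^+ 2 - (n ^+ 2 + 3 - n ^+ 2 * y ^+ 6))).
  by rewrite /C; field; rewrite !gt_eqF.
by rewrite E1 en os !subrr !mulr0 subr0 addr0.
Qed.

(** This is the biconservative equation: [grad H] points along the profile curve, and there the
    equation reads [2 k1 + (k1 + N k2) = 0]. *)
Lemma k1_k2 t : 3 * k1 t + N%:R * k2 t = 0.
Proof.
have y0 := ycX_gt0 t N; have yp := yc_gt0 t; have s0 := sN_gt0.
by rewrite /k1 /k2 -sN_sqr; field; rewrite !gt_eqF.
Qed.

(** Along an orbit the normal varies with radius [be * ww] and the position with radius [rr]; the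
    ratio identifies [k2] as the principal curvature of the orbits. *)
Lemma be_ww_k2 t : be t * ww t = - k2 t * rr t.
Proof.
have y0 := ycX_gt0 t N; have yp := yc_gt0 t; have s0 := sN_gt0.
have o0 := om_gt0 t; have M0 := sM_gt0.
by rewrite /k2 /rr /be /ww; field; rewrite !gt_eqF.
Qed.

Lemma der_be_rr (t : R) : is_derive t 1 (fun t => be t * rr t)
  (al t * (sp t * be t / ww t) - k1 t * sp t * (al t * rr t)).
Proof.
have w0 := ww_gt0 t; have dw := der_ww t; have dr := der_rr t.
have dbw := der_be_ww t.
have -> : (fun t => be t * rr t) = (fun t => be t * ww t * rr t / ww t).
  by apply/funext => s; field; rewrite gt_eqF ?ww_gt0.
apply: (is_derive_eq (derM (derM dbw dr) (derV (lt0r_neq0 w0) dw))).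
apply/eqP; rewrite -subr_eq0; apply/eqP.
transitivity (sp t * al t * be t / ww t * (rr t ^+ 2 + ww t ^+ 2 - 1)).
  by rewrite /=; field; rewrite gt_eqF.
by rewrite rr_ww subrr mulr0.
Qed.

End ProfileCurve.

(** * Rotations about an axis *)

Section Cylindrical.
Context {R : realType} {d : nat}.
Implicit Types (w : 'rV[R]_d) (x : 'rV[R]_d.+2).

(* R^(n+1) = R^d x R^2 with d = n - 1, the rotations acting on the first factor. *)
Definition cyl w (a b : R) : 'rV[R]_d.+2 :=
  \row_k (if insub (nat_of_ord k) is Some i then w 0 i
          else if k == d :> nat then a else b).

Definition idx (i : 'I_d) : 'I_d.+2 := widen_ord (leqnSn _) (widen_ord (leqnSn _) i).
Definition idx1 : 'I_d.+2 := widen_ord (leqnSn _) ord_max.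
Definition idx2 : 'I_d.+2 := ord_max.

Lemma cyl_idx w a b i : cyl w a b 0 (idx i) = w 0 i.
Proof. by rewrite mxE /= insubT//= => h; congr (w 0 _); apply: val_inj. Qed.

Lemma cyl_idx1 w a b : cyl w a b 0 idx1 = a.
Proof. by rewrite mxE /= insubF ?ltnn ?eqxx. Qed.

Lemma cyl_idx2 w a b : cyl w a b 0 idx2 = b.
Proof.
rewrite mxE /= insubF; last by apply/negbTE; rewrite -leqNgt.
by rewrite gtn_eqF.
Qed.

Lemma idx_cases (P : 'I_d.+2 -> Prop) :
  (forall i, P (idx i)) -> P idx1 -> P idx2 -> forall k, P k.
Proof.
move=> H H1 H2 k; case: (ltnP k d) => kd.
  have -> : k = idx (Ordinal kd) by apply: val_inj.
  exact: H.
case: (eqVneq (nat_of_ord k) d) => kd'.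
  by have -> : k = idx1 by apply: val_inj.
have -> // : k = idx2.
by apply: val_inj => /=; have := ltn_ord k; lia.
Qed.

Lemma sum_idx (F : 'I_d.+2 -> R) : \sum_k F k = \sum_i F (idx i) + F idx1 + F idx2.
Proof. by rewrite big_ord_recr big_ord_recr. Qed.

Definition hd x : 'rV[R]_d := \row_i x 0 (idx i).

Lemma cylK w a b : hd (cyl w a b) = w.
Proof. by apply/rowP => i; rewrite mxE cyl_idx. Qed.

Lemma cyl_eta x : x = cyl (hd x) (x 0 idx1) (x 0 idx2).
Proof.
apply/rowP; apply: idx_cases => [i||]; rewrite ?cyl_idx ?cyl_idx1 ?cyl_idx2//.
by rewrite mxE.
Qed.

Lemma cylD w a b w' a' b' : cyl w a b + cyl w' a' b' = cyl (w + w') (a + a') (b + b').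
Proof.
apply/rowP; apply: idx_cases => [i||]; rewrite mxE ?cyl_idx ?cyl_idx1 ?cyl_idx2//.
by rewrite mxE.
Qed.

Lemma cylZ c w a b : c *: cyl w a b = cyl (c *: w) (c * a) (c * b).
Proof.
apply/rowP; apply: idx_cases => [i||]; rewrite mxE ?cyl_idx ?cyl_idx1 ?cyl_idx2//.
by rewrite mxE.
Qed.

Lemma dot_cyl w a b w' a' b' :
  dot (cyl w a b) (cyl w' a' b') = dot w w' + a * a' + b * b'.
Proof.
rewrite /dot sum_idx !cyl_idx1 !cyl_idx2; congr (_ + _ + _).
by apply: eq_bigr => i _; rewrite !cyl_idx.
Qed.

End Cylindrical.

Section Rotations.
Context {R : realType} {d : nat}.
Local Notation n := d.+1.
Implicit Types (A B : 'M[R]_n.+1) (w : 'rV[R]_d).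

(** As row [l] of [A] is a basis vector, the entry [(k, l)] of [A A^T = 1] is [A k l]. *)
Lemma rotation_col A (k l : 'I_n.+1) : rotations A -> (d <= l)%N -> A k l = (k == l)%:R.
Proof.
move=> [AA H] dl; have /matrixP/(_ k l) := AA.
rewrite !mxE => <-; rewrite (bigD1 l)//= mxE [A l l]H// eqxx mulr1.
rewrite big1 ?addr0// => j jl; rewrite mxE [A l j]H//.
by rewrite eq_sym (negbTE jl) mulr0.
Qed.

Lemma rotations1 : rotations (1%:M : 'M[R]_n.+1).
Proof.
split; first by rewrite /orthogonal_mx trmx1 mulmx1.
by move=> k l _; rewrite mxE.
Qed.

Lemma rotationsM A B : rotations A -> rotations B -> rotations (A *m B).
Proof.
move=> HA HB; have [AA _] := HA; have [BB _] := HB; split.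
  by rewrite /orthogonal_mx trmx_mul mulmxA -(mulmxA A) BB mulmx1.
move=> k l dk; rewrite mxE (bigD1 k)//= [A k k]HA.2// eqxx mul1r [B k l]HB.2//.
rewrite big1 ?addr0// => j jk; rewrite [A k j]HA.2//.
by rewrite eq_sym (negbTE jk) mul0r.
Qed.

Lemma rotation_axis A a b : rotations A -> cyl (0 : 'rV[R]_d) a b *m A = cyl 0 a b.
Proof.
move=> HA; apply/rowP => l; rewrite mxE sum_idx big1 => [|i _]; last first.
  by rewrite cyl_idx mxE mul0r.
rewrite add0r cyl_idx1 cyl_idx2 !HA.2//=.
move: l; apply: idx_cases => [i||]; rewrite ?cyl_idx ?cyl_idx1 ?cyl_idx2.
- rewrite mxE.
  have -> : (idx1 == idx i) = false by apply/negbTE; rewrite -val_eqE /= gtn_eqF.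
  have -> : (idx2 == idx i) = false.
    by apply/negbTE; rewrite -val_eqE /= gtn_eqF// ltnS ltnW.
  by rewrite !mulr0 addr0.
- by rewrite eqxx -val_eqE /= gtn_eqF// mulr1 mulr0 addr0.
- by rewrite eqxx -val_eqE /= ltn_eqF// mulr1 mulr0 add0r.
Qed.

Lemma rotation_cyl A w : rotations A -> exists2 w' : 'rV[R]_d,
  dot w' w' = dot w w & forall r a b, cyl (r *: w) a b *m A = cyl (r *: w') a b.
Proof.
move=> HA; pose w' := hd (cyl w 0 0 *m A).
have E : cyl w 0 0 *m A = cyl w' 0 0.
  rewrite [LHS]cyl_eta; congr cyl; rewrite mxE sum_idx.
    rewrite !cyl_idx1 !cyl_idx2 !mul0r !addr0 big1// => i _.
    by rewrite rotation_col//= -val_eqE /= ltn_eqF ?mulr0.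
  rewrite !cyl_idx1 !cyl_idx2 !mul0r !addr0 big1// => i _.
  by rewrite rotation_col//= -val_eqE /= ltn_eqF ?mulr0// ltnS ltnW.
exists w'.
  have := dot_mulr (cyl w 0 0) (cyl w 0 0) HA.1.
  by rewrite E !dot_cyl !mulr0 !addr0.
move=> r a' b'.
have -> : cyl (r *: w) a' b' = r *: cyl w 0 0 + cyl 0 a' b'.
  by rewrite cylZ cylD !mulr0 !add0r addr0.
by rewrite mulmxDl rotation_axis// -scalemxAl E cylZ cylD !mulr0 !add0r addr0.
Qed.

Definition reflection (h : 'rV[R]_n.+1) : 'M[R]_n.+1 :=
  1%:M - (2 / dot h h) *: (h^T *m h).

Lemma mul_reflection (h x : 'rV[R]_n.+1) :
  x *m reflection h = x - (2 / dot h h * dot x h) *: h.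
Proof.
by rewrite mulmxBr mulmx1 -scalemxAr mulmxA dot_mulmx mul_scalar_mx scalerA.
Qed.

Lemma reflection_rotation (w : 'rV[R]_d) : dot w w != 0 ->
  rotations (reflection (cyl w 0 0)).
Proof.
move=> w0; set h := cyl w 0 0.
have hh0 : dot h h != 0 by rewrite dot_cyl !mulr0 !addr0.
have h0 (k : 'I_n.+1) : (d <= k)%N -> h 0 k = 0.
  rewrite /h; move: k; apply: idx_cases => [i||]; rewrite ?cyl_idx1 ?cyl_idx2//=.
  by rewrite leqNgt ltn_ord.
move: h hh0 h0 => h hh0 h0; split.
  have AT : (reflection h)^T = reflection h.
    by rewrite /reflection linearB /= trmx1 linearZ /= trmx_mul trmxK.
  rewrite /orthogonal_mx AT; apply/row_matrixP => i.
  have rA : row i (reflection h) = row i 1%:M *m reflection h.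
    by rewrite -row_mul mul1mx.
  rewrite row_mul rA !mul_reflection dotBl dotZl; set t := dot (row i _) h.
  have -> : t - 2 / dot h h * t * dot h h = - t by field.
  by rewrite mulrN scaleNr opprK subrK.
by move=> k l dk; rewrite !mxE big_ord1 !mxE h0// mul0r mulr0 subr0.
Qed.

Lemma dot_eq0 k (w : 'rV[R]_k) : dot w w = 0 -> w = 0.
Proof.
move=> /eqP; rewrite psumr_eq0 => [|j _]; last by rewrite -expr2 sqr_ge0.
move=> /allP H; apply/rowP => i; rewrite mxE; apply/eqP.
by have := H i; rewrite mem_index_enum mulf_eq0 orbb => /(_ isT).
Qed.

(** The reflection in the hyperplane orthogonal to [e - w] exchanges two distinct unit vectors, and
    the full orthogonal group contains reflections. *)
Lemma rotation_transitive (e w : 'rV[R]_d) : dot e e = 1 -> dot w w = 1 ->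
  exists2 A : 'M[R]_n.+1, rotations A &
    forall r a b, cyl (r *: e) a b *m A = cyl (r *: w) a b.
Proof.
move=> ee ww; case: (eqVneq e w) => [<-|ew].
  by exists 1%:M; [exact: rotations1|move=> *; rewrite mulmx1].
have hh : dot (e - w) (e - w) = 2 * dot (e - w) e.
  rewrite !dotBl !(dotC _ (e - w)) !dotBl ee ww (dotC w e); ring.
have hh0 : dot (e - w) (e - w) != 0.
  by apply: contra ew => /eqP/dot_eq0/eqP; rewrite subr_eq0.
exists (reflection (cyl (e - w) 0 0)); first exact: reflection_rotation.
move=> r a b; rewrite mul_reflection !dot_cyl !mulr0 !addr0 dotZl (dotC e).
have -> : 2 / dot (e - w) (e - w) * (r * dot (e - w) e) = r.
  by move: hh0; rewrite hh mulf_eq0 negb_or => /andP[_ h1]; field.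
rewrite -scaleNr cylZ cylD !mulr0 !addr0; congr cyl.
by rewrite scalerBr !scaleNr opprK addrA subrr add0r.
Qed.

End Rotations.

(** * The torus and its charts *)

Section SubsetTopology.
Context {X : topologicalType} (K : set X).

Lemma open_subset (B : set X) : open B -> open (set_val @^-1` B : set K).
Proof. by move=> oB; exists B. Qed.

Lemma continuous_into_subset (Y : topologicalType) (f : Y -> K) :
  continuous (fun y => set_val (f y) : X) -> continuous f.
Proof.
move=> cf; apply/continuousP => U [B oB <-].
by move/continuousP : cf => /(_ B oB).
Qed.

Lemma compact_subset_type : compact K -> compact [set: K].
Proof.
move=> cK F PF _.
pose G := set_val @ F : set_system X.
have GK : G K.
  suff : F (set_val @^-1` K) by [].
  by apply: (@filterS _ F _ setT) => [x _|]; [exact: set_valP|exact: filterT].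
have [p [Kp cp]] := cK G (fmap_proper_filter _ PF) GK.
exists (SigSub (mem_set Kp) : K); split => // A B FA nB.
have [/= U [[V oV <-] Vp VB]] : exists U, [/\ open (U : set K), U (SigSub (mem_set Kp)) & U `<=` B].
  by move: nB; rewrite nbhsE => -[U [oU Up] UB]; exists U.
have GA : G (set_val @` A).
  suff : F (set_val @^-1` (set_val @` A)) by [].
  by apply: (filterS _ FA) => a Aa; exists a.
have [y [Ay Vy]] := cp (set_val @` A) V GA (open_nbhs_nbhs (conj oV Vp)).
case: Ay => a Aa ay; exists a; split => //; apply: VB.
by rewrite /preimage/= ay.
Qed.

Lemma hausdorff_subset_type : hausdorff_space X -> hausdorff_space K.
Proof.
move=> hX x y H; apply: val_inj; apply: hX => A B nA nB.
have cv (z : K) : {for z, continuous (set_val : K -> X)} by exact: initial_continuous.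
have [z [Az Bz]] := H _ _ (cv x _ nA) (cv y _ nB).
by exists (set_val z).
Qed.

End SubsetTopology.

Lemma connected_rV (R : realType) n : connected [set: 'rV[R]_n].
Proof.
have -> : [set: 'rV[R]_n] = \bigcup_(v in [set: 'rV[R]_n]) ((fun t : R => t *: v) @` setT).
  apply/seteqP; split => // v _; exists v => //; exists 1 => //; exact: scale1r.
apply: bigcup_connected.
  by exists 0 => v _; exists 0 => //; exact: scale0r.
move=> v _; apply: connected_continuous_connected.
  by apply/connected_intervalP.
apply: continuous_subspaceT => t.
exact: scalel_continuous.
Qed.

Section Stereographic.
Context {R : realType} (k : nat).
Local Notation d := k.+1.
Implicit Types (b : bool) (u v : 'rV[R]_d).

Definition sgb b : R := (-1) ^+ b.

Lemma sgb_sqr b : sgb b * sgb b = 1.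
Proof. by case: b; rewrite /sgb ?expr1 ?expr0 ?mulrNN ?mulr1. Qed.

Definition inl (i : 'I_k) : 'I_d := widen_ord (leqnSn k) i.

Lemma ord_cases (P : 'I_d -> Prop) : (forall i, P (inl i)) -> P ord_max -> forall i, P i.
Proof.
move=> H H' i; case: (ltnP i k) => ik.
  have -> : i = inl (Ordinal ik) by apply: val_inj.
  exact: H.
have -> // : i = ord_max by apply: val_inj => /=; have := ltn_ord i; lia.
Qed.

(* The first [k] coordinates of the chart parametrize the sphere by inverse
   stereographic projection from one of the two poles; the last coordinate
   parametrizes the circle. *)
Definition es u : R := 1 + \sum_(i < k) u 0 (inl i) ^+ 2.
Definition st b u : 'rV[R]_d :=
  \row_i (if (i < k)%N then 2 * u 0 i / es u else sgb b * (2 - es u) / es u).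
Definition th b (a : R) : R := 2 * atan a + (if b then pi else 0).

Lemma es_gt0 u : 0 < es u.
Proof. by rewrite ltr_pwDl// sumr_ge0// => i _; exact: sqr_ge0. Qed.

Lemma st_inl b u i : st b u 0 (inl i) = 2 * u 0 (inl i) / es u.
Proof. by rewrite mxE /= ltn_ord. Qed.

Lemma st_max b u : st b u 0 ord_max = sgb b * (2 - es u) / es u.
Proof. by rewrite mxE /= ltnn. Qed.

Lemma dot_st b u : dot (st b u) (st b u) = 1.
Proof.
have e0 : es u != 0 by rewrite gt_eqF// es_gt0.
rewrite /dot big_ord_recr /=.
under eq_bigr => i _ do rewrite st_inl.
have -> : \sum_(i < k) 2 * u 0 (inl i) / es u * (2 * u 0 (inl i) / es u) =
    4 / es u ^+ 2 * (es u - 1).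
  rewrite /es addrAC subrr add0r mulr_sumr; apply: eq_bigr => i _.
  by field.
rewrite st_max.
have -> : sgb b * (2 - es u) / es u * (sgb b * (2 - es u) / es u) =
   (sgb b * sgb b) * ((2 - es u) ^+ 2 / es u ^+ 2) by field.
by rewrite sgb_sqr; field.
Qed.

Lemma cos_2atan (a : R) : cos (2 * atan a) = (1 - a ^+ 2) / (1 + a ^+ 2).
Proof.
have a0 : 0 < 1 + a ^+ 2 by rewrite ltr_pwDl// sqr_ge0.
rewrite mulrC mulr_natr cos_mulr2n cos_atan exprVn sqr_sqrtr ?ltW//.
by rewrite -mulr_natr; field; rewrite gt_eqF.
Qed.

Lemma sin_2atan (a : R) : sin (2 * atan a) = 2 * a / (1 + a ^+ 2).
Proof.
have a0 : 0 < 1 + a ^+ 2 by rewrite ltr_pwDl// sqr_ge0.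
have c0 : cos (atan a) != 0 by rewrite cos_atan invr_eq0 sqrtr_eq0 -ltNge.
rewrite mulrC mulr_natr sin_mulr2n.
have -> : sin (atan a) = a * cos (atan a).
  by rewrite -{2}(atanK a) /tan divfK.
rewrite mulrCA -expr2 cos_atan exprVn sqr_sqrtr ?ltW//.
by rewrite -mulr_natr; field; rewrite gt_eqF.
Qed.

Lemma cos_th b (a : R) : cos (th b a) = sgb b * ((1 - a ^+ 2) / (1 + a ^+ 2)).
Proof.
rewrite /th; case: b; rewrite /sgb ?cosDpi ?addr0 ?expr0 ?mul1r cos_2atan//.
by rewrite expr1 mulN1r.
Qed.

Lemma sin_th b (a : R) : sin (th b a) = sgb b * (2 * a / (1 + a ^+ 2)).
Proof.
rewrite /th; case: b; rewrite /sgb ?sinDpi ?addr0 ?expr0 ?mul1r sin_2atan//.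
by rewrite expr1 mulN1r.
Qed.

Definition torus : set 'rV[R]_d.+2 :=
  [set x | dot (hd x) (hd x) = 1 /\ x 0 idx1 ^+ 2 + x 0 idx2 ^+ 2 = 1].

Lemma torus_cyl (w : 'rV[R]_d) (t : R) : dot w w = 1 -> torus (cyl w (cos t) (sin t)).
Proof. by move=> ww; split; rewrite ?cylK// cyl_idx1 cyl_idx2 cos2Dsin2. Qed.

Definition pt (w : 'rV[R]_d) (t : R) (ww : dot w w = 1) : torus :=
  SigSub (mem_set (torus_cyl t ww)).

Definition par_torus (b : bool * bool) u : torus := pt (th b.2 (u 0 ord_max)) (dot_st b.1 u).

Lemma par_torusE (b : bool * bool) u :
  set_val (par_torus b u) = cyl (st b.1 u) (cos (th b.2 (u 0 ord_max))) (sin (th b.2 (u 0 ord_max))).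
Proof. by []. Qed.

(** Stereographic projection on the sphere and the half-angle formula
    [tan (a / 2) = sin a / (1 + cos a)] on the circle. *)
Definition inv_par (b : bool * bool) (x : 'rV[R]_d.+2) : 'rV[R]_d :=
  \row_i (if (i < k)%N then x 0 (idx i) / (1 + sgb b.1 * x 0 (idx ord_max))
     else sgb b.2 * x 0 idx2 / (1 + sgb b.2 * x 0 idx1)).

Definition chart_dom (b : bool * bool) : set 'rV[R]_d.+2 :=
  [set x | 1 + sgb b.1 * x 0 (idx ord_max) != 0 /\ 1 + sgb b.2 * x 0 idx1 != 0].

Lemma par_chart_dom (b : bool * bool) u : chart_dom b (set_val (par_torus b u)).
Proof.
have e0 : es u != 0 by rewrite gt_eqF// es_gt0.
have a0 : 1 + u 0 ord_max ^+ 2 != 0 by rewrite gt_eqF// ltr_pwDl// sqr_ge0.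
rewrite par_torusE; split; rewrite ?cyl_idx ?cyl_idx1.
  have -> : 1 + sgb b.1 * st b.1 u 0 ord_max = 2 / es u.
    by rewrite st_max -!mulrA mulrA sgb_sqr; field.
  by rewrite mulf_neq0// invr_eq0.
have -> : 1 + sgb b.2 * cos (th b.2 (u 0 ord_max)) = 2 / (1 + u 0 ord_max ^+ 2).
  by rewrite cos_th mulrA sgb_sqr; field.
by rewrite mulf_neq0// invr_eq0.
Qed.

Lemma par_torusK (b : bool * bool) u : inv_par b (set_val (par_torus b u)) = u.
Proof.
have e0 : es u != 0 by rewrite gt_eqF// es_gt0.
have a0 : 1 + u 0 ord_max ^+ 2 != 0 by rewrite gt_eqF// ltr_pwDl// sqr_ge0.
apply/rowP; rewrite par_torusE; apply: ord_cases => [i|]; rewrite mxE /= ?ltn_ord ?ltnn.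
  rewrite !cyl_idx st_inl.
  have -> : 1 + sgb b.1 * st b.1 u 0 ord_max = 2 / es u.
    by rewrite st_max -!mulrA mulrA sgb_sqr; field.
  by field.
rewrite cyl_idx1 cyl_idx2.
have -> : 1 + sgb b.2 * cos (th b.2 (u 0 ord_max)) = 2 / (1 + u 0 ord_max ^+ 2).
  by rewrite cos_th mulrA sgb_sqr; field.
rewrite sin_th mulrA sgb_sqr; field.
by rewrite a0.
Qed.

Lemma inv_parK (b : bool * bool) (x : torus) :
  chart_dom b (set_val x) -> par_torus b (inv_par b (set_val x)) = x.
Proof.
move=> [x1 x2]; have [H1 H2] := set_valP x.
suff E0 : set_val (par_torus b (inv_par b (set_val x))) = set_val x by exact: val_inj.
set y := set_val x in x1 x2 H1 H2 *.
have E : es (inv_par b y) = 2 / (1 + sgb b.1 * y 0 (idx ord_max)).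
  have : dot (hd y) (hd y) = 1 by [].
  rewrite /dot big_ord_recr /= !mxE => H3.
  rewrite /es.
  have -> : \sum_(i < k) inv_par b y 0 (inl i) ^+ 2 =
     (\sum_(i < k) hd y 0 (widen_ord (leqnSn k) i) * hd y 0 (widen_ord (leqnSn k) i)) / (1 + sgb b.1 * y 0 (idx ord_max)) ^+ 2.
    rewrite mulr_suml; apply: eq_bigr => i _; rewrite !mxE /= ltn_ord.
    by field.
  have -> : \sum_(i < k) hd y 0 (widen_ord (leqnSn k) i) * hd y 0 (widen_ord (leqnSn k) i) =
     (1 + sgb b.1 * y 0 (idx ord_max)) * (1 - sgb b.1 * y 0 (idx ord_max)).
    transitivity (1 - (sgb b.1 * sgb b.1) * (y 0 (idx ord_max) * y 0 (idx ord_max))); last by ring.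
    by rewrite sgb_sqr mul1r -[X in _ = X - _]H3 addrK.
  by field.
have F : 1 + inv_par b y 0 ord_max ^+ 2 = 2 / (1 + sgb b.2 * y 0 idx1).
  rewrite mxE /= ltnn expr_div_n exprMn.
  have -> : sgb b.2 ^+ 2 = 1 by rewrite expr2 sgb_sqr.
  have -> : y 0 idx2 ^+ 2 = (1 + sgb b.2 * y 0 idx1) * (1 - sgb b.2 * y 0 idx1).
    transitivity (1 - (sgb b.2 * sgb b.2) * (y 0 idx1 ^+ 2)); last by ring.
    by rewrite sgb_sqr mul1r -H2 addrAC subrr add0r.
  by field.
rewrite par_torusE [RHS]cyl_eta; congr cyl.
- apply/rowP; apply: ord_cases => [i|].
    rewrite st_inl E !mxE /= ltn_ord; field.
    by rewrite x1.
  rewrite st_max E mxE.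
  transitivity ((sgb b.1 * sgb b.1) * y 0 (idx ord_max)); first by field; rewrite x1.
  by rewrite sgb_sqr mul1r.
- rewrite cos_th F; transitivity ((sgb b.2 * sgb b.2) * y 0 idx1); last by rewrite sgb_sqr mul1r.
  have -> : 1 - inv_par b y 0 ord_max ^+ 2 = 2 - 2 / (1 + sgb b.2 * y 0 idx1).
    by rewrite -F; ring.
  by field; rewrite x2.
- rewrite sin_th F !mxE /= ltnn; transitivity ((sgb b.2 * sgb b.2) * y 0 idx2); last by rewrite sgb_sqr mul1r.
  by field; rewrite x2.
Qed.

Lemma inv_par_continuous (b : bool * bool) (x : 'rV[R]_d.+2) : chart_dom b x ->
  {for x, continuous (inv_par b)}.
Proof.
move=> [x1 x2].
have cc i : {for x, continuous (fun x : 'rV[R]_d.+2 => x 0 i)} by exact: coord_continuous.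
suff : inv_par b z @[z --> x] --> inv_par b x by [].
apply: (@cvg_rV R _ (nbhs x)); apply: ord_cases => [i|].
  rewrite /inv_par mxE /= ltn_ord.
  under eq_fun do rewrite mxE /= ltn_ord.
  apply: cvgM; first exact: cc.
  apply: cvgV => //; apply: cvgD; first exact: cvg_cst.
  by apply: cvgM; [exact: cvg_cst|exact: cc].
rewrite /inv_par mxE /= ltnn.
under eq_fun do rewrite mxE /= ltnn.
apply: cvgM; first by apply: cvgM; [exact: cvg_cst|exact: cc].
apply: cvgV => //; apply: cvgD; first exact: cvg_cst.
by apply: cvgM; [exact: cvg_cst|exact: cc].
Qed.

Lemma chart_dom_nbhs (b : bool * bool) (x : 'rV[R]_d.+2) : chart_dom b x ->
  \forall z \near x, chart_dom b z.
Proof.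
move=> [x1 x2].
have cc i : {for x, continuous (fun x : 'rV[R]_d.+2 => x 0 i)} by exact: coord_continuous.
have c1 i (s : R) : 1 + s * z 0 i @[z --> x] --> 1 + s * x 0 i.
  apply: cvgD; first exact: cvg_cst.
  by apply: cvgM; [exact: cvg_cst|exact: cc].
near=> z; split; near: z.
- exact: (cvgr_neq0 _ (c1 _ _) x1).
- exact: (cvgr_neq0 _ (c1 _ _) x2).
Unshelve. all: by end_near. Qed.

Lemma par_torus_open (b : bool * bool) (A : set 'rV[R]_d) : open A -> open (par_torus b @` A).
Proof.
move=> oA.
have -> : par_torus b @` A = set_val @^-1` [set x | chart_dom b x /\ A (inv_par b x)].
  apply/seteqP; split => [_ [u Au <-]|x [Dx Ax]].
    by split; [exact: par_chart_dom|rewrite par_torusK].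
  by exists (inv_par b (set_val x)) => //; exact: inv_parK.
apply: open_subset; rewrite openE => x [Dx Ax].
have nD := chart_dom_nbhs Dx.
have nA : \forall z \near x, A (inv_par b z).
  by apply: (inv_par_continuous Dx); exact: open_nbhs_nbhs.
rewrite /interior; near=> z; split; near: z; [exact: nD|exact: nA].
Unshelve. all: by end_near. Qed.

Lemma smooth_es : smooth es.
Proof.
apply: smoothD; first exact: smooth_cst.
by apply: smooth_sum => i; apply: smoothX; exact: smooth_coord.
Qed.

Lemma smooth_st b i : smooth (fun u => st b u 0 i).
Proof.
have e0 u : es u != 0 by rewrite gt_eqF// es_gt0.
move: i; apply: ord_cases => [i|].
  under eq_fun do rewrite st_inl.
  apply: smoothM; last by apply: smoothV => //; exact: smooth_es.
  by apply: smoothM; [exact: smooth_cst|exact: smooth_coord].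
under eq_fun do rewrite st_max.
apply: smoothM; last by apply: smoothV => //; exact: smooth_es.
apply: smoothM; first exact: smooth_cst.
by apply: smoothB; [exact: smooth_cst|exact: smooth_es].
Qed.

Lemma smooth_th b : smooth (fun u => th b (u 0 ord_max)).
Proof.
apply: smoothD; last exact: smooth_cst.
apply: smoothM; first exact: smooth_cst.
by apply: smooth_atan; exact: smooth_coord.
Qed.

Lemma par_torus_continuous (b : bool * bool) : continuous (par_torus b).
Proof.
apply: continuous_into_subset => u.
suff : set_val (par_torus b z) @[z --> u] --> set_val (par_torus b u) by [].
have sc (f : 'rV[R]_d -> R) : smooth f -> f z @[z --> u] --> f u.
  by move=> sf; exact: differentiable_continuous (Cs_diff u (sf 0%N)).
apply: (@cvg_rV R _ (nbhs u)); apply: idx_cases => [i||].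
- rewrite par_torusE cyl_idx; under eq_fun do rewrite par_torusE cyl_idx.
  by apply: sc; exact: smooth_st.
- rewrite par_torusE cyl_idx1; under eq_fun do rewrite par_torusE cyl_idx1.
  by apply: (sc (fun u => cos (th b.2 (u 0 ord_max)))); apply: smooth_cos; exact: smooth_th.
- rewrite par_torusE cyl_idx2; under eq_fun do rewrite par_torusE cyl_idx2.
  by apply: (sc (fun u => sin (th b.2 (u 0 ord_max)))); apply: smooth_sin; exact: smooth_th.
Qed.

Lemma par_torus_cover (x : torus) : exists b : bool * bool, chart_dom b (set_val x).
Proof.
have dec (a : R) : exists b, 1 + sgb b * a != 0.
  case: (eqVneq a (-1)) => [->|a1].
    by exists true; rewrite /sgb expr1 mulrNN mulr1 -[1 + 1]/(2%:R) pnatr_eq0.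
  exists false; rewrite /sgb expr0 mul1r addrC addr_eq0; exact: a1.
have [b1 h1] := dec (set_val x 0 (idx ord_max)); have [b2 h2] := dec (set_val x 0 idx1).
by exists (b1, b2).
Qed.

Lemma par_torus_inj (b : bool * bool) : injective (par_torus b).
Proof. by move=> u v E; rewrite -(par_torusK b u) E par_torusK. Qed.

Lemma torus_hausdorff : hausdorff_space (torus : set _).
Proof. by apply: hausdorff_subset_type; exact: norm_hausdorff. Qed.

Lemma torus_compact : compact [set: torus].
Proof.
apply: compact_subset_type; apply: bounded_closed_compact.
  exists 1; split; first exact: num_real.
  move=> M' M1 x [x1 x2]; apply: (le_trans _ (ltW M1)).
  have sq (a b : R) : 0 <= b -> a ^+ 2 + b = 1 -> `|a| <= 1.
    move=> b0 ab; rewrite -(@ler_pXn2r _ 2) ?nnegrE// expr1n real_normK ?num_real//.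
    by rewrite -ab lerDl.
  apply: norm_rV_le => //; apply: idx_cases => [i||].
  - apply: (sq _ (\sum_(j | j != i) hd x 0 j * hd x 0 j)).
      by apply: sumr_ge0 => j _; rewrite -expr2 sqr_ge0.
    by rewrite -[RHS]x1 /dot [RHS](bigD1 i)//= !mxE expr2; congr (_ + _); apply: eq_bigr => j _; rewrite !mxE.
  - by apply: (sq _ _ (sqr_ge0 _) x2).
  - by apply: (sq _ (x 0 idx1 ^+ 2) (sqr_ge0 _)); rewrite addrC.
have cf (f : 'rV[R]_d.+2 -> R) : smooth f -> closed (f @^-1` [set 1]).
  move=> sf; apply: closed_comp => [x _|]; last exact: closed_eq.
  exact: differentiable_continuous (Cs_diff x (sf 0%N)).
have -> : torus = (fun x => \sum_i x 0 (idx i) ^+ 2) @^-1` [set 1] `&`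
    (fun x => x 0 idx1 ^+ 2 + x 0 idx2 ^+ 2) @^-1` [set 1].
  apply/seteqP; split => x [x1 x2]; split => //=; rewrite -x1; apply: eq_bigr => i _;
  by rewrite !mxE expr2.
apply: closedI; apply: cf.
  by apply: smooth_sum => i; apply: smoothX; exact: smooth_coord.
by apply: smoothD; apply: smoothX; exact: smooth_coord.
Qed.

Lemma torus_connected : (0 < k)%N -> connected [set: torus].
Proof.
move=> k0.
have -> : [set: torus] = \bigcup_(b in [set: bool * bool]) (par_torus b @` setT).
  apply/seteqP; split => // x _; have [b xb] := par_torus_cover x.
  by exists b => //; exists (inv_par b (set_val x)) => //; exact: inv_parK.
(* A point on the equators of both factors lies in all four charts; for [k = 0] the sphere consists
   of two points and has no equator. *)
have ee : dot (delta_mx 0 (inl (Ordinal k0)) : 'rV[R]_d) (delta_mx 0 (inl (Ordinal k0))) = 1.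
  rewrite /dot (bigD1 (inl (Ordinal k0)))//= !mxE !eqxx mulr1 big1 ?addr0// => j jk.
  by rewrite !mxE eqxx /= (negbTE jk) mul0r.
apply: bigcup_connected.
  exists (pt (pi / 2) ee) => b _; exists (inv_par b (set_val (pt (pi / 2) ee))) => //.
  apply: inv_parK; split; rewrite /= ?cyl_idx ?cyl_idx1.
    rewrite !mxE eqxx /= (_ : ord_max == _ = false) ?mulr0 ?addr0 ?oner_neq0//.
    by apply/negbTE; rewrite -val_eqE /= gtn_eqF.
  by rewrite cos_pihalf mulr0 addr0 oner_neq0.
move=> b _; apply: connected_continuous_connected; first exact: connected_rV.
by apply: continuous_subspaceT; exact: par_torus_continuous.
Qed.

End Stereographic.

(** * The moving frame in space and the closing of the profile curve *)

Lemma cos_eq1 (R : realType) (x : R) : cos x = 1 -> 0 <= x ->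
  exists n : nat, x = 2 * pi * n%:R.
Proof.
move=> cx x0; have p2 : 0 < 2 * pi :> R by rewrite mulr_gt0// pi_gt0.
pose n := Num.truncn (x / (2 * pi)).
have /andP[n1 n2] : (n%:R <= x / (2 * pi) < n.+1%:R).
  by apply: truncn_itv; rewrite divr_ge0// ltW.
exists n; pose r := x - 2 * pi * n%:R.
have r0 : 0 <= r by rewrite subr_ge0 mulrC -ler_pdivlMr.
have r2 : r < 2 * pi.
  by move: n2; rewrite ltr_pdivrMr// -natr1 /r; lra.
have cr : cos r = 1.
  rewrite -cx -[in RHS](subrK (2 * pi * n%:R) x) -/r.
  by rewrite mulr_natr [2 * pi]mulrC mulr_natr (periodicn (@cosD2pi R)).
case: (eqVneq r 0) => [/eqP|rn0]; first by rewrite subr_eq0 => /eqP.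
have rp : 0 < r by rewrite lt_neqAle eq_sym rn0.
have s : 0 < sin (r / 2).
  apply: sin_gt0_pi; rewrite divr_gt0//=; lra.
have : cos r = 1 - 2 * sin (r / 2) ^+ 2.
  have -> : cos r = cos (r / 2 *+ 2) by rewrite -mulr_natr divfK.
  by rewrite cos_mulr2n cos2sin2 -mulr_natr; ring.
rewrite cr => h; have : 0 < sin (r / 2) ^+ 2 by rewrite exprn_gt0.
lra.
Qed.

Lemma cos_sin_eq (R : realType) (a b : R) : cos a = cos b -> sin a = sin b ->
  exists n : nat, a = b + 2 * pi * n%:R \/ b = a + 2 * pi * n%:R.
Proof.
move=> ec es.
have c1 : cos (a - b) = 1 by rewrite cosB ec es -!expr2 cos2Dsin2.
case: (leP 0 (a - b)) => h.
  by have [n E] := cos_eq1 c1 h; exists n; left; rewrite -E; ring.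
have c2 : cos (b - a) = 1 by rewrite -opprB cosN.
have [|n E] := cos_eq1 c2; first by rewrite -opprB oppr_ge0 ltW.
by exists n; right; rewrite -E; ring.
Qed.

Section LiftedCurve.
Context {R : realType} (m : nat).
Local Notation N := m.+1.
Local Notation Gam := (@Gam R m).
Local Notation potx := (@potx R m).

Variables (A0 : R) (g : R -> R).
Hypothesis A00 : 0 < A0.
Hypothesis gP : forall v : R, `|v| <= A0 -> [/\ 0 < g v, N%:R * g v ^+ 6 <= N%:R + 1,
    potx (g v) = v & is_derive v 1 g (Gam (g v))].
Variables (A : R) (Phi : R -> R).
Hypothesis AA0 : `|A| <= A0.
Hypothesis dPhi : forall t : R, is_derive t 1 Phi (kg m g (A * sin t)).

Local Notation yc := (@yc R g A).
Local Notation rr := (@rr R m g A).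
Local Notation ww := (@ww R m g A).
Local Notation ph := (@ph R A Phi).
Local Notation al := (@al R m g A).
Local Notation be := (@be R m g A).
Local Notation sp := (@sp R m g A).
Local Notation k1 := (@k1 R m g A).
Local Notation d := m.+2.
Implicit Types (w : 'rV[R]_d) (t : R).

Definition X1 t := ww t * cos (ph t).
Definition X2 t := ww t * sin (ph t).
Definition T1 t := - (al t * rr t) * cos (ph t) - be t * sin (ph t).
Definition T2 t := - (al t * rr t) * sin (ph t) + be t * cos (ph t).
Definition N1 t := - (be t * rr t) * cos (ph t) + al t * sin (ph t).
Definition N2 t := - (be t * rr t) * sin (ph t) - al t * cos (ph t).
(** In the unit sphere, [Xc] is the position, [Tc] the unit tangent along the profile curve and [Nc]
    the unit normal, at the place [w] of the orbit. *)
Definition Xc w t := cyl (rr t *: w) (X1 t) (X2 t).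
Definition Tc w t := cyl (al t * ww t *: w) (T1 t) (T2 t).
Definition Nc w t := cyl (be t * ww t *: w) (N1 t) (N2 t).

Lemma der_X1 t : is_derive t 1 X1 (sp t * T1 t).
Proof.
have d1 := der_ww gP AA0 t; have d2 := der_ph gP AA0 dPhi t.
have w0 := ww_gt0 gP AA0 t.
rewrite /X1; derive_eq; rewrite /T1 /=; field.
by rewrite gt_eqF.
Qed.

Lemma der_X2 t : is_derive t 1 X2 (sp t * T2 t).
Proof.
have d1 := der_ww gP AA0 t; have d2 := der_ph gP AA0 dPhi t.
have w0 := ww_gt0 gP AA0 t.
rewrite /X2; derive_eq; rewrite /T2 /=; field.
by rewrite gt_eqF.
Qed.

Lemma der_N1 t : is_derive t 1 N1 (- (k1 t * sp t) * T1 t).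
Proof.
have d1 := der_be_rr gP AA0 t; have d2 := der_ph gP AA0 dPhi t.
have d3 := der_al gP AA0 t; have w0 := ww_gt0 gP AA0 t.
apply: (is_derive_eq (derD (derM (derN d1) (der_cos d2)) (derM d3 (der_sin d2)))).
by rewrite /T1 /=; field; rewrite gt_eqF.
Qed.

Lemma der_N2 t : is_derive t 1 N2 (- (k1 t * sp t) * T2 t).
Proof.
have d1 := der_be_rr gP AA0 t; have d2 := der_ph gP AA0 dPhi t.
have d3 := der_al gP AA0 t; have w0 := ww_gt0 gP AA0 t.
apply: (is_derive_eq (derB (derM (derN d1) (der_sin d2)) (derM d3 (der_cos d2)))).
by rewrite /T2 /=; field; rewrite gt_eqF.
Qed.

Lemma dot_frame w t : dot w w = 1 ->
  [/\ dot (Xc w t) (Xc w t) = 1, dot (Tc w t) (Tc w t) = 1, dot (Nc w t) (Nc w t) = 1 &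
  [/\ dot (Nc w t) (Xc w t) = 0, dot (Nc w t) (Tc w t) = 0 & dot (Tc w t) (Xc w t) = 0]].
Proof.
move=> w1; rewrite !dot_cyl !dotZl !(dotC w (_ *: w)) !dotZl w1.
rewrite /X1 /X2 /T1 /T2 /N1 /N2.
have ab := alpha_beta gP AA0 t; have rw := rr_ww gP AA0 t.
have cs := cos2Dsin2 (ph t).
move: (al t) (be t) (rr t) (ww t) (cos _) (sin _) ab rw cs => a b r w' c s ab rw cs.
split; [| | |split].
- transitivity (r ^+ 2 + w' ^+ 2 * (c ^+ 2 + s ^+ 2)); first by ring.
  by rewrite cs mulr1.
- transitivity (a ^+ 2 * w' ^+ 2 + (a ^+ 2 * r ^+ 2 + b ^+ 2) * (c ^+ 2 + s ^+ 2)); first by ring.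
  by rewrite cs mulr1 addrA -mulrDr [_ + r ^+ 2]addrC rw mulr1.
- transitivity (b ^+ 2 * w' ^+ 2 + (b ^+ 2 * r ^+ 2 + a ^+ 2) * (c ^+ 2 + s ^+ 2)); first by ring.
  by rewrite cs mulr1 addrA -mulrDr [_ + r ^+ 2]addrC rw mulr1 addrC.
- transitivity (b * r * w' * (1 - (c ^+ 2 + s ^+ 2))); first by ring.
  by rewrite cs subrr mulr0.
- transitivity (a * b * ((r ^+ 2 - 1) * (c ^+ 2 + s ^+ 2) + w' ^+ 2)); first by ring.
  rewrite cs mulr1; transitivity (a * b * (r ^+ 2 + w' ^+ 2 - 1)); first by ring.
  by rewrite rw subrr mulr0.
- transitivity (a * r * w' * (1 - (c ^+ 2 + s ^+ 2))); first by ring.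
  by rewrite cs subrr mulr0.
Qed.

Section Smooth.
Context {V : normedModType R} (f : V -> R).
Hypothesis sf : smooth f.

Let sy : smooth (fun u => yc (f u)).
Proof.
apply: (@smooth_comp _ _ g (fun v => Gam (g v)) (fun u => A * sin (f u))).
- by move=> u; have [] := gP (sin_amplitude (f u) AA0).
- by apply: smoothM; [exact: smooth_cst|exact: smooth_sin].
- move=> k Hk; apply: CsM.
    apply: Cs_sqrt => [u|]; first by apply: Spoly_gt0 => //; exact: sqr_ge0.
    by apply: Cs_horner; exact: CsX.
  apply: CsV => [u|].
    have y0 : 0 < g (A * sin (f u)) by have [] := gP (sin_amplitude (f u) AA0).
    by rewrite gt_eqF// !mulr_gt0 ?ltr0n ?prM_gt0// ?addr_gt0 ?exprn_gt0.
  apply: CsM; first by apply: CsM; [exact: Cs_cst|exact: CsX].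
  by apply: CsD; [apply: CsD; exact: CsX|exact: Cs_cst].
Qed.

Let yX n (u : V) : yc (f u) ^+ n != 0.
Proof. by rewrite gt_eqF// (ycX_gt0 gP AA0). Qed.

Let so : smooth (fun u => om m g A (f u)).
Proof.
apply: smooth_sqrt => [u|]; first exact: (w2_gt0 gP (sin_amplitude _ AA0)).
apply: smoothB; first exact: smooth_cst.
by apply: smoothM; [exact: smooth_cst|exact: smoothX].
Qed.

Lemma smooth_rr : smooth (fun u => rr (f u)).
Proof. by apply: smoothM; [exact: smooth_cst|exact: smoothX]. Qed.

Lemma smooth_ww : smooth (fun u => ww (f u)).
Proof. by apply: smoothM; [exact: so|exact: smooth_cst]. Qed.

Lemma smooth_sp : smooth (fun u => sp (f u)).
Proof.
apply: smoothM.
  by apply: smoothM; [exact: smooth_cst|apply: smoothM; exact: smoothX].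
apply: smoothM.
  apply: smooth_sqrt => [u|k]; first by apply: Spoly_gt0 => //; exact: sqr_ge0.
  by apply: Cs_horner; exact: (smoothX 2 sy).
apply: smoothV => [u|].
  have y0 := yc_gt0 gP AA0 (f u).
  by rewrite gt_eqF// !mulr_gt0 ?ltr0n ?prM_gt0// ?addr_gt0 ?exprn_gt0.
apply: smoothM; first by apply: smoothM; [exact: smooth_cst|exact: smoothX].
by apply: smoothD; [apply: smoothD; exact: smoothX|exact: smooth_cst].
Qed.

Let sD : smooth (fun u => (yc (f u) ^+ N * om m g A (f u))^-1).
Proof.
apply: smoothV => [u|].
  by rewrite mulf_neq0// gt_eqF// (om_gt0 gP AA0).
by apply: smoothM; [exact: smoothX|exact: so].
Qed.

Lemma smooth_al : smooth (fun u => al (f u)).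
Proof.
apply: smoothM => //.
by apply: smoothM; [exact: smooth_cst|exact: smooth_cos].
Qed.

Lemma smooth_be : smooth (fun u => be (f u)).
Proof. by apply: smoothM => //; exact: smooth_cst. Qed.

Lemma smooth_ph : smooth (fun u => ph (f u)).
Proof.
apply: smoothM; first exact: smooth_cst.
apply: (@smooth_comp _ _ Phi (fun t => kg m g (A * sin t))) => // k _.
suff : smooth (fun u => kap m (yc (f u))) by apply.
have G : smooth (fun u => Gam (yc (f u))).
  have -> : (fun u => Gam (yc (f u))) = (fun u => sp (f u) *
      (3 * @sN R m)^-1 * (yc (f u) ^+ N * yc (f u) ^+ 2)^-1).
    apply/funext => u; rewrite /sp; field.
    by rewrite !yX -[X in X != 0]expr1 yX gt_eqF// sN_gt0.
  apply: smoothM.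
    by apply: smoothM; [exact: smooth_sp|exact: smooth_cst].
  by apply: smoothV => [u|]; [rewrite mulf_neq0|apply: smoothM; exact: smoothX].
apply: smoothM.
  by apply: smoothM => //; apply: smoothM; [exact: smooth_cst|exact: smoothX].
apply: smoothV => [u|].
  by rewrite gt_eqF// (w2_gt0 gP (sin_amplitude _ AA0)).
apply: smoothB; first exact: smooth_cst.
by apply: smoothM; [exact: smooth_cst|exact: smoothX].
Qed.

Let sc := smooth_cos smooth_ph.
Let ss := smooth_sin smooth_ph.

Lemma smooth_X1 : smooth (fun u => X1 (f u)).
Proof. by apply: smoothM => //; exact: smooth_ww. Qed.
Lemma smooth_X2 : smooth (fun u => X2 (f u)).
Proof. by apply: smoothM => //; exact: smooth_ww. Qed.

Lemma smooth_N1 : smooth (fun u => N1 (f u)).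
Proof.
apply: smoothD; apply: smoothM => //; last exact: smooth_al.
by apply: smoothN; apply: smoothM; [exact: smooth_be|exact: smooth_rr].
Qed.
Lemma smooth_N2 : smooth (fun u => N2 (f u)).
Proof.
apply: smoothB; apply: smoothM => //; last exact: smooth_al.
by apply: smoothN; apply: smoothM; [exact: smooth_be|exact: smooth_rr].
Qed.

End Smooth.

Section Periodic.
Variables (l p : nat).
Hypothesis lp : cA A * (Phi (2 * pi) - Phi 0) * l%:R = 2 * pi * p%:R.

Lemma yc_period t n : yc (t + 2 * pi * n%:R) = yc t.
Proof. by rewrite /yc mulr_natr [2 * pi]mulrC mulr_natr (periodicn (@sinD2pi R)). Qed.

Lemma ph_period t n : ph (t + 2 * pi * n%:R) = ph t + cA A * (Phi (2 * pi) - Phi 0) * n%:R.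
Proof.
elim: n => [|n IH]; first by rewrite !mulr0 !addr0.
rewrite -(natr1 n) mulrDr mulr1 addrA /ph (angle_periodic dPhi).
by move: IH; rewrite /ph => IH; rewrite mulrDr IH; ring.
Qed.

(** In [l] oscillations of the distance the polar angle makes [p] full turns. *)
Lemma curve_period w t n :
  Xc w (t + 2 * pi * (l * n)%:R) = Xc w t /\ Nc w (t + 2 * pi * (l * n)%:R) = Nc w t.
Proof.
have Ep : ph (t + 2 * pi * (l * n)%:R) = ph t + (pi *+ 2) *+ (p * n).
  by rewrite ph_period natrM mulrA lp -(mulr_natr (pi *+ 2)) natrM -(mulr_natr pi 2); ring.
have cp : cos (ph (t + 2 * pi * (l * n)%:R)) = cos (ph t).
  by rewrite Ep (periodicn (@cosD2pi R)).
have sp' : sin (ph (t + 2 * pi * (l * n)%:R)) = sin (ph t).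
  by rewrite Ep (periodicn (@sinD2pi R)).
have ct : cos (t + 2 * pi * (l * n)%:R) = cos t.
  by rewrite mulr_natr [2 * pi]mulrC mulr_natr (periodicn (@cosD2pi R)).
by split; rewrite /Xc /Nc /X1 /X2 /N1 /N2 /rr /ww /al /be /om ?cp ?sp' ?ct !yc_period.
Qed.

(** It makes the curve point at parameter [l * a] a function of the point of the circle at angle
    [a], so that the map on the torus is well defined. *)
Lemma curve_lift w a b : cos a = cos b -> sin a = sin b ->
  Xc w (l%:R * a) = Xc w (l%:R * b) /\ Nc w (l%:R * a) = Nc w (l%:R * b).
Proof.
move=> ec es; have [n [->|->]] := cos_sin_eq ec es.
  have -> : l%:R * (b + 2 * pi * n%:R) = l%:R * b + 2 * pi * (l * n)%:R by rewrite natrM; ring.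
  exact: curve_period.
have -> : l%:R * (a + 2 * pi * n%:R) = l%:R * a + 2 * pi * (l * n)%:R by rewrite natrM; ring.
by have [-> ->] := curve_period w (l%:R * a) n.
Qed.

End Periodic.
End LiftedCurve.

(** * The immersion *)

Section Coordinates.
Context {R : realType} {n : nat}.
Implicit Types (v w : 'rV[R]_n).

Lemma scale_coord (a : R) v j : (a *: v) 0 j = a * v 0 j.
Proof. by rewrite mxE. Qed.

Lemma add_coord v w j : (v + w) 0 j = v 0 j + w 0 j.
Proof. by rewrite mxE. Qed.

Lemma derive_rV (V : normedModType R) (F : V -> 'rV[R]_n) (u v : V) (F' : 'rV[R]_n) :
  (forall j, is_derive u v (fun u => F u 0 j) (F' 0 j)) -> is_derive u v F F'.
Proof.
move=> H; have dF : derivable F u v.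
  by apply/derivable_mxP => i j; rewrite (ord1 i); case: (H j).
apply: DeriveDef => //.
by rewrite (derive_mx dF); apply/rowP => j; rewrite mxE; exact: derive_val.
Qed.

Definition rV_coord := (scale_coord, add_coord).
End Coordinates.

Section StereographicDerivative.
Context {R : realType} (k : nat).
Local Notation d := k.+1.
Implicit Types (b : bool) (u v : 'rV[R]_d).

Definition pd u v : R := \sum_(i < k) u 0 (inl i) * v 0 (inl i).
Definition dst b u v : 'rV[R]_d :=
  \row_i (if (i < k)%N then 2 * v 0 i / es u - 4 * u 0 i * pd u v / es u ^+ 2
          else sgb b * (- (4 * pd u v / es u ^+ 2))).

Lemma dst_inl b u v i : dst b u v 0 (inl i) =
  2 * v 0 (inl i) / es u - 4 * u 0 (inl i) * pd u v / es u ^+ 2.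
Proof. by rewrite mxE /= ltn_ord. Qed.

Lemma dst_max b u v : dst b u v 0 ord_max = sgb b * (- (4 * pd u v / es u ^+ 2)).
Proof. by rewrite mxE /= ltnn. Qed.

Lemma der_coord (n : nat) (i : 'I_n) (u v : 'rV[R]_n) :
  is_derive u v (fun u : 'rV[R]_n => u 0 i) (v 0 i).
Proof.
apply: DeriveDef; first by apply: diff_derivable; exact: differentiable_coord.
rewrite /derive; apply: cvg_lim => //=.
apply: cvg_near_cst; near=> h.
rewrite /= !mxE addrK -[RHS]scale1r.
rewrite -[in RHS](@mulVf _ h); first by rewrite scalerA.
by near: h; exact: nbhs_dnbhs_neq.
Unshelve. all: by end_near. Qed.

Lemma der_es u v : is_derive u v (@es R k) (2 * pd u v).
Proof.
have H (i : 'I_k) : is_derive u v (fun u => u 0 (inl i) ^+ 2) (2 * (u 0 (inl i) * v 0 (inl i))).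
  by apply: (is_derive_eq (derX 2 (der_coord (inl i) u v))); rewrite mulrA.
have H2 : is_derive u v (fun u => \sum_(i < k) u 0 (inl i) ^+ 2) (2 * pd u v).
  have := is_derive_sum H; rewrite -mulr_sumr.
  by congr is_derive; apply/funext => x; rewrite fct_sumE.
by apply: (is_derive_eq (derD (der_cst 1 u v) H2)); rewrite add0r.
Qed.

Lemma der_st b u v i : is_derive u v (fun u => st b u 0 i) (dst b u v 0 i).
Proof.
have e0 : es u != 0 by rewrite gt_eqF// es_gt0.
have de := der_es u v.
move: i; apply: ord_cases => [i|].
  under eq_fun do rewrite st_inl; rewrite dst_inl.
  apply: (is_derive_eq (derM (derM (der_cst 2 u v) (der_coord (inl i) u v)) (derV e0 de))).
  by field.
under eq_fun do rewrite st_max; rewrite dst_max.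
apply: (is_derive_eq (derM (derM (der_cst (sgb b) u v) (derB (der_cst 2 u v) de)) (derV e0 de))).
by field.
Qed.

Lemma dot_dst b u v v' : dot (dst b u v) (dst b u v') = 4 / es u ^+ 2 * pd v v'.
Proof.
have e0 : es u != 0 by rewrite gt_eqF// es_gt0.
rewrite /dot big_ord_recr /= !dst_max.
have -> : \sum_(i < k) dst b u v 0 (widen_ord (leqnSn k) i) * dst b u v' 0 (widen_ord (leqnSn k) i) =
   4 / es u ^+ 2 * pd v v' - 16 * pd u v * pd u v' / es u ^+ 3
   + 16 * pd u v * pd u v' / es u ^+ 4 * (es u - 1).
  transitivity (\sum_(i < k) (4 / es u ^+ 2 * (v 0 (inl i) * v' 0 (inl i))
    - 8 * pd u v' / es u ^+ 3 * (u 0 (inl i) * v 0 (inl i))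
    - 8 * pd u v / es u ^+ 3 * (u 0 (inl i) * v' 0 (inl i))
    + 16 * pd u v * pd u v' / es u ^+ 4 * u 0 (inl i) ^+ 2)).
    by apply: eq_bigr => i _; rewrite -/(inl i) !dst_inl; field.
  rewrite big_split /= sumrB sumrB -!mulr_sumr.
  rewrite -/(pd v v') -/(pd u v) -/(pd u v').
  have -> : \sum_(i < k) u 0 (inl i) ^+ 2 = es u - 1 by rewrite /es addrAC subrr add0r.
  by field.
transitivity (4 / es u ^+ 2 * pd v v' - 16 * pd u v * pd u v' / es u ^+ 3
   + 16 * pd u v * pd u v' / es u ^+ 4 * (es u - 1)
   + (sgb b * sgb b) * (16 * pd u v * pd u v' / es u ^+ 4)); first by field.
by rewrite sgb_sqr; field.
Qed.

Lemma dot_st_dst b u v : dot (st b u) (dst b u v) = 0.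
Proof.
have e0 : es u != 0 by rewrite gt_eqF// es_gt0.
rewrite /dot big_ord_recr /= dst_max st_max.
have -> : \sum_(i < k) st b u 0 (widen_ord (leqnSn k) i) * dst b u v 0 (widen_ord (leqnSn k) i) =
   4 / es u ^+ 2 * pd u v - 8 * pd u v / es u ^+ 3 * (es u - 1).
  transitivity (\sum_(i < k) (4 / es u ^+ 2 * (u 0 (inl i) * v 0 (inl i))
    - 8 * pd u v / es u ^+ 3 * u 0 (inl i) ^+ 2)).
    by apply: eq_bigr => i _; rewrite -/(inl i) dst_inl st_inl; field.
  rewrite sumrB -!mulr_sumr -/(pd u v).
  by have -> : \sum_(i < k) u 0 (inl i) ^+ 2 = es u - 1 by rewrite /es addrAC subrr add0r.
transitivity (4 / es u ^+ 2 * pd u v - 8 * pd u v / es u ^+ 3 * (es u - 1)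
  - (sgb b * sgb b) * ((2 - es u) * 4 * pd u v / es u ^+ 3)); first by field.
by rewrite sgb_sqr; field.
Qed.

Lemma der_th b u v : is_derive u v (fun u => th b (u 0 ord_max))
  (2 / (1 + u 0 ord_max ^+ 2) * v 0 ord_max).
Proof.
have d1 : is_derive u v (fun u => atan (u 0 ord_max)) ((1 + u 0 ord_max ^+ 2)^-1 * v 0 ord_max).
  apply: (@is_derive_comp1 _ _ atan (fun u => u 0 ord_max)) => //.
  + exact: der_coord.
  + exact: differentiable_coord.
apply: (is_derive_eq (derD (derM (der_cst 2 u v) d1) (der_cst (if b then pi else 0) u v))).
by rewrite mulr0 !addr0 mulrA.
Qed.

Lemma pd_delta i j : pd (delta_mx 0 i) (delta_mx 0 j) = ((i < k)%N && (i == j))%:R.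
Proof.
rewrite /pd; move: i; apply: ord_cases => [i|]; rewrite /= ?ltn_ord ?ltnn /=; last first.
  rewrite big1// => l _; rewrite !mxE eqxx /= -val_eqE /= ltn_eqF//.
  by rewrite mul0r.
rewrite (bigD1 i)//= !mxE !eqxx /= mul1r big1 ?addr0// => l li.
rewrite !mxE eqxx /= (_ : inl l == inl i = false) ?mul0r//.
by apply/negbTE; apply: contra li => /eqP/(congr1 val)/= /val_inj ->.
Qed.

End StereographicDerivative.

Section Immersion.
Context {R : realType} (m : nat) (rho : R).
Hypothesis rho0 : 0 < rho.
Local Notation N := m.+1.
Local Notation Gam := (@Gam R m).
Local Notation potx := (@potx R m).

Variables (A0 : R) (g : R -> R).
Hypothesis A00 : 0 < A0.
Hypothesis gP : forall v : R, `|v| <= A0 -> [/\ 0 < g v, N%:R * g v ^+ 6 <= N%:R + 1,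
    potx (g v) = v & is_derive v 1 g (Gam (g v))].
Variables (A : R) (Phi : R -> R).
Hypothesis AA0 : `|A| <= A0.
Hypothesis dPhi : forall t : R, is_derive t 1 Phi (kg m g (A * sin t)).
Variables (l p : nat).
Hypothesis l0 : (0 < l)%N.
Hypothesis lp : cA A * (Phi (2 * pi) - Phi 0) * l%:R = 2 * pi * p%:R.

Local Notation rr := (@rr R m g A).
Local Notation ww := (@ww R m g A).
Local Notation be := (@be R m g A).
Local Notation sp := (@sp R m g A).
Local Notation k1 := (@k1 R m g A).
Local Notation Xc := (@Xc R m g A Phi).
Local Notation Tc := (@Tc R m g A Phi).
Local Notation Nc := (@Nc R m g A Phi).
Local Notation X1 := (@X1 R m g A Phi).
Local Notation X2 := (@X2 R m g A Phi).
Local Notation N1 := (@N1 R m g A Phi).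
Local Notation N2 := (@N2 R m g A Phi).
Local Notation d := m.+2.
Local Notation T := (@torus R N : set _).
Implicit Types (w : 'rV[R]_d) (t : R) (x : T) (b : bool * bool) (u v : 'rV[R]_d).

Definition sr : R := Num.sqrt rho.
Lemma sr_gt0 : 0 < sr. Proof. by rewrite sqrtr_gt0. Qed.
Lemma sr_sqr : sr ^+ 2 = rho. Proof. by rewrite sqr_sqrtr// ltW. Qed.

(** Any angle of the circle component, chosen without regard to continuity; by [curve_lift] the
    values of [immT] and [etaT] do not depend on the choice. *)
Definition ang x : R := xget 0 [set a | cos a = set_val x 0 idx1 /\ sin a = set_val x 0 idx2].
Definition immT x : 'rV[R]_d.+2 := sr^-1 *: Xc (hd (set_val x)) (l%:R * ang x).
Definition etaT x : 'rV[R]_d.+2 := Nc (hd (set_val x)) (l%:R * ang x).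

Lemma imm_pt w a (ww : dot w w = 1) :
  immT (pt a ww) = sr^-1 *: Xc w (l%:R * a) /\ etaT (pt a ww) = Nc w (l%:R * a).
Proof.
have [ec es] : cos (ang (pt a ww)) = cos a /\ sin (ang (pt a ww)) = sin a.
  rewrite /ang; case: xgetP => [b _ []|/(_ a) []]; first by rewrite /= cyl_idx1 cyl_idx2.
  by rewrite /= cyl_idx1 cyl_idx2.
have [E1 E2] := curve_lift dPhi lp w ec es.
by rewrite /immT /etaT /= cylK E1 E2.
Qed.

Lemma immT_cover x : exists w t, [/\ dot w w = 1, immT x = sr^-1 *: Xc w t & etaT x = Nc w t].
Proof. by exists (hd (set_val x)), (l%:R * ang x); split => //; have [] := set_valP x. Qed.

Definition tt b u : R := l%:R * th b.2 (u 0 ord_max).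
Definition lam u : R := l%:R * (2 / (1 + u 0 ord_max ^+ 2)).

Lemma lam_gt0 u : 0 < lam u.
Proof. by rewrite mulr_gt0 ?ltr0n// divr_gt0// ltr_pwDl// sqr_ge0. Qed.

Lemma smooth_tt b : smooth (tt b).
Proof. by apply: smoothM; [exact: smooth_cst|exact: smooth_th]. Qed.

Lemma der_tt b u v : is_derive u v (tt b) (lam u * v 0 ord_max).
Proof.
apply: (is_derive_eq (derM (der_cst l%:R u v) (der_th b.2 u v))).
by rewrite mulr0 addr0 mulrA.
Qed.

Lemma der_comp_tt b u v (f : R -> R) f' : is_derive (tt b u) 1 f f' ->
  is_derive u v (fun u => f (tt b u)) (f' * (lam u * v 0 ord_max)).
Proof.
move=> df; apply: is_derive_comp1 => //; first exact: der_tt.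
exact: (Cs_diff u (smooth_tt b 0)).
Qed.

Lemma imm_par b u : immT (par_torus b u) = sr^-1 *: Xc (st b.1 u) (tt b u) /\
  etaT (par_torus b u) = Nc (st b.1 u) (tt b u).
Proof. exact: imm_pt. Qed.

Lemma imm_coord b :
  [/\ forall u i, immT (par_torus b u) 0 (idx i) = sr^-1 * (rr (tt b u) * st b.1 u 0 i),
    forall u, immT (par_torus b u) 0 idx1 = sr^-1 * X1 (tt b u) &
    forall u, immT (par_torus b u) 0 idx2 = sr^-1 * X2 (tt b u)].
Proof.
by split => u *; rewrite (imm_par b u).1 mxE /Xc ?cyl_idx ?cyl_idx1 ?cyl_idx2// mxE.
Qed.

Lemma eta_coord b :
  [/\ forall u i, etaT (par_torus b u) 0 (idx i) = be (tt b u) * ww (tt b u) * st b.1 u 0 i,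
    forall u, etaT (par_torus b u) 0 idx1 = N1 (tt b u) &
    forall u, etaT (par_torus b u) 0 idx2 = N2 (tt b u)].
Proof.
by split => u *; rewrite (imm_par b u).2 /Nc ?cyl_idx ?cyl_idx1 ?cyl_idx2// mxE.
Qed.

Lemma smooth_imm b j : smooth (fun u => immT (par_torus b u) 0 j).
Proof.
have [E E1 E2] := imm_coord b; have s := smooth_tt b.
move: j; apply: idx_cases => [i||].
- under eq_fun do rewrite E; apply: smoothM; first exact: smooth_cst.
  by apply: smoothM; [exact: (smooth_rr gP AA0)|exact: smooth_st].
- under eq_fun do rewrite E1; apply: smoothM; first exact: smooth_cst.
  exact: (smooth_X1 gP AA0 dPhi).
- under eq_fun do rewrite E2; apply: smoothM; first exact: smooth_cst.
  exact: (smooth_X2 gP AA0 dPhi).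
Qed.

Lemma smooth_eta b j : smooth (fun u => etaT (par_torus b u) 0 j).
Proof.
have [E E1 E2] := eta_coord b; have s := smooth_tt b.
move: j; apply: idx_cases => [i||].
- under eq_fun do rewrite E; apply: smoothM; last exact: smooth_st.
  by apply: smoothM; [exact: (smooth_be gP AA0)|exact: (smooth_ww gP AA0)].
- by under eq_fun do rewrite E1; exact: (smooth_N1 gP AA0 dPhi).
- by under eq_fun do rewrite E2; exact: (smooth_N2 gP AA0 dPhi).
Qed.

Lemma derive_imm b u v : 'D_v (immT \o par_torus b) u =
  sr^-1 *: (rr (tt b u) *: cyl (dst b.1 u v) 0 0
    + (lam u * v 0 ord_max * sp (tt b u)) *: Tc (st b.1 u) (tt b u)).
Proof.
apply: derive_val; apply: derive_rV => j; rewrite /comp /Tc.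
have [E E1 E2] := imm_coord b.
move: j; apply: idx_cases => [i||]; rewrite !rV_coord ?cyl_idx ?cyl_idx1 ?cyl_idx2 ?rV_coord.
- under eq_fun do rewrite E.
  have d1 := der_comp_tt v (der_rr gP AA0 (tt b u)).
  apply: (is_derive_eq (derM (der_cst sr^-1 u v) (derM d1 (der_st b.1 u v i)))).
  by ring.
- under eq_fun do rewrite E1.
  have d1 := der_comp_tt v (der_X1 gP AA0 dPhi (tt b u)).
  by apply: (is_derive_eq (derM (der_cst sr^-1 u v) d1)); ring.
- under eq_fun do rewrite E2.
  have d1 := der_comp_tt v (der_X2 gP AA0 dPhi (tt b u)).
  by apply: (is_derive_eq (derM (der_cst sr^-1 u v) d1)); ring.
Qed.

Lemma derive_eta b u v : 'D_v (etaT \o par_torus b) u =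
  (be (tt b u) * ww (tt b u)) *: cyl (dst b.1 u v) 0 0
    + (- (lam u * v 0 ord_max * (k1 (tt b u) * sp (tt b u)))) *: Tc (st b.1 u) (tt b u).
Proof.
apply: derive_val; apply: derive_rV => j; rewrite /comp /Tc.
have [E E1 E2] := eta_coord b.
move: j; apply: idx_cases => [i||]; rewrite !rV_coord ?cyl_idx ?cyl_idx1 ?cyl_idx2 ?rV_coord.
- under eq_fun do rewrite E.
  have d1 := der_comp_tt v (der_be_ww gP AA0 (tt b u)).
  apply: (is_derive_eq (derM d1 (der_st b.1 u v i))).
  by ring.
- under eq_fun do rewrite E1.
  have d1 := der_comp_tt v (der_N1 gP AA0 dPhi (tt b u)).
  by apply: (is_derive_eq d1); ring.
- under eq_fun do rewrite E2.
  have d1 := der_comp_tt v (der_N2 gP AA0 dPhi (tt b u)).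
  by apply: (is_derive_eq d1); ring.
Qed.

End Immersion.

(** * The rotational hypersurfaces *)

Section Hypersurface.
Context {R : realType} (m : nat) (rho : R).
Hypothesis rho0 : 0 < rho.
Local Notation N := m.+1.
Local Notation Gam := (@Gam R m).
Local Notation potx := (@potx R m).

Variables (A0 : R) (g : R -> R).
Hypothesis A00 : 0 < A0.
Hypothesis gP : forall v : R, `|v| <= A0 -> [/\ 0 < g v, N%:R * g v ^+ 6 <= N%:R + 1,
    potx (g v) = v & is_derive v 1 g (Gam (g v))].
Variables (A : R) (Phi : R -> R).
Hypothesis AA0 : `|A| <= A0.
Hypothesis dPhi : forall t : R, is_derive t 1 Phi (kg m g (A * sin t)).
Variables (l p : nat).
Hypothesis l0 : (0 < l)%N.
Hypothesis lp : cA A * (Phi (2 * pi) - Phi 0) * l%:R = 2 * pi * p%:R.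

Local Notation yc := (@yc R g A).
Local Notation rr := (@rr R m g A).
Local Notation ww := (@ww R m g A).
Local Notation sp := (@sp R m g A).
Local Notation k1 := (@k1 R m g A).
Local Notation k2 := (@k2 R m g A).
Local Notation Tc := (@Tc R m g A Phi).
Local Notation d := m.+2.
Local Notation T := (@torus R N : set _).
Implicit Types (w : 'rV[R]_d) (t : R) (x : T) (b : bool * bool) (u v : 'rV[R]_d).

Local Notation sr := (@sr R rho).
Local Notation immT := (@immT R m rho g A Phi l).
Local Notation etaT := (@etaT R m g A Phi l).
Local Notation tt := (@tt R m l).
Local Notation lam := (@lam R m l).

Lemma dst_delta_max (c : bool) u : dst c u (delta_mx 0 ord_max) = 0.
Proof.
have pd0 : pd u (delta_mx 0 ord_max) = 0.
  rewrite /pd big1// => i _; rewrite mxE eqxx /= -val_eqE /= ltn_eqF ?mulr0//.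
apply/rowP; apply: ord_cases => [i|]; rewrite ?dst_inl ?dst_max pd0 [RHS]mxE.
  by rewrite mxE eqxx /= -val_eqE /= ltn_eqF//= !mulr0 !mul0r subr0.
by rewrite mulr0 mul0r oppr0 mulr0.
Qed.

Lemma row_jac (n k : nat) (F : 'rV[R]_n -> 'rV[R]_k) (u : 'rV[R]_n) i :
  row i (jac F u) = 'D_(delta_mx 0 i) F u.
Proof. by apply/rowP => j; rewrite !mxE. Qed.

Definition prcurv t : 'rV[R]_d := \row_i (sr * (if (i < N)%N then k2 t else k1 t)).
Definition gdiag b u : 'rV[R]_d := \row_i (rho^-1 *
  (if (i < N)%N then rr (tt b u) ^+ 2 * (4 / es u ^+ 2) else (lam u * sp (tt b u)) ^+ 2)).

Lemma gdiag_inl b u i : gdiag b u 0 (inl i) = sr ^- 2 * (rr (tt b u) ^+ 2 * (4 / es u ^+ 2)).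
Proof. by rewrite mxE /= ltn_ord (sr_sqr rho0). Qed.

Lemma gdiag_max b u : gdiag b u 0 ord_max = sr ^- 2 * (lam u * sp (tt b u)) ^+ 2.
Proof. by rewrite mxE /= ltnn (sr_sqr rho0). Qed.

Lemma delta_inl i : (delta_mx 0 (inl i) : 'rV[R]_d) 0 ord_max = 0.
Proof. by rewrite mxE eqxx /= -val_eqE /= gtn_eqF. Qed.

Lemma delta_last : (delta_mx 0 ord_max : 'rV[R]_d) 0 ord_max = 1.
Proof. by rewrite mxE !eqxx. Qed.

Lemma prcurv_inl t i : prcurv t 0 (inl i) = sr * k2 t.
Proof. by rewrite mxE /= ltn_ord. Qed.

Lemma prcurv_max t : prcurv t 0 ord_max = sr * k1 t.
Proof. by rewrite mxE /= ltnn. Qed.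

(** The Weingarten equation in a frame of principal directions. The factor [sr] in [prcurv] rescales
    the curvatures from the unit sphere to the sphere of radius [1 / sr]. *)
Lemma jac_eta b u : jac (etaT \o par_torus b) u =
  - diag_mx (prcurv (tt b u)) *m jac (immT \o par_torus b) u.
Proof.
have s0 := lt0r_neq0 (sr_gt0 rho0).
apply/row_matrixP => i; rewrite row_mul row_jac.
have -> : row i (- diag_mx (prcurv (tt b u))) = (- prcurv (tt b u) 0 i) *: delta_mx 0 i.
  by apply/rowP => j; rewrite !mxE eqxx /= eq_sym; case: (j == i); rewrite ?mulr1n ?mulr1 ?mulr0n ?mulr0 ?oppr0.
rewrite -scalemxAl -rowE row_jac (derive_imm rho gP AA0 dPhi lp) (derive_eta rho gP AA0 dPhi lp).
move: i; apply: ord_cases => [i|].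
  rewrite delta_inl !mulr0 !mul0r oppr0 !scale0r !addr0 !scalerA prcurv_inl.
  congr (_ *: _); rewrite (be_ww_k2 gP AA0); field.
  by rewrite s0.
rewrite dst_delta_max delta_last prcurv_max.
have -> : cyl (0 : 'rV[R]_d) 0 0 = 0.
  by apply/rowP; apply: idx_cases => [i||]; rewrite ?cyl_idx ?cyl_idx1 ?cyl_idx2 !mxE.
rewrite !scaler0 !add0r !scalerA; congr (_ *: _).
by field; rewrite s0.
Qed.

Lemma gram_imm b u : jac (immT \o par_torus b) u *m (jac (immT \o par_torus b) u)^T =
  diag_mx (gdiag b u).
Proof.
have s0 := lt0r_neq0 (sr_gt0 rho0).
apply/matrixP => i j.
have -> : (jac (immT \o par_torus b) u *m (jac (immT \o par_torus b) u)^T) i j =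
   dot (row i (jac (immT \o par_torus b) u)) (row j (jac (immT \o par_torus b) u)).
  by rewrite mxE; apply: eq_bigr => k _; rewrite !mxE.
rewrite !row_jac !(derive_imm rho gP AA0 dPhi lp).
have [_ TT _ _] := dot_frame gP Phi AA0 (tt b u) (dot_st b.1 u).
have E v : dot (cyl (dst b.1 u v) 0 0) (Tc (st b.1 u) (tt b u)) = 0.
  by rewrite dot_cyl !mul0r !addr0 dotC dotZl dot_st_dst mulr0.
have E' v : dot (Tc (st b.1 u) (tt b u)) (cyl (dst b.1 u v) 0 0) = 0 by rewrite dotC.
rewrite dotZl dotZr dotDl !dotDr !dotZl !dotZr !E !E' TT.
rewrite dot_cyl !mulr0 !addr0 add0r dot_dst pd_delta [RHS]mxE.
move: i j; apply: ord_cases => [i|]; apply: ord_cases => [j|]; rewrite ?delta_inl ?delta_last ?gdiag_inl ?gdiag_max /= ?ltn_ord ?ltnn /=.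
- case: (inl i == inl j) => /=; rewrite ?mulr1n ?mulr0n; last by rewrite ?mulr0n; ring.
  by field; rewrite s0 gt_eqF// es_gt0.
- have -> : (inl i == ord_max) = false by apply/negbTE; rewrite -val_eqE /= ltn_eqF.
  by rewrite /= !mulr0n; ring.
- have -> : (ord_max == inl j) = false by apply/negbTE; rewrite -val_eqE /= gtn_eqF.
  by rewrite /= !mulr0n; ring.
- by rewrite eqxx mulr1n; field; rewrite s0 gt_eqF ?es_gt0.
Qed.

Lemma gdiag_gt0 b u i : 0 < gdiag b u 0 i.
Proof.
rewrite mxE mulr_gt0 ?invr_gt0//; case: ifP => _; last first.
  by rewrite exprn_gt0// mulr_gt0 ?lam_gt0 ?(sp_gt0 gP AA0).
by rewrite mulr_gt0 ?exprn_gt0 ?(rr_gt0 gP AA0)// divr_gt0 ?exprn_gt0 ?es_gt0.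
Qed.

Lemma gram_unit b u : diag_mx (gdiag b u) \in unitmx.
Proof.
rewrite unitmxE det_diag unitfE; apply/prodf_neq0 => i _.
by rewrite gt_eqF// gdiag_gt0.
Qed.

Lemma imm_row_free b u : row_free (jac (immT \o par_torus b) u).
Proof.
apply/row_freeP; exists ((jac (immT \o par_torus b) u)^T *m invmx (diag_mx (gdiag b u))).
by rewrite mulmxA gram_imm mulmxV// gram_unit.
Qed.

Lemma immT_sphere x : round_sphere rho (immT x).
Proof.
have [w [t [ww -> _]]] := immT_cover rho g A Phi l x.
rewrite /round_sphere /= dotZl dotZr.
have [-> _ _ _] := dot_frame gP Phi AA0 t ww.
by rewrite mulr1 -invfM -expr2 (sr_sqr rho0).
Qed.

Definition rotM : hypersurface m.+3 rho := @Hypersurface R m.+3 rho T immT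
  (bool * bool)%type (fun=> setT) (@par_torus R N)
  (@torus_hausdorff R N) (@torus_connected R N isT)
  (fun=> openT) (fun b u _ => @par_torus_continuous R N b u)
  (fun b u v _ _ => @par_torus_inj R N b u v)
  (fun b A oA _ => @par_torus_open R N b A oA)
  (fun x => let: ex_intro b xb := par_torus_cover x in
     ex_intro _ b (ex_intro2 _ _ _ I (inv_parK xb)))
  immT_sphere
  (fun b => smooth_on_coord (smooth_imm rho gP AA0 dPhi lp b))
  (fun b u _ => imm_row_free b u).

Lemma rotM_closed : closed_hypersurface rotM.
Proof. exact: torus_compact. Qed.

Lemma rotM_normal : @unit_normal _ _ _ rotM etaT.
Proof.
split.
- move=> x; have [w [t [ww _ ->]]] := immT_cover rho g A Phi l x.
  by have [_ _ -> _] := dot_frame gP Phi AA0 t ww.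
- move=> x; have [w [t [ww Ei ->]]] := immT_cover rho g A Phi l x.
  rewrite /imm /= Ei dotC dotZl dotC.
  by have [_ _ _ [-> _ _]] := dot_frame gP Phi AA0 t ww; rewrite mulr0.
- move=> b u _; apply/row_matrixP => i; rewrite row_mul row0 dot_mulmx row_jac.
  rewrite (derive_imm rho gP AA0 dPhi lp) (imm_par rho dPhi lp b u).2.
  rewrite dotZl dotDl !dotZl dot_cyl !mul0r !addr0 (dotC (dst _ _ _)) dotZl dot_st_dst.
  have [_ _ _ [_ E _]] := dot_frame gP Phi AA0 (tt b u) (dot_st b.1 u).
  by rewrite (dotC (Tc _ _)) E !mulr0 addr0 mulr0 raddf0.
- by move=> b; apply: smooth_on_coord; exact: (smooth_eta rho gP AA0 dPhi lp).
Qed.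

Lemma rotM_shape b u : @Defs.shape _ _ _ rotM etaT b u = diag_mx (prcurv (tt b u)).
Proof.
rewrite /Defs.shape /Defs.metric /tangent_frame /=.
rewrite (jac_eta b u) -mulNmx opprK -!mulmxA [X in _ *m X]mulmxA gram_imm mulmxV ?mulmx1//.
exact: gram_unit.
Qed.

(** By [k1_k2] the trace [k1 + N k2] equals [- 2 k1]. *)
Definition Hc t : R := - (2 * sr / d%:R) * k1 t.

Lemma rotM_mean b u : @mean_curvature _ _ _ rotM etaT b u = Hc (tt b u).
Proof.
rewrite /mean_curvature rotM_shape mxtrace_diag big_ord_recr /=.
under eq_bigr => i _ do rewrite mxE /= ltn_ord.
rewrite sumr_const card_ord mxE /= ltnn -mulr_natr /Hc.
have E : N%:R * k2 (tt b u) = - (3 * k1 (tt b u)).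
  by apply/eqP; rewrite -addr_eq0 addrC; apply/eqP; exact: (k1_k2 gP AA0).
have d0 : (d%:R : R) != 0 by rewrite pnatr_eq0.
transitivity ((sr * (N%:R * k2 (tt b u)) + sr * k1 (tt b u)) / d%:R); first by congr (_ / _); ring.
by rewrite E; field.
Qed.

Lemma der_k1 t : exists k1', is_derive t 1 k1 k1'.
Proof.
have dy := der_yc gP AA0 t; eexists; rewrite /k1.
apply: (derM (der_cst _ _ _) (derV _ (derM (der_cst _ _ _) (derM (derX _ dy) (derX _ dy))))).
by rewrite gt_eqF// mulr_gt0// mulr_gt0// (ycX_gt0 gP AA0).
Qed.

(** [H] varies with the circle coordinate only and the metric is diagonal, so the gradient of [H] is
    an eigenvector of the shape operator for [sr * k1]; the scalars cancel because [d * Hc] is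
    [- 2 sr k1]. *)
Lemma rotM_biconservative : @biconservative _ _ _ rotM etaT.
Proof.
move=> b u _; rewrite rotM_shape.
set G := grad_mean_curvature _ _ _.
have [h Eh] : exists h, (\row_k 'D_(delta_mx 0 k) (@mean_curvature _ _ _ rotM etaT b) u : 'rV[R]_d)
    = h *: delta_mx 0 ord_max.
  have -> : @mean_curvature _ _ _ rotM etaT b = (fun u => Hc (tt b u)).
    by apply/funext => v; exact: rotM_mean.
  have [k1' dk] := der_k1 (tt b u).
  have dH : is_derive (tt b u) 1 Hc _ := derM (der_cst (- (2 * sr / d%:R)) (tt b u) 1) dk.
  eexists; apply/rowP => i; rewrite !mxE eqxx /=.
  rewrite (@derive_val _ _ _ _ _ _ _ (der_comp_tt (delta_mx 0 i) dH)).
  rewrite mxE eqxx /= mulrA eq_sym; congr (_ * _).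
have [c Ec] : exists c, G = c *: delta_mx 0 ord_max.
  exists (h / gdiag b u 0 ord_max).
  rewrite /G /grad_mean_curvature Eh /Defs.metric /tangent_frame /= gram_imm.
  apply: (canLR (mulmxK (gram_unit b u))).
  by rewrite -scalemxAl -rowE row_diag_mx scalerA divfK// gt_eqF// gdiag_gt0.
have ES : G *m diag_mx (prcurv (tt b u)) = (sr * k1 (tt b u)) *: G.
  by rewrite Ec -scalemxAl -rowE row_diag_mx mxE /= ltnn !scalerA mulrC.
rewrite ES rotM_mean scalerA -scalerDl.
have d0 : (d%:R : R) != 0 by rewrite pnatr_eq0.
have -> : 2 * (sr * k1 (tt b u)) + d%:R * Hc (tt b u) = 0 by rewrite /Hc; field.
by rewrite scale0r.
Qed.

Hypothesis A_gt0 : 0 < A.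

Lemma chart_time t : - (l%:R * pi) < t < l%:R * pi ->
  exists u : 'rV[R]_d, tt (false, false) u = t.
Proof.
move=> /andP[t1 t2]; have lr : 0 < l%:R :> R by rewrite ltr0n.
exists (const_mx (tan (t / (2 * l%:R)))); rewrite /tt /th mxE addr0 tanK.
  by field; rewrite gt_eqF.
rewrite in_itv/= ltr_pdivlMr ?mulr_gt0// ltr_pdivrMr ?mulr_gt0//; apply/andP; split; nra.
Qed.

(** Equal mean curvatures at [t = 0] and at the apex [t = pi / 2] would force [g 0 = g A], and
    [potx] would turn this into [0 = A]. *)
Lemma rotM_not_CMC : ~ @CMC _ _ _ rotM etaT.
Proof.
move=> [c H].
have pp : 0 < pi :> R by exact: pi_gt0.
have lr : 1 <= l%:R :> R by rewrite ler1n.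
have [|u0 E0] := @chart_time 0; first by apply/andP; split; nra.
have [|u1 E1] := @chart_time (pi / 2); first by apply/andP; split; nra.
have := H (false, false) u0 I; have := H (false, false) u1 I.
rewrite !rotM_mean E0 E1 => <-.
have s0 : - (2 * sr / d%:R) != 0.
  by rewrite oppr_eq0 gt_eqF// divr_gt0 ?mulr_gt0 ?sr_gt0 ?ltr0n.
move=> /(mulfI s0); rewrite /k1.
have n0 : @sN R m * cA A != 0 by rewrite gt_eqF// mulr_gt0 ?sN_gt0 ?(cA_gt0 gP AA0).
move=> /(mulfI n0)/invr_inj; have n3 : (3 : R) != 0 by rewrite pnatr_eq0.
move=> /(mulfI n3); rewrite -!exprD => /eqP.
rewrite eqrXn2 ?ltW ?(yc_gt0 gP AA0)//.
rewrite /yc sin0 mulr0 sin_pihalf mulr1 => /eqP E.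
have [_ _ EA _] := gP AA0.
have [_ _ E00 _] : [/\ 0 < g 0, N%:R * g 0 ^+ 6 <= N%:R + 1, potx (g 0) = 0
    & is_derive (0 : R) 1 g (Gam (g 0))] by apply: gP; rewrite normr0 ltW.
by move: A_gt0; rewrite -EA -E E00 ltxx.
Qed.

End Hypersurface.

(** * Rotational symmetry and the profile curve in arc length *)

Section Rotational.
Context {R : realType} (m : nat) (rho : R).
Hypothesis rho0 : 0 < rho.
Local Notation N := m.+1.
Local Notation Gam := (@Gam R m).
Local Notation potx := (@potx R m).

Variables (A0 : R) (g : R -> R).
Hypothesis A00 : 0 < A0.
Hypothesis gP : forall v : R, `|v| <= A0 -> [/\ 0 < g v, N%:R * g v ^+ 6 <= N%:R + 1,
    potx (g v) = v & is_derive v 1 g (Gam (g v))].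
Variables (A : R) (Phi : R -> R).
Hypothesis AA0 : `|A| <= A0.
Hypothesis dPhi : forall t : R, is_derive t 1 Phi (kg m g (A * sin t)).
Variables (l p : nat).
Hypothesis l0 : (0 < l)%N.
Hypothesis lp : cA A * (Phi (2 * pi) - Phi 0) * l%:R = 2 * pi * p%:R.

Local Notation yc := (@yc R g A).
Local Notation rr := (@rr R m g A).
Local Notation sp := (@sp R m g A).
Local Notation Xc := (@Xc R m g A Phi).
Local Notation Tc := (@Tc R m g A Phi).
Local Notation X1 := (@X1 R m g A Phi).
Local Notation X2 := (@X2 R m g A Phi).
Local Notation d := m.+2.
Local Notation T := (@torus R N : set _).
Implicit Types (w : 'rV[R]_d) (t : R) (x : T) (b : bool * bool) (u v : 'rV[R]_d).

Local Notation sr := (@sr R rho).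
Local Notation immT := (@immT R m rho g A Phi l).
Local Notation rotM := (@rotM R m rho rho0 A0 g gP A Phi AA0 dPhi l p l0 lp).

Lemma torus_rotation (Q : 'M[R]_d.+2) x : rotations Q -> torus (set_val x *m Q).
Proof.
move=> HQ; have [x1 x2] := set_valP x.
have [w' w1 E] := rotation_cyl (hd (set_val x)) HQ.
rewrite [set_val x]cyl_eta -[hd _]scale1r E; split; rewrite ?cylK ?cyl_idx1 ?cyl_idx2//.
by rewrite scale1r w1.
Qed.

(** The action must be total on matrices, hence the identity as default value off the rotations. *)
Definition act (Q : 'M[R]_d.+2) x : T :=
  if pselect (rotations Q) is left h then SigSub (mem_set (torus_rotation x h)) else x.

Lemma actE (Q : 'M[R]_d.+2) x : rotations Q -> set_val (act Q x) = set_val x *m Q.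
Proof. by rewrite /act; case: pselect. Qed.

Lemma Xc_rotation (Q : 'M[R]_d.+2) w : rotations Q ->
  exists2 w', dot w' w' = dot w w & forall t, Xc w t *m Q = Xc w' t.
Proof. by move=> HQ; have [w' w1 E] := rotation_cyl w HQ; exists w' => // t; exact: E. Qed.

Lemma act_continuous (Q : 'M[R]_d.+2) : rotations Q -> continuous (act Q).
Proof.
move=> HQ; apply: continuous_into_subset.
have -> : (fun y : T => set_val (act Q y) : 'rV[R]_d.+2) = (fun y => y *m Q) \o set_val.
  by apply/funext => x; exact: actE.
move=> x; apply: continuous_comp; first exact: initial_continuous.
have H : forall j, smooth (fun y : 'rV[R]_d.+2 => (y *m Q) 0 j).
  move=> j; under eq_fun do rewrite mxE.
  by apply: smooth_sum => i; apply: smoothM; [exact: smooth_coord|exact: smooth_cst].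
exact: (@smooth_on_coord _ _ _ (fun y => y *m Q) H 0%N).
Qed.

Lemma imm_act (Q : 'M[R]_d.+2) x : rotations Q -> immT (act Q x) = immT x *m Q.
Proof.
move=> HQ; have [w' w1 E] := rotation_cyl (hd (set_val x)) HQ.
have Ex : set_val (act Q x) = cyl w' (set_val x 0 idx1) (set_val x 0 idx2).
  by rewrite actE// {1}[set_val x]cyl_eta -{1}[hd _]scale1r E scale1r.
have Ea : ang (act Q x) = ang x by rewrite /ang Ex cyl_idx1 cyl_idx2.
by rewrite /immT Ea Ex cylK -scalemxAl /Xc E.
Qed.

(** The speed depends on [sin t] only, so its minimum over the compact interval [[- pi / 2, pi / 2]]
    is a bound for all [t]. *)
Lemma sp_lower : exists2 del : R, 0 < del & forall t, del <= sp t.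
Proof.
have csp : continuous sp.
  by move=> t; exact: differentiable_continuous (Cs_diff t (smooth_sp gP AA0 smooth_id 0)).
have pp : 0 < pi :> R by exact: pi_gt0.
have [||c cI Hc] := @EVT_min R sp (- (pi / 2)) (pi / 2); first by lra.
  by apply: continuous_subspaceT.
exists (sp c); first exact: (sp_gt0 gP AA0).
move=> t; have st : -1 <= sin t <= 1 by rewrite sin_geN1 sin_le1.
have -> : sp t = sp (asin (sin t)) by rewrite /sp /yc asinK// in_itv.
by apply: Hc; rewrite in_itv/= asin_geNpi2// asin_lepi2.
Qed.

(** The lower bound on the speed makes the arc length function onto, so that its inverse [tau]
    satisfies the differential equation on the whole line. *)
Lemma arclength : exists tau : R -> R,
  (forall s : R, is_derive s 1 tau (sr / sp (tau s))) /\ forall t, exists s, tau s = t.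
Proof.
have [del del0 Hdel] := sp_lower.
have s0 := sr_gt0 rho0.
have ssp := smooth_sp gP AA0 smooth_id.
have [|F dF] := @antiderivative R (fun t => sp t / sr).
  move=> t; have C0 := smoothM ssp (smooth_cst sr^-1) 0%N.
  exact: (differentiable_continuous (Cs_diff t C0)).
have F0 t : 0 < sp t / sr by rewrite divr_gt0// (sp_gt0 gP AA0).
have [tau Htau] := @local_inverse R F (fun t => sp t / sr) setT openT
  (fun _ _ _ _ _ _ => I) (fun z _ => dF z) (fun z _ => F0 z).
have cF : continuous F by move=> t; exact: is_derive_continuous (dF t).
have grow (a1 a2 : R) : a1 <= a2 -> del / sr * (a2 - a1) <= F a2 - F a1.
  move=> ab; have [c _ ->] := mean_value (fun z (_ : a1 <= z <= a2) => dF z) ab.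
  by rewrite ler_wpM2r ?subr_ge0// ler_pM2r ?invr_gt0.
have sF s : exists t, F t = s.
  have ds : 0 < del / sr by rewrite divr_gt0.
  pose K := `|s - F 0| / (del / sr).
  have K0 : 0 <= K by rewrite divr_ge0// ltW.
  have KE : del / sr * K = `|s - F 0| by rewrite mulrC divfK// gt_eqF.
  have [||t _ Et] := @intermediate_value _ F (- K) K s cF; last by exists t.
    by rewrite (le_trans _ K0)// oppr_le0.
  have h1 := grow 0 K K0; have h2 := grow (- K) 0 _.
  rewrite subr0 KE in h1; rewrite sub0r opprK KE in h2.
  have {}h2 := h2 ltac:(by rewrite oppr_le0).
  have := ler_norm (s - F 0); have := ler_norm (- (s - F 0)); rewrite normrN => h3 h4.
  by apply/andP; split; lra.
exists tau; split; last by move=> t; exists (F t); have [] := Htau t I.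
move=> s; have [t <-] := sF s; have [E d'] := Htau t I.
by rewrite E -invf_div.
Qed.

Lemma rotM_rotational : rotational rotM.
Proof.
have s0 := sr_gt0 rho0.
split.
  exists act; split.
  - by move=> x; apply: val_inj; rewrite -[LHS]/(set_val _) actE ?mulmx1//; exact: rotations1.
  - move=> B C x HB HC; apply: val_inj; rewrite -[LHS]/(set_val _) -[RHS]/(set_val _).
    by rewrite !actE ?mulmxA//; exact: rotationsM.
  - exact: act_continuous.
  - by move=> B x HB; exact: imm_act.
have [tau [dtau stau]] := arclength.
have smtau : smooth tau.
  apply: (@smooth_comp _ _ tau (fun s => sr / sp (tau s)) (fun s => s)) => //.
    exact: smooth_id.
  move=> k Hk; have Ctau := Hk.
  apply: CsM; first exact: Cs_cst.
  apply: CsV => [s|]; first by rewrite gt_eqF// (sp_gt0 gP AA0).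
  exact: (Cs_comp_smooth (smooth_sp gP AA0 smooth_id)).
(* The last basis vector before the fixed plane: with it the curve lies in the span of the last
   three basis vectors. *)
pose e : 'rV[R]_d := delta_mx 0 ord_max.
have ee : dot e e = 1.
  by rewrite /dot (bigD1 ord_max)//= !mxE !eqxx mulr1 big1 ?addr0// => j jk;
    rewrite !mxE eqxx /= (negbTE jk) mul0r.
exists (fun s => sr^-1 *: Xc e (tau s)).
  split.
  - apply: smooth_on_coord; apply: idx_cases => [i||].
    + under eq_fun do rewrite rV_coord cyl_idx rV_coord.
      apply: smoothM; first exact: smooth_cst.
      by apply: smoothM; [exact: (smooth_rr gP AA0)|exact: smooth_cst].
    + under eq_fun do rewrite rV_coord cyl_idx1.
      by apply: smoothM; [exact: smooth_cst|exact: (smooth_X1 gP AA0 dPhi)].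
    + under eq_fun do rewrite rV_coord cyl_idx2.
      by apply: smoothM; [exact: smooth_cst|exact: (smooth_X2 gP AA0 dPhi)].
  - move=> s; rewrite /round_sphere /= dotZl dotZr.
    have [-> _ _ _] := dot_frame gP Phi AA0 (tau s) ee.
    by rewrite mulr1 -invfM -expr2 (sr_sqr rho0).
  - move=> s; apply: idx_cases => [i||] /= ki.
    + rewrite rV_coord cyl_idx rV_coord mxE eqxx /= (_ : i == ord_max = false) ?mulr0//.
      by apply/negbTE; rewrite -val_eqE /= ltn_eqF.
    + by have := ltnW ki; rewrite ltnn.
    + by have := ltnW (ltnW ki); rewrite ltnn.
  - move=> s.
    have -> : derive1 (fun s => sr^-1 *: Xc e (tau s)) s = Tc e (tau s).
      rewrite derive1E; apply: derive_val; apply: derive_rV => j.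
      have p0 := lt0r_neq0 (sp_gt0 gP AA0 (tau s)).
      move: j; apply: idx_cases => [i||].
      + under eq_fun do rewrite rV_coord cyl_idx rV_coord; rewrite cyl_idx rV_coord.
        apply: (is_derive_eq (derM (der_cst sr^-1 s 1) (derM (der_comp (dtau s) (der_rr gP AA0 (tau s))) (der_cst (e 0 i) s 1)))).
        by field; rewrite p0 gt_eqF.
      + under eq_fun do rewrite rV_coord cyl_idx1; rewrite cyl_idx1.
        apply: (is_derive_eq (derM (der_cst sr^-1 s 1) (der_comp (dtau s) (der_X1 gP AA0 dPhi (tau s))))).
        by field; rewrite p0 gt_eqF.
      + under eq_fun do rewrite rV_coord cyl_idx2; rewrite cyl_idx2.
        apply: (is_derive_eq (derM (der_cst sr^-1 s 1) (der_comp (dtau s) (der_X2 gP AA0 dPhi (tau s))))).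
        by field; rewrite p0 gt_eqF.
    by have [_ -> _ _] := dot_frame gP Phi AA0 (tau s) ee.
apply/seteqP; split.
  move=> _ [x _ <-]; have [w [t [w1 Ei _]]] := immT_cover rho g A Phi l x.
  have [s Es] := stau t; have [Q HQ HX] := rotation_transitive ee w1.
  exists s, Q; split => //.
  by rewrite /imm /= Ei -scalemxAl Es /Xc HX.
move=> _ [s [Q [HQ ->]]].
have [w' w1 HX] := Xc_rotation e HQ.
rewrite ee in w1.
exists (pt (tau s / l%:R) w1) => //.
rewrite /imm /= (imm_pt rho dPhi lp _ w1).1 -scalemxAl HX mulrCA divff ?mulr1//.
by rewrite pnatr_eq0 -lt0n.
Qed.

End Rotational.

(** * Self-intersections *)

Section NonEmbedded.
Context {R : realType} (m : nat) (rho : R).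
Hypothesis rho0 : 0 < rho.
Local Notation N := m.+1.
Local Notation Gam := (@Gam R m).
Local Notation potx := (@potx R m).

Variables (A0 : R) (g : R -> R).
Hypothesis A00 : 0 < A0.
Hypothesis gP : forall v : R, `|v| <= A0 -> [/\ 0 < g v, N%:R * g v ^+ 6 <= N%:R + 1,
    potx (g v) = v & is_derive v 1 g (Gam (g v))].
Variables (A : R) (Phi : R -> R).
Hypothesis AA0 : `|A| <= A0.
Hypothesis dPhi : forall t : R, is_derive t 1 Phi (kg m g (A * sin t)).
Variables (l p : nat).
Hypothesis l0 : (0 < l)%N.
Hypothesis lp : cA A * (Phi (2 * pi) - Phi 0) * l%:R = 2 * pi * p%:R.

Local Notation yc := (@yc R g A).
Local Notation rr := (@rr R m g A).
Local Notation ww := (@ww R m g A).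
Local Notation ph := (@ph R A Phi).
Local Notation al := (@al R m g A).
Local Notation be := (@be R m g A).
Local Notation sp := (@sp R m g A).
Local Notation Xc := (@Xc R m g A Phi).
Local Notation Tc := (@Tc R m g A Phi).
Local Notation X1 := (@X1 R m g A Phi).
Local Notation X2 := (@X2 R m g A Phi).
Local Notation T1 := (@T1 R m g A Phi).
Local Notation T2 := (@T2 R m g A Phi).
Local Notation d := m.+2.
Local Notation T := (@torus R N : set _).
Implicit Types (w : 'rV[R]_d) (t : R) (x : T) (b : bool * bool) (u v : 'rV[R]_d).

Local Notation sr := (@sr R rho).
Local Notation rotM := (@rotM R m rho rho0 A0 g gP A Phi AA0 dPhi l p l0 lp).

Lemma range_rotM w t : dot w w = 1 -> range (@imm _ _ _ rotM) (sr^-1 *: Xc w t).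
Proof.
move=> w1; exists (pt (t / l%:R) w1) => //.
rewrite /imm /= (imm_pt rho dPhi lp _ w1).1 mulrCA divff ?mulr1//.
by rewrite pnatr_eq0 -lt0n.
Qed.

(* By the reflection symmetry about [pi / 2], the two parameters give the same
   point as soon as the angle has turned by [pi] between [pi / 2] and [t1]. *)
Lemma crossing : pi < cA A * (Phi (2 * pi) - Phi 0) < 2 * pi ->
  exists t1 t2, [/\ cos t1 != 0, yc t2 = yc t1, cos t2 = - cos t1,
    cos (ph t2) = cos (ph t1) & sin (ph t2) = sin (ph t1)].
Proof.
move=> /andP[P1 P2]; set P := cA A * _ in P1 P2.
have pp : 0 < pi :> R by exact: pi_gt0.
have per t : ph (t + 2 * pi) = ph t + P.
  by rewrite /ph (angle_periodic dPhi) mulrDr.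
have odd h : ph (pi / 2 + h) - ph (pi / 2) = ph (pi / 2) - ph (pi / 2 - h).
  by rewrite /ph -!mulrBr (angle_odd dPhi).
have cph : continuous (fun h => ph (pi / 2 + h)).
  move=> h; have ds : is_derive h 1 (fun s : R => pi / 2 + s) (0 + 1) by exact: derD.
  exact: is_derive_continuous (der_comp ds (der_ph gP AA0 dPhi (pi / 2 + h))).
have E1 : ph (pi / 2 + pi) = ph (pi / 2) + P / 2.
  have h1 := per (pi / 2 - pi); have h2 := odd pi.
  have e : pi / 2 - pi + 2 * pi = pi / 2 + pi :> R by lra.
  by rewrite e in h1; lra.
(* As [P / 2 < pi < P], the angle has turned by [pi] strictly between the times [pi] and [2 * pi]
   after the apex, where [cos t1] is nonzero; this makes the crossing transversal. *)
have [||h /andP[h1 h2] /= Eh] := @intermediate_value _ (fun h => ph (pi / 2 + h)) pi (2 * pi) (ph (pi / 2) + pi) cph.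
- by lra.
- by rewrite E1 per; apply/andP; split; lra.
have hp : pi < h.
  rewrite lt_neqAle h1 andbT; apply/eqP => E; move: Eh; rewrite -E E1; lra.
have h2p : h < 2 * pi.
  rewrite lt_neqAle h2 andbT; apply/eqP => E; move: Eh; rewrite E per; lra.
exists (pi / 2 + h), (pi / 2 - h); split.
- rewrite addrC cosDpihalf oppr_eq0.
  have -> : sin h = - sin (h - pi) by rewrite -[in LHS](subrK pi h) sinDpi.
  by rewrite oppr_eq0 gt_eqF// sin_gt0_pi// subr_gt0 hp /=; lra.
- by rewrite /yc ![pi / 2 + _]addrC !sinDpihalf cosN.
- by rewrite ![pi / 2 + _]addrC !cosDpihalf sinN.
- have -> : ph (pi / 2 - h) = ph (pi / 2 + h) - pi *+ 2.
    have := odd h; rewrite Eh -mulr_natr; lra.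
  by rewrite -[in RHS](subrK (pi *+ 2) (ph (pi / 2 + h))) cosD2pi.
- have -> : ph (pi / 2 - h) = ph (pi / 2 + h) - pi *+ 2.
    have := odd h; rewrite Eh -mulr_natr; lra.
  by rewrite -[in RHS](subrK (pi *+ 2) (ph (pi / 2 + h))) sinD2pi.
Qed.

Hypothesis A_gt0 : 0 < A.

Let e : 'rV[R]_d := delta_mx 0 ord_max.

Lemma dot_delta (n : nat) (i j : 'I_n) :
  dot (delta_mx 0 i : 'rV[R]_n) (delta_mx 0 j) = (i == j)%:R.
Proof.
rewrite /dot (bigD1 i)//= !mxE !eqxx mul1r big1 ?addr0// => k ki.
by rewrite !mxE eqxx /= (negbTE ki) mul0r.
Qed.

Lemma dot_delta_r (n : nat) (i : 'I_n) (v : 'rV[R]_n) : dot (delta_mx 0 i) v = v 0 i.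
Proof.
rewrite /dot (bigD1 i)//= !mxE !eqxx mul1r big1 ?addr0// => k ki.
by rewrite !mxE eqxx /= (negbTE ki) mul0r.
Qed.

Lemma der_curve w t : is_derive (0 : R) 1 (fun s => sr^-1 *: Xc w (t + s))
  ((sr^-1 * sp t) *: Tc w t).
Proof.
have ds : is_derive (0 : R) 1 (fun s => t + s) 1 by derive_eq; rewrite add0r.
have shift (f : R -> R) f' : is_derive t 1 f f' -> is_derive (0 : R) 1 (fun s => f (t + s)) f'.
  by rewrite -{1}[t]addr0 => /(der_comp ds); rewrite mulr1.
have c0 (a1 : R) := der_cst a1 (0 : R) 1.
apply: derive_rV => j; move: j; apply: idx_cases => [i||].
- under eq_fun do rewrite rV_coord cyl_idx rV_coord; rewrite rV_coord cyl_idx rV_coord.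
  apply: (is_derive_eq (derM (c0 sr^-1) (derM (shift _ _ (der_rr gP AA0 t)) (c0 (w 0 i))))).
  by ring.
- under eq_fun do rewrite rV_coord cyl_idx1; rewrite rV_coord cyl_idx1.
  apply: (is_derive_eq (derM (c0 sr^-1) (shift _ _ (der_X1 gP AA0 dPhi t)))).
  by ring.
- under eq_fun do rewrite rV_coord cyl_idx2; rewrite rV_coord cyl_idx2.
  apply: (is_derive_eq (derM (c0 sr^-1) (shift _ _ (der_X2 gP AA0 dPhi t)))).
  by ring.
Qed.

Lemma der_orbit (i : 'I_N) t :
  is_derive (0 : R) 1 (fun s => sr^-1 *: Xc (cos s *: e + sin s *: delta_mx 0 (inl i)) t)
  (cyl ((sr^-1 * rr t) *: delta_mx 0 (inl i)) 0 0).
Proof.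
apply: derive_rV => j; move: j; apply: idx_cases => [j||].
- under eq_fun do rewrite rV_coord cyl_idx rV_coord add_coord !scale_coord.
  rewrite cyl_idx rV_coord.
  have dc := der_cos (der_id (0 : R)); have ds := der_sin (der_id (0 : R)).
  have der0 (a : R) := der_cst a (0 : R) 1.
  apply: (is_derive_eq (derM (der0 sr^-1) (derM (der0 (rr t))
    (derD (derM dc (der0 (e 0 j))) (derM ds (der0 (delta_mx 0 (inl i) 0 j))))))).
  by rewrite sin0 cos0; ring.
- by under eq_fun do rewrite rV_coord cyl_idx1; rewrite cyl_idx1; exact: der_cst.
- by under eq_fun do rewrite rV_coord cyl_idx2; rewrite cyl_idx2; exact: der_cst.
Qed.

Lemma rotM_not_embedded : pi < cA A * (Phi (2 * pi) - Phi 0) < 2 * pi -> ~ embedded rotM.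
Proof.
move=> HP [M' [[cimm injimm openimm] HR]].
have [t1 [t2 [ct1 yt ct cp sp']]] := crossing HP.
have s0 := sr_gt0 rho0; have isr0 : sr^-1 != 0 by rewrite invr_eq0 gt_eqF.
have ee : dot e e = 1 by rewrite dot_delta eqxx.
have rt : rr t2 = rr t1 by rewrite /rr yt.
have wt : ww t2 = ww t1 by rewrite /ww /om yt.
have bt : be t2 = be t1 by rewrite /be /om yt.
have at_ : al t2 = - al t1 by rewrite /al /om yt ct mulrN mulNr.
have X12 : Xc e t2 = Xc e t1.
  by rewrite /Xc /X1 /X2 rt wt cp sp'.
pose x0 := sr^-1 *: Xc e t1.
have [p0 _ Ep0] : range (@imm _ _ _ M') x0 by rewrite HR; exact: range_rotM.
have [i [u0 Du0 Eu0]] := par_cover p0.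
pose F := @imm _ _ _ M' \o par i.
have FC : class_C 1 (dom i) F by exact: imm_smooth.
pose J := jac F u0.
(* Here the embedding enters: points of the image close to [x0] come from chart parameters close to
   [u0], so every curve in the image through [x0] is tangent to [M']. *)
have main (nu : 'rV[R]_d.+2) (c : R -> 'rV[R]_d.+2) c' : J *m nu^T = 0 ->
    is_derive (0 : R) 1 c c' -> c 0 = x0 -> (forall s, range (@imm _ _ _ rotM) (c s)) ->
    dot c' nu = 0.
  move=> Jnu dc c0 rc.
  have fr : row_free (jac F u0) by exact: imm_immersion.
  have h := tangent_velocity (@dom_open _ _ _ M' i) Du0 FC fr.
  have h' := h _ _ _ Jnu dc.
  apply: h'.
  - by rewrite c0 /F /= Eu0.
  move=> r r0.
  have oB : open (par i @` (dom i `&` ball u0 r)).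
    apply: par_open; last by move=> u [].
    apply: openI; first exact: dom_open.
    exact: ball_open.
  have [B oB' EB] := openimm _ oB.
  have B0 : B (c 0).
    rewrite c0 -Ep0.
    suff : (@imm _ _ _ M' @^-1` B) p0 by [].
    by rewrite -EB; exists u0 => //; split => //; exact: ballxx.
  have cc : {for 0, continuous c}.
    by apply: differentiable_continuous; apply/derivable1_diffP; case: dc.
  have nB : \forall s \near (0 : R), B (c s).
    by apply: cc; exact: open_nbhs_nbhs.
  apply: filterS nB => s Bcs.
  have : range (@imm _ _ _ M') (c s) by rewrite HR; exact: rc.
  move=> [q _ Eq].
  have : (@imm _ _ _ M' @^-1` B) q by rewrite /preimage /= Eq.
  rewrite -EB => -[u [_ ur] Eu]; exists u; split; last by rewrite /F /= Eu.
  by move: ur; rewrite -ball_normE /ball_/= distrC.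
(* A normal of [M'] is orthogonal to the velocities of both arcs and to the orbit, which leaves only
   the direction of the position vector. *)
have key (nu : 'rV[R]_d.+2) : J *m nu^T = 0 -> exists k, nu = k *: Xc e t1.
  move=> Jnu.
  have h1 : dot (Tc e t1) nu = 0.
    have := main nu _ _ Jnu (der_curve e t1).
    rewrite addr0 dotZl => /(_ erefl (fun s => range_rotM _ ee)) E.
    by apply: (mulfI (mulf_neq0 isr0 (lt0r_neq0 (sp_gt0 gP AA0 t1)))); rewrite mulr0.
  have h2 : dot (Tc e t2) nu = 0.
    have := main nu _ _ Jnu (der_curve e t2).
    rewrite addr0 X12 dotZl => /(_ erefl (fun s => range_rotM _ ee)) E.
    by apply: (mulfI (mulf_neq0 isr0 (lt0r_neq0 (sp_gt0 gP AA0 t2)))); rewrite mulr0.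
  have h3 j : nu 0 (idx (inl j)) = 0.
    have := main nu _ _ Jnu (der_orbit j t1).
    rewrite cos0 sin0 scale1r scale0r addr0 => /(_ erefl).
    have un s : dot (cos s *: e + sin s *: delta_mx 0 (inl j)) (cos s *: e + sin s *: delta_mx 0 (inl j)) = 1.
      rewrite dotDl !dotDr !dotZl !dotZr !dot_delta !eqxx.
      have -> : (ord_max == inl j) = false by apply/negbTE; rewrite -val_eqE /= gtn_eqF.
      have -> : (inl j == ord_max) = false by apply/negbTE; rewrite -val_eqE /= ltn_eqF.
      by rewrite !mulr0 addr0 add0r !mulr1 -!expr2 cos2Dsin2.
    move=> /(_ (fun s => range_rotM _ (un s))).
    rewrite [nu in dot _ nu]cyl_eta dot_cyl !mul0r !addr0 dotZl dot_delta_r mxE => E.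
    by apply: (mulfI (mulf_neq0 isr0 (lt0r_neq0 (rr_gt0 gP AA0 t1)))); rewrite mulr0.
  have ne : nu = cyl (nu 0 (idx ord_max) *: e) (nu 0 idx1) (nu 0 idx2).
    rewrite [LHS]cyl_eta; congr cyl; apply/rowP => j; rewrite mxE.
    move: j; apply: ord_cases => [j|]; rewrite rV_coord mxE eqxx /=.
      by rewrite h3 -val_eqE /= ltn_eqF// mulr0.
    by rewrite eqxx mulr1.
  move: h1 h2; rewrite ne !dot_cyl !dotZl !dotZr ee /T1 /T2 at_ wt rt bt cp sp' !mulr1.
  set a := nu 0 (idx ord_max); set b1 := nu 0 idx1; set b2 := nu 0 idx2.
  have al0 : al t1 != 0.
    rewrite /al mulf_neq0 ?invr_eq0//.
      rewrite mulf_neq0//; apply/eqP => A00'.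
      by move: A_gt0; rewrite A00' ltxx.
    by rewrite mulf_neq0 ?gt_eqF ?(ycX_gt0 gP AA0) ?(om_gt0 gP AA0).
  have be0 := lt0r_neq0 (be_gt0 gP AA0 t1); have ww0 := lt0r_neq0 (ww_gt0 gP AA0 t1).
  move=> h1 h2; set C := cos (ph t1) in h1 h2; set Sn := sin (ph t1) in h1 h2.
  have cs : C ^+ 2 + Sn ^+ 2 = 1 by exact: cos2Dsin2.
  (* Sum and difference of [h1] and [h2]: between the two arcs [al] changes its sign and [be] does
     not, so each coefficient can be isolated. *)
  have e1 : b2 * C = b1 * Sn.
    by apply: (mulfI be0); lra.
  have e2 : ww t1 * a = rr t1 * (b1 * C + b2 * Sn).
    by apply: (mulfI al0); lra.
  exists ((b1 * C + b2 * Sn) / ww t1).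
  rewrite /Xc cylZ scalerA; congr cyl.
  - by congr (_ *: _); apply: (mulfI ww0); rewrite e2; field.
  - rewrite /X1 -/C mulrA divfK//.
    transitivity (b1 * (C ^+ 2 + Sn ^+ 2)); first by rewrite cs mulr1.
    by rewrite mulrDl [b2 * Sn * C]mulrAC e1; ring.
  - rewrite /X2 -/Sn mulrA divfK//.
    transitivity (b2 * (C ^+ 2 + Sn ^+ 2)); first by rewrite cs mulr1.
    by rewrite mulrDl [b1 * C * Sn]mulrAC -e1; ring.
(* The normals form the kernel of [J^T], whose dimension is at least [(n + 1) - (n - 1) = 2]. *)
have rk : (\rank (kermx J^T) <= 1)%N.
  apply: leq_trans (rank_leq_row (Xc e t1)).
  apply: mxrankS; apply/row_subP => j.
  have [|k ->] := key (row j (kermx J^T)); last exact: scalemx_sub.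
  apply: trmx_inj; rewrite trmx_mul trmxK trmx0.
  by apply/sub_kermxP; rewrite row_sub.
move: rk; rewrite mxrank_ker.
have := rank_leq_col J^T; move: (\rank _) => r /= rle; lia.
Qed.

End NonEmbedded.

(** * Congruences *)

Section Congruence.
Context {R : realType} (m : nat) (rho : R).
Hypothesis rho0 : 0 < rho.
Local Notation N := m.+1.
Local Notation Gam := (@Gam R m).
Local Notation potx := (@potx R m).

Variables (A0 : R) (g : R -> R).
Hypothesis A00 : 0 < A0.
Hypothesis gP : forall v : R, `|v| <= A0 -> [/\ 0 < g v, N%:R * g v ^+ 6 <= N%:R + 1,
    potx (g v) = v & is_derive v 1 g (Gam (g v))].
Variables (A : R) (Phi : R -> R).
Hypothesis AA0 : `|A| <= A0.
Hypothesis dPhi : forall t : R, is_derive t 1 Phi (kg m g (A * sin t)).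
Variables (l p : nat).
Hypothesis l0 : (0 < l)%N.
Hypothesis lp : cA A * (Phi (2 * pi) - Phi 0) * l%:R = 2 * pi * p%:R.

Local Notation yc := (@yc R g A).
Local Notation rr := (@rr R m g A).
Local Notation ww := (@ww R m g A).
Local Notation ph := (@ph R A Phi).
Local Notation Xc := (@Xc R m g A Phi).
Local Notation X1 := (@X1 R m g A Phi).
Local Notation X2 := (@X2 R m g A Phi).
Local Notation d := m.+2.
Local Notation T := (@torus R N : set _).
Implicit Types (w : 'rV[R]_d) (t : R) (x : T) (b : bool * bool) (u v : 'rV[R]_d).

Local Notation sr := (@sr R rho).
Local Notation rotM := (@rotM R m rho rho0 A0 g gP A Phi AA0 dPhi l p l0 lp).

Lemma potx_le (a1 c1 : R) : 0 < a1 -> 0 < c1 -> potx a1 <= potx c1 -> a1 <= c1.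
Proof.
move=> a10 c10 le12; case: (leP a1 c1) => // lt21.
have : potx c1 < potx a1.
  apply: (@increasing_deriv _ _ (fun y => (Gam y)^-1)) => // y /andP[y1 _].
    by apply: der_potx; exact: lt_le_trans y1.
  by rewrite invr_gt0 Gam_gt0//; exact: lt_le_trans y1.
by rewrite ltNge le12.
Qed.

Lemma g_le (a1 c1 : R) : `|a1| <= A0 -> `|c1| <= A0 -> a1 <= c1 -> g a1 <= g c1.
Proof.
move=> /gP[a2 _ Ea _] /gP[c2 _ Ec _] le12.
by apply: potx_le => //; rewrite Ea Ec.
Qed.

Lemma yc_le t : 0 <= A -> yc t <= yc (pi / 2).
Proof.
move=> Age0; rewrite /yc; apply: g_le; rewrite ?(sin_amplitude _ AA0)//.
by rewrite sin_pihalf ler_wpM2l// sin_le1.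
Qed.

Lemma srK (a1 : R) : rho * (sr^-1 * (sr^-1 * a1)) = a1.
Proof.
have := sr_gt0 rho0; rewrite -[X in X * _](sr_sqr rho0) => s0.
by field; rewrite gt_eqF.
Qed.

Lemma hdZ (a1 : R) (y : 'rV[R]_d.+2) : hd (a1 *: y) = a1 *: hd y.
Proof. by apply/rowP => i; rewrite !mxE. Qed.

Lemma hd_range (y : 'rV[R]_d.+2) : 0 <= A -> range (@imm _ _ _ rotM) y ->
  rho * dot (hd y) (hd y) <= rr (pi / 2) ^+ 2.
Proof.
move=> Age0 [z _ <-]; rewrite /imm /=.
have [w [t [w1 -> _]]] := immT_cover rho g A Phi l z.
rewrite hdZ dotZl dotZr srK /Xc cylK dotZl dotZr w1 mulr1 -expr2.
have le1 : rr t <= rr (pi / 2).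
  rewrite /rr; apply: ler_wpM2l; first by rewrite divr_ge0 ?sqrtr_ge0.
  by apply: lerXn2r (yc_le t Age0); apply: ltW; exact: (yc_gt0 gP AA0).
by apply: lerXn2r le1; apply: ltW; exact: (rr_gt0 gP AA0).
Qed.

Definition apex (j : nat) : R := pi / 2 + 2 * pi * j%:R.

Lemma apex_yc j : yc (apex j) = yc (pi / 2).
Proof.
by rewrite /yc /apex mulr_natr [2 * pi]mulrC mulr_natr (periodicn (@sinD2pi R)).
Qed.

Lemma apex_ph j : ph (apex j) = ph (pi / 2) + cA A * (Phi (2 * pi) - Phi 0) * j%:R.
Proof.
rewrite /apex; elim: j => [|j IH]; first by rewrite !mulr0 !addr0.
have -> : pi / 2 + 2 * pi * j.+1%:R = pi / 2 + 2 * pi * j%:R + 2 * pi :> R.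
  by rewrite -(natr1 j); ring.
have per s : ph (s + 2 * pi) = ph s + cA A * (Phi (2 * pi) - Phi 0).
  by rewrite /ph (angle_periodic dPhi) mulrDr.
by rewrite per IH -(natr1 j); ring.
Qed.

(* The apexes are the vertices of a regular star polygon. *)
Lemma sum_apex (a b : R) : pi < cA A * (Phi (2 * pi) - Phi 0) < 2 * pi ->
  \sum_(j < l) (a * cos (ph (apex j)) + b * sin (ph (apex j))) ^+ 2
  = l%:R * (a ^+ 2 + b ^+ 2) / 2.
Proof.
move=> /andP[P1 P2].
under eq_bigr do rewrite apex_ph.
move: lp P1 P2; set P := cA A * _; set q := ph _ => lP P1 P2.
have sP : sin P != 0.
  rewrite -(subrK pi P) sinDpi oppr_eq0 gt_eqF// sin_gt0_pi// subr_gt0 P1 /=; lra.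
(* Multiplied by [2 sin P], which is nonzero as [pi < P < 2 pi], the sum telescopes; its ends agree
   because [l * P] is a multiple of [2 pi]. *)
have tele c : \sum_(j < l) cos (c + 2 * (P * j%:R)) = 0.
  apply: (mulfI (mulf_neq0 (lt0r_neq0 (ltr0n R 2)) sP)); rewrite mulr0 mulr_sumr.
  pose f (j : nat) := sin (c - P + 2 * (P * j%:R)).
  transitivity (\sum_(0 <= j < l) (f j.+1 - f j)).
    rewrite big_mkord; apply: eq_bigr => j _.
    rewrite /f; set h := c + 2 * (P * j%:R).
    have -> : c - P + 2 * (P * j.+1%:R) = h + P by rewrite /h -(natr1 j); ring.
    have -> : c - P + 2 * (P * j%:R) = h - P by rewrite /h; ring.
    by rewrite sinD sinB; ring.
  rewrite telescope_sumr// /f lP mulr0 mulr0 addr0.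
  have -> : 2 * (2 * pi * p%:R) = (pi *+ 2) *+ (2 * p) :> R.
    by rewrite -[RHS]mulr_natr -[pi *+ 2]mulr_natr natrM; ring.
  by rewrite (periodicn (@sinD2pi R)) subrr.
(* Double angle formulas split the square into its mean and two oscillating terms; the sine is
   written as a cosine shifted by [pi / 2] so that [tele] handles both. *)
transitivity (\sum_(j < l) ((a ^+ 2 + b ^+ 2) / 2
    + (a ^+ 2 - b ^+ 2) / 2 * cos (2 * q + 2 * (P * j%:R))
    + a * b * cos (2 * q - pi / 2 + 2 * (P * j%:R)))).
  apply: eq_bigr => j _; set h := q + P * j%:R.
  have -> : 2 * q + 2 * (P * j%:R) = h *+ 2 by rewrite -[RHS]mulr_natr /h; ring.
  have -> : 2 * q - pi / 2 + 2 * (P * j%:R) = h *+ 2 - pi / 2 by rewrite -[h *+ 2]mulr_natr /h; ring.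
  rewrite cosBpihalf sin_mulr2n cos_mulr2n -[_ ^+ 2 *+ 2]mulr_natr -[(_ * _) *+ 2]mulr_natr.
  have := cos2Dsin2 h; set C := cos h; set Sn := sin h => e.
  have -> : (a * C + b * Sn) ^+ 2 = (C ^+ 2 + Sn ^+ 2 - C ^+ 2) * b ^+ 2 + a ^+ 2 * C ^+ 2
      + 2 * a * b * C * Sn by ring.
  by rewrite e; field.
rewrite !big_split /= -!mulr_sumr !tele !mulr0 !addr0 sumr_const card_ord -[_ *+ l]mulr_natl.
by ring.
Qed.

Lemma apex_ww j : ww (apex j) = ww (pi / 2).
Proof. by rewrite /ww /om apex_yc. Qed.

Lemma apex_rr j : rr (apex j) = rr (pi / 2).
Proof. by rewrite /rr apex_yc. Qed.

(** After clearing denominators this is the cap [N y^6 <= N + 1] that [g] satisfies. *)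
Lemma rr_half t : 2 * rr t ^+ 2 <= d%:R * ww t ^+ 2.
Proof.
have e := rr_ww gP AA0 t.
have -> : ww t ^+ 2 = 1 - rr t ^+ 2 by lra.
have [_ h _ _] := gP (sin_amplitude t AA0).
have -> : rr t ^+ 2 = N%:R * yc t ^+ 6 / (N%:R + 3).
  by rewrite /rr exprMn expr_div_n sM_sqr sN_sqr -exprM mulrAC.
have N0 : 0 < N%:R + 3 :> R by rewrite ltr_wpDl.
move: h; rewrite -/(yc t); move: (N%:R * _) => z h.
rewrite -[d%:R]natr1 -subr_ge0.
have -> : (N%:R + 1) * (1 - z / (N%:R + 3)) - 2 * (z / (N%:R + 3)) = N%:R + 1 - z.
  by field; rewrite gt_eqF.
by rewrite subr_ge0.
Qed.

(** The sum is a diagonal quadratic form in [v], with the eigenvalue [2 l r^2] on the factor where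
    the rotations act and [l d W^2] on the fixed plane. By [rr_half] the first is the smaller
    one. *)
Lemma sum_dot_apex (v : 'rV[R]_d.+2) : pi < cA A * (Phi (2 * pi) - Phi 0) < 2 * pi ->
  dot v v = 1 ->
  l%:R * (2 * rr (pi / 2) ^+ 2) <=
  \sum_(j < l) \sum_(i < d) (dot (Xc (delta_mx 0 i) (apex j)) v ^+ 2
    + dot (Xc (- delta_mx 0 i) (apex j)) v ^+ 2).
Proof.
move=> HP; rewrite (cyl_eta v) dot_cyl.
move: (hd v) (v 0 idx1) (v 0 idx2) => h a b v1.
set r := rr (pi / 2); set W := ww (pi / 2).
pose s j := a * cos (ph (apex j)) + b * sin (ph (apex j)).
have -> : \sum_(j < l) \sum_(i < d) (dot (Xc (delta_mx 0 i) (apex j)) (cyl h a b) ^+ 2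
    + dot (Xc (- delta_mx 0 i) (apex j)) (cyl h a b) ^+ 2)
  = \sum_(j < l) (2 * r ^+ 2 * dot h h + 2 * d%:R * W ^+ 2 * s j ^+ 2).
  apply: eq_bigr => j _.
  transitivity (\sum_(i < d) (2 * r ^+ 2 * (h 0 i * h 0 i) + 2 * W ^+ 2 * s j ^+ 2)).
    apply: eq_bigr => i _.
    rewrite /Xc /X1 /X2 !dot_cyl apex_rr apex_ww -/r -/W scalerN -scaleNr !dotZl.
    by rewrite dot_delta_r /s; ring.
  rewrite big_split /= -mulr_sumr sumr_const card_ord -[_ *+ d]mulr_natl.
  by congr (_ + _); ring.
have Ss : \sum_(j < l) s j ^+ 2 = l%:R * (a ^+ 2 + b ^+ 2) / 2 by exact: sum_apex.
rewrite big_split /= sumr_const card_ord -[_ * dot h h *+ l]mulr_natl -mulr_sumr Ss.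
have -> : l%:R * (2 * r ^+ 2 * dot h h) + 2 * d%:R * W ^+ 2 * (l%:R * (a ^+ 2 + b ^+ 2) / 2)
  = l%:R * (2 * r ^+ 2 * dot h h + d%:R * W ^+ 2 * (a ^+ 2 + b ^+ 2)) by field.
rewrite ler_wpM2l//; have -> : dot h h = 1 - (a ^+ 2 + b ^+ 2) by lra.
have ab0 : 0 <= a ^+ 2 + b ^+ 2 by rewrite addr_ge0 ?sqr_ge0.
have := rr_half (pi / 2); rewrite -/r -/W; set D := d%:R => H.
rewrite -subr_ge0.
have -> : 2 * r ^+ 2 * (1 - (a ^+ 2 + b ^+ 2)) + D * W ^+ 2 * (a ^+ 2 + b ^+ 2) - 2 * r ^+ 2
  = (D * W ^+ 2 - 2 * r ^+ 2) * (a ^+ 2 + b ^+ 2) by ring.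
by rewrite mulr_ge0 ?subr_ge0.
Qed.

(* Averaging over the points of maximal distance to the axis. *)
Lemma rr_le_isometry (Q : 'M[R]_d.+2) (B : R) : pi < cA A * (Phi (2 * pi) - Phi 0) < 2 * pi ->
  orthogonal_mx Q ->
  (forall y, range (@imm _ _ _ rotM) y -> rho * dot (hd (y *m Q)) (hd (y *m Q)) <= B) ->
  rr (pi / 2) ^+ 2 <= B.
Proof.
move=> HP QQ HB.
have QTQ : Q^T *m Q = 1%:M by exact: mulmx1C.
(* The first [d] columns of [Q] are unit vectors, and the squared distance of [y *m Q] to the axis
   is the sum of the squared components of [y] along them. *)
pose q (k : 'I_d) : 'rV[R]_d.+2 := (col (idx k) Q)^T.
have q1 k : dot (q k) (q k) = 1.
  have /matrixP/(_ (idx k) (idx k)) := QTQ; rewrite !mxE eqxx mulr1n => <-.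
  by rewrite /dot; apply: eq_bigr => i _; rewrite !mxE.
have qE (y : 'rV[R]_d.+2) : dot (hd (y *m Q)) (hd (y *m Q)) = \sum_k dot y (q k) ^+ 2.
  rewrite /dot; apply: eq_bigr => k _; rewrite !mxE -expr2; congr (_ ^+ 2).
  by apply: eq_bigr => i _; rewrite !mxE.
have HX w t : dot w w = 1 -> \sum_k dot (Xc w t) (q k) ^+ 2 <= B.
  move=> w1; have := HB _ (range_rotM rho0 gP AA0 dPhi l0 lp t w1).
  rewrite -scalemxAl.
  by rewrite hdZ dotZl dotZr qE srK.
have ld : 0 < (l * d)%:R :> R by rewrite ltr0n muln_gt0 l0.
(* [2 l d] is the number of points averaged over: [l] apexes, each with the [2 d] points of an
   orthogonal cross. *)
rewrite -(ler_pM2l (mulr_gt0 ld (ltr0n R 2))).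
apply: (@le_trans _ _ (\sum_(k < d) (l%:R * (2 * rr (pi / 2) ^+ 2)))).
  by rewrite sumr_const card_ord -[X in _ <= X]mulr_natl natrM le_eqVlt; apply/orP; left; apply/eqP; ring.
apply: (le_trans (ler_sum _ (fun (k : 'I_d) _ => sum_dot_apex HP (q1 k)))).
rewrite exchange_big /=.
under eq_bigr do rewrite exchange_big /=.
apply: (@le_trans _ _ (\sum_(j < l) \sum_(i < d) (B + B))).
  apply: ler_sum => j _; apply: ler_sum => i _; rewrite big_split /=.
  apply: lerD; apply: HX; first by rewrite dot_delta eqxx.
  by rewrite -scaleN1r dotZl dotZr dot_delta eqxx !mulN1r opprK.
rewrite !sumr_const !card_ord -[X in X <= _]mulr_natl -[(B + B) *+ d]mulr_natl natrM le_eqVlt; apply/orP; left; apply/eqP; ring.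
Qed.

End Congruence.

Section Distinct.
Context {R : realType} (m : nat) (rho : R).
Hypothesis rho0 : 0 < rho.
Variables (A0 : R) (g : R -> R).
Hypothesis gP : forall v : R, `|v| <= A0 -> [/\ 0 < g v, m.+1%:R * g v ^+ 6 <= m.+1%:R + 1,
    @potx R m (g v) = v & is_derive v 1 g (@Gam R m (g v))].

Lemma congruent_amplitude A A' Phi Phi' (AA0 : `|A| <= A0) (AA0' : `|A'| <= A0)
  dPhi dPhi' l l' p p' l0 l0' lp lp' :
  0 < A -> 0 < A' ->
  pi < cA A * (Phi (2 * pi) - Phi 0) < 2 * pi ->
  pi < cA A' * (Phi' (2 * pi) - Phi' 0) < 2 * pi ->
  congruent (@rotM R m rho rho0 A0 g gP A Phi AA0 dPhi l p l0 lp)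
    (@rotM R m rho rho0 A0 g gP A' Phi' AA0' dPhi' l' p' l0' lp') -> A = A'.
Proof.
move=> Ap Ap' HP HP' [Q QQ E].
have QTQ : Q^T *m Q = 1%:M by exact: mulmx1C.
have le1 : @rr R m g A (pi / 2) ^+ 2 <= @rr R m g A' (pi / 2) ^+ 2.
  apply: (rr_le_isometry (rho0 := rho0) (gP := gP) (AA0 := AA0) (dPhi := dPhi)
    (l0 := l0) (lp := lp) HP QQ).
  move=> y Hy; apply: (hd_range (rho0 := rho0) (gP := gP) (AA0 := AA0') (dPhi := dPhi')
    (l0 := l0') (lp := lp') (ltW Ap')).
  by rewrite E; exists y.
have le2 : @rr R m g A' (pi / 2) ^+ 2 <= @rr R m g A (pi / 2) ^+ 2.
  apply: (rr_le_isometry (rho0 := rho0) (gP := gP) (AA0 := AA0') (dPhi := dPhi')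
    (l0 := l0') (lp := lp') (Q := Q^T) HP').
    by rewrite /orthogonal_mx trmxK.
  move=> y; rewrite E => -[z Hz <-]; rewrite -mulmxA QQ mulmx1.
  exact: (hd_range (rho0 := rho0) (gP := gP) (AA0 := AA0) (dPhi := dPhi) (l0 := l0) (lp := lp) (ltW Ap)).
have r0 := rr_gt0 gP AA0 (pi / 2); have r0' := rr_gt0 gP AA0' (pi / 2).
have er : @rr R m g A (pi / 2) = @rr R m g A' (pi / 2).
  have e2 := le_anti (introT andP (conj le1 le2)).
  by apply: (pexpIrn (n := 2)); rewrite // ?nnegrE; apply: ltW.
have c0 : @sN R m / @sM R m != 0 by rewrite lt0r_neq0// divr_gt0 ?sN_gt0 ?sM_gt0.
have [g0 _ gA _] := gP AA0; have [g0' _ gA' _] := gP AA0'.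
move: er; rewrite /rr /yc sin_pihalf !mulr1 => /(mulfI c0) e3.
have eg : g A = g A' by apply: (pexpIrn (n := 3)); rewrite // ?nnegrE; apply: ltW.
by rewrite -gA -gA' eg.
Qed.

End Distinct.

(** * The biparametric family *)

Theorem theorem5p2 (R : realType) (n : nat) (rho : R) :
  (3 <= n)%N -> 0 < rho ->
  exists (M : nat -> nat -> hypersurface n rho)
         (eta : forall p q, M p q -> 'rV[R]_n.+1),
    (forall p q,
        closed_hypersurface (M p q) /\
        unit_normal (eta p q) /\
        ~ CMC (eta p q) /\
        biconservative (eta p q) /\
        rotational (M p q) /\
        ~ embedded (M p q)) /\
    (forall p q p' q', congruent (M p q) (M p' q') -> p = p' /\ q = q').
Proof.
case: n => [|[|[|m]]] // _ rho0.
have [A0 [g [A00 gP]]] := @inverse_profile R m.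
have [Phi dPhi] := angle_exists gP.
have [A [p [l [injA A_itv l0 HP]]]] := rational_amplitudes A00 gP dPhi.
have Ap j : 0 < A j by have /andP[] := A_itv j.
have AA0 j : `|A j| <= A0.
  by rewrite gtr0_norm//; have /andP[] := A_itv j.
(* An injective coding of pairs of naturals arranges the sequence of amplitudes in a family with two
   indices. *)
pose J (a b : nat) : nat := pickle (a, b).
have Jinj a b a' b' : J a b = J a' b' -> a = a' /\ b = b'.
  by move=> /(pcan_inj (@pickleK (nat * nat)%type))[-> ->].
pose M a b : hypersurface m.+3 rho :=
  rotM rho0 gP (AA0 (J a b)) (dPhi _ (AA0 (J a b))) (l0 (J a b)) (HP (J a b)).2.
exists M, (fun a b => etaT g (A (J a b)) (Phi (A (J a b))) (l (J a b))); split.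
  move=> a b; split; first exact:
    (@rotM_closed R m rho rho0 A0 g gP _ _ (AA0 _) (dPhi _ (AA0 _)) _ _ (l0 _) (HP _).2).
  split; first exact:
    (@rotM_normal R m rho rho0 A0 g gP _ _ (AA0 _) (dPhi _ (AA0 _)) _ _ (l0 _) (HP _).2).
  split; first exact:
    (@rotM_not_CMC R m rho rho0 A0 g A00 gP _ _ (AA0 _) (dPhi _ (AA0 _)) _ _ (l0 _) (HP _).2
      (Ap _)).
  split; first exact:
    (@rotM_biconservative R m rho rho0 A0 g gP _ _ (AA0 _) (dPhi _ (AA0 _)) _ _ (l0 _) (HP _).2).
  split; first exact:
    (@rotM_rotational R m rho rho0 A0 g gP _ _ (AA0 _) (dPhi _ (AA0 _)) _ _ (l0 _) (HP _).2).
  exact: (@rotM_not_embedded R m rho rho0 A0 g A00 gP _ _ (AA0 _) (dPhi _ (AA0 _)) _ _ (l0 _)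
    (HP _).2 (Ap _) (HP _).1).
move=> a b a' b' C; apply: Jinj; apply: injA.
exact: (congruent_amplitude (Ap _) (Ap _) (HP _).1 (HP _).1 C).
Qed.
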